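(* Let $E=x\partial_x+y\partial_y$, $T=-y\partial_x+x\partial_y$, let $\tau>0$ and let $\pi_\tau=(\tau E+T)\wedge\partial_z$ on $\mathbb{R}^3$. The Poisson cohomology groups $H^\bullet(\mathbb{R}^3,\pi_\tau)$ are uniquely characterized by the following representatives: - the Casimir functions are the constants, $H^0(\mathbb{R}^3,\pi_\tau)=\mathbb{R}$; - $H^1(\mathbb{R}^3,\pi_\tau)$ is a free module over the Casimir functions with generators the classes of $E$ and $\partial_z$; - $H^2(\mathbb{R}^3,\pi_\tau)$ is a free module over the Casimir functions with one generator, the class of $E\wedge\partial_z$; - $H^3(\mathbb{R}^3,\pi_\tau)=0$. Moreover, the algebraic structure (wedge product and Schouten–Nijenhuis bracket on cohomology) is given by the operations on these representatives.
   Context: For a Poisson structure $\pi$ on a manifold $M$ (a bivector field with $[\pi,\pi]=0$, where $[\cdot,\cdot]$ is the Schouten–Nijenhuis bracket), the Poisson cohomology $H^\bullet(M,\pi)$ is the cohomology of the complex $(\mathfrak{X}^\bullet(M),d_\pi:=[\pi,\cdot])$ of smooth multivector fields. The wedge product and Schouten–Nijenhuis bracket descend to $H^\bullet(M,\pi)$. Coordinates on $\mathbb{R}^3$ are $(x,y,z)$. *)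

(* Defs.v *)
(* Poisson cohomology of R^n, on top of MathComp and MathComp-Analysis *)
From HB Require Import structures.
From mathcomp Require Import all_boot all_order all_algebra.
From mathcomp Require Import all_classical all_reals all_analysis.
Set Implicit Arguments.
Unset Strict Implicit.
Unset Printing Implicit Defensive.
Import Order.TTheory GRing.Theory Num.Theory.
Import numFieldNormedType.Exports.
Local Open Scope ring_scope.
Local Open Scope quotient_scope.

Section SmoothFunctions.
Context {R : realType} {n : nat}.
Implicit Types (f g : 'rV[R]_n -> R) (i : 'I_n).

Definition pderive i f : 'rV[R]_n -> R := fun v => 'D_(delta_mx 0 i) f v.

(* f is C^k: all its iterated partial derivatives of order <= k exist and are
   continuous *)
Fixpoint Ck (k : nat) f : Prop :=
  continuous f /\
  if k is k'.+1 then
    forall i, (forall v, derivable f v (delta_mx 0 i)) /\ Ck k' (pderive i f)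
  else True.

Definition smooth : {pred 'rV[R]_n -> R} := [pred f | `[< forall k, Ck k f >]].

Lemma Ck_cst k (c : R) : Ck k (cst c : 'rV[R]_n -> R).
Proof.
have cc (a : R) : continuous (cst a : 'rV[R]_n -> R) by exact: cst_continuous.
elim: k c => [|k IH] c; split=> //.
move=> i; split=> [v|]; first exact: derivable_cst.
suff -> : pderive i (cst c) = cst 0 by [].
by apply/funext => v; rewrite /pderive derive_cst.
Qed.

Lemma Ck_continuous k f : Ck k f -> continuous f.
Proof. by case: k => [|k] []. Qed.

Lemma Ck_pred k f : Ck k.+1 f -> Ck k f.
Proof.
elim: k f => [|k IH] f; first by move=> [].
move=> [cf H]; split=> // i; have [df Cf] := H i.
by split=> //; exact: IH.
Qed.

Lemma CkB k f g : Ck k f -> Ck k g -> Ck k (f - g).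
Proof.
elim: k f g => [|k IH] f g /= [cf Hf] [cg Hg]; split=> //.
- by move=> v; apply: continuousB; [exact: cf|exact: cg].
- by move=> v; apply: continuousB; [exact: cf|exact: cg].
move=> i; have [df Cf] := Hf i; have [dg Cg] := Hg i.
split=> [v|]; first exact: derivableB.
suff -> : pderive i (f - g) = pderive i f - pderive i g by exact: IH.
by apply/funext => v; rewrite /pderive deriveB.
Qed.

Lemma CkD k f g : Ck k f -> Ck k g -> Ck k (f + g).
Proof.
move=> Cf Cg; rewrite -[g]opprK -[- g]sub0r; apply: CkB => //.
by apply: CkB => //; exact: Ck_cst.
Qed.

Lemma CkM k f g : Ck k f -> Ck k g -> Ck k (f * g).
Proof.
elim: k f g => [|k IH] f g; first last.
  move=> Cf Cg; have [Cf' Cg'] := (Ck_pred Cf, Ck_pred Cg).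
  case: Cf Cg => [cf Hf] [cg Hg]; split.
    by move=> v; apply: continuousM; [exact: cf|exact: cg].
  move=> i; have [df dCf] := Hf i; have [dg dCg] := Hg i.
  split=> [v|]; first exact: derivableM.
  suff -> : pderive i (f * g) = f * pderive i g + g * pderive i f.
    by apply: CkD; exact: IH.
  by apply/funext => v; rewrite /pderive deriveM.
move=> [cf _] [cg _]; split=> // v.
by apply: continuousM; [exact: cf|exact: cg].
Qed.

Lemma smooth_subring_closed : subring_closed smooth.
Proof.
split=> [|f g /asboolP Cf /asboolP Cg|f g /asboolP Cf /asboolP Cg];
  apply/asboolP => k.
- exact: Ck_cst.
- exact: CkB.
- exact: CkM.
Qed.

Lemma smooth_scaler_closed : GRing.scaler_closed (smooth : {pred 'rV[R]_n -> R^o}).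
Proof.
by move=> a f /asboolP Cf; apply/asboolP => k; apply: CkM => //; exact: Ck_cst.
Qed.

HB.instance Definition _ := GRing.isSubringClosed.Build _ smooth smooth_subring_closed.
HB.instance Definition _ :=
  GRing.isScaleClosed.Build R ('rV[R]_n -> R) smooth smooth_scaler_closed.

Lemma pderive_smooth i f : f \in smooth -> pderive i f \in smooth.
Proof. by move=> /asboolP Cf; apply/asboolP => k; case: (Cf k.+1) => _ /(_ i)[]. Qed.

Lemma coord_smooth i : (fun v : 'rV[R]_n => v 0 i) \in smooth.
Proof.
apply/asboolP => k.
have cc : continuous (fun v : 'rV[R]_n => v 0 i) by exact: coord_continuous.
case: k => [|k]; split=> // j.
have dc v : derivable (fun w : 'rV[R]_n => w 0 i) v (delta_mx 0 j).
  have H := (@derivable_mxP R _ 1 n id v (delta_mx 0 j)).1 (@derivable_id _ _ v _).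
  exact: H 0 i.
split=> //.
suff -> : pderive j (fun w : 'rV[R]_n => w 0 i) = cst (i == j)%:R by exact: Ck_cst.
apply/funext => v; rewrite /pderive /=.
have := derive_mx (@derivable_id _ _ v (delta_mx 0 j : 'rV[R]_n)).
by move=> /matrixP/(_ 0 i); rewrite derive_id !mxE /= => <-.
Qed.

End SmoothFunctions.

Record smoothfun (R : realType) (n : nat) :=
  SmoothFun { sfun :> 'rV[R]_n -> R ; _ : sfun \in smooth }.
HB.instance Definition _ R n := [isSub for @sfun R n].
HB.instance Definition _ R n := [Choice of smoothfun R n by <:].
HB.instance Definition _ R n := [SubChoice_isSubComNzRing of smoothfun R n by <:].
HB.instance Definition _ R n := [SubZmodule_isSubLmodule of smoothfun R n by <:].

Section MultivectorFields.
Context {R : realType} {n : nat}.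
Local Notation C := (smoothfun R n).

Definition partial (i : 'I_n) (f : C) : C := SmoothFun (pderive_smooth i (valP f)).

Definition coord (i : 'I_n) : C := SmoothFun (coord_smooth i).

Lemma partial_is_linear i : linear (partial i).
Proof.
have drv (f : C) v : derivable (f : 'rV[R]_n -> R) v (delta_mx 0 i).
  by have /asboolP/(_ 1%N)[_ /(_ i)[]] := valP f.
move=> a f g; apply/val_inj/funext => v.
rewrite /= /pderive deriveD ?deriveZ//; exact: derivableZ.
Qed.

HB.instance Definition _ i :=
  GRing.isLinear.Build R C C _ (partial i) (partial_is_linear i).

(* Multivector fields of all degrees on R^n: P stands for the sum over I of
   P I * d/dx_{i_1} /\ ... /\ d/dx_{i_k}, where I = {i_1 < ... < i_k}. *)
Definition mvf := {ffun {set 'I_n} -> C}.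

HB.instance Definition _ := GRing.Lmodule.on mvf.

Implicit Types P Q : mvf.

Definition homogeneous (k : nat) P := forall I : {set 'I_n}, #|I| != k -> P I = 0.

Definition mvf_fun (f : C) : mvf := [ffun I : {set 'I_n} => if I == finset.set0 then f else 0].

Definition mvf_partial (i : 'I_n) : mvf := [ffun I : {set 'I_n} => if I == [set i] then 1 else 0].

(* the number of transpositions needed to sort the concatenation of I and J *)
Definition inversions (I J : {set 'I_n}) : nat :=
  #|[set p in finset.setX I J | (p.2 < p.1)%N]|.

Definition wedge P Q : mvf :=
  [ffun K : {set 'I_n} => \sum_(I : {set 'I_n} | I \subset K)
    (-1) ^+ inversions I (K :\: I) * (P I * Q (K :\: I))].

Definition mvf_dx (i : 'I_n) P : mvf := [ffun I => partial i (P I)].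

(* Left and right derivatives with respect to the odd variable d/dx_i, i.e.
   contraction with dx_i in the first and in the last slot *)
Definition lcontr (i : 'I_n) P : mvf :=
  [ffun I : {set 'I_n} => if i \in I then 0 else (-1) ^+ inversions [set i] I * P (i |: I)].
Definition rcontr (i : 'I_n) P : mvf :=
  [ffun I : {set 'I_n} => if i \in I then 0 else (-1) ^+ inversions I [set i] * P (i |: I)].

(* Schouten-Nijenhuis bracket, in the convention where, for a vector field X,
   [X, f] = X(f) and [X, -] is the Lie derivative, and where
   [P, Q /\ S] = [P, Q] /\ S + (-1)^((p-1)q) Q /\ [P, S]. *)
Definition schouten P Q : mvf :=
  \sum_(i < n) (wedge (rcontr i P) (mvf_dx i Q) - wedge (mvf_dx i P) (lcontr i Q)).

Lemma smoothfun_scaleAr (a : R) (f g : C) : f * (a *: g) = a *: (f * g).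
Proof. by apply/val_inj/funext => v; exact: mulrCA. Qed.

Lemma wedge_linearr P : linear (wedge P).
Proof.
move=> a Q S; apply/ffunP => K; rewrite !ffunE scaler_sumr -big_split /=.
apply: eq_bigr => I _.
by rewrite !ffunE mulrDr smoothfun_scaleAr mulrDr smoothfun_scaleAr.
Qed.

Lemma mvf_dx_is_linear i : linear (mvf_dx i).
Proof. by move=> a Q S; apply/ffunP => K; rewrite !ffunE linearP. Qed.

Lemma lcontr_is_linear i : linear (lcontr i).
Proof.
move=> a Q S; apply/ffunP => K; rewrite !ffunE; case: ifP => _.
  by rewrite scaler0 addr0.
by rewrite mulrDr smoothfun_scaleAr.
Qed.

Lemma schouten_is_linear P : linear (schouten P).
Proof.
move=> a Q S; rewrite /schouten scaler_sumr -big_split /=.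
apply: eq_bigr => i _.
by rewrite mvf_dx_is_linear lcontr_is_linear !wedge_linearr scalerBr opprD addrACA.
Qed.

HB.instance Definition _ P :=
  GRing.isLinear.Build R mvf mvf _ (schouten P) (schouten_is_linear P).

Definition poisson P := homogeneous 2 P /\ schouten P P = 0.

End MultivectorFields.

Arguments mvf R n : clear implicits.

Section PoissonCohomology.
Context {R : realType} {n : nat}.
Variables (pi : mvf R n) (k : nat).

Definition cocycle_pred : {pred mvf R n} :=
  [pred P | `[< homogeneous k P >] && (schouten pi P == 0)].

Lemma cocycle_submod_closed : submod_closed cocycle_pred.
Proof.
split=> [|a P Q].
  by rewrite inE /= linear0 eqxx andbT; apply/asboolP => I _; rewrite ffunE.
rewrite !inE /= => /andP[/asboolP hP /eqP dP] /andP[/asboolP hQ /eqP dQ].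
rewrite schouten_is_linear dP dQ scaler0 addr0 eqxx andbT; apply/asboolP => I hI.
by rewrite !ffunE hP// hQ// scaler0 addr0.
Qed.

HB.instance Definition _ :=
  GRing.isSubmodClosed.Build R (mvf R n) cocycle_pred cocycle_submod_closed.

Record cocycle := Cocycle { cocycle_val :> mvf R n ; _ : cocycle_val \in cocycle_pred }.
HB.instance Definition _ := [isSub for cocycle_val].
HB.instance Definition _ := [Choice of cocycle by <:].
HB.instance Definition _ := [SubChoice_isSubZmodule of cocycle by <:].
HB.instance Definition _ := [SubZmodule_isSubLmodule of cocycle by <:].

(* The primitive Q has degree k - 1; it is 0 when k = 0. *)
Definition coboundary : {pred cocycle} :=
  [pred Z | `[< exists2 Q : mvf R n, (forall I : {set 'I_n}, #|I|.+1 != k -> Q I = 0) &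
                val Z = schouten pi Q >]].

Lemma coboundary_submod_closed : submod_closed coboundary.
Proof.
split=> [|a Z Y /asboolP[P hP eP] /asboolP[Q hQ eQ]]; apply/asboolP.
  by exists 0; [move=> I _; rewrite ffunE|rewrite [RHS]linear0].
exists (a *: P + Q); last by rewrite schouten_is_linear -eP -eQ.
by move=> I hI; rewrite !ffunE hP// hQ// scaler0 addr0.
Qed.

HB.instance Definition _ :=
  GRing.isSubmodClosed.Build R cocycle coboundary coboundary_submod_closed.

Definition cohomology := Quotient.quot coboundary.

HB.instance Definition _ := GRing.Zmodule.on cohomology.
HB.instance Definition _ := ZmodQuotient.on cohomology.

Definition cohomology_scale (a : R) (h : cohomology) : cohomology :=
  \pi_cohomology (a *: repr h).

Lemma pi_scale a (Z : cocycle) :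
  cohomology_scale a (\pi_cohomology Z) = \pi_cohomology (a *: Z).
Proof.
apply/eqP; rewrite -Quotient.idealrBE -scalerBr rpredZ//.
by rewrite Quotient.idealrBE reprK.
Qed.

Fact cohomology_scaleA a b h :
  cohomology_scale a (cohomology_scale b h) = cohomology_scale (a * b) h.
Proof. by rewrite -[h]reprK (pi_scale b) !pi_scale scalerA. Qed.

Fact cohomology_scale1 : left_id 1 cohomology_scale.
Proof. by move=> h; rewrite -[h]reprK pi_scale scale1r. Qed.

Fact cohomology_scaleDr : right_distributive cohomology_scale +%R.
Proof.
move=> a h h'; rewrite -[h]reprK -[h']reprK -raddfD !pi_scale scalerDr.
by rewrite raddfD.
Qed.

Fact cohomology_scaleDl h : {morph cohomology_scale^~ h : a b / a + b}.
Proof. by move=> a b; rewrite -[h]reprK !pi_scale scalerDl raddfD. Qed.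

HB.instance Definition _ := GRing.Zmodule_isLmodule.Build R cohomology
  cohomology_scaleA cohomology_scale1 cohomology_scaleDr cohomology_scaleDl.

(* The class of P when P is a k-cocycle, 0 (a junk value) otherwise. *)
Definition coh_class (P : mvf R n) : cohomology := \pi_cohomology (insubd (0 : cocycle) P).

Definition coh_repr (h : cohomology) : mvf R n := val (repr h : cocycle).

End PoissonCohomology.
Arguments coh_class {R n} pi k P.

Section CohomologyOperations.
Context {R : realType} {n : nat}.
Variable pi : mvf R n.

(* Computed on the chosen representatives coh_repr; independence of this choice
   is not built in and has to be stated. *)
Definition cup p q (h : cohomology pi p) (h' : cohomology pi q) :
    cohomology pi (p + q) :=
  coh_class pi (p + q) (wedge (coh_repr h) (coh_repr h')).

(* [h, h'] has degree p + q - 1; two functions have bracket 0, which we see in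
   degree 0. *)
Definition cbracket p q (h : cohomology pi p) (h' : cohomology pi q) :
    cohomology pi (p + q).-1 :=
  coh_class pi (p + q).-1 (schouten (coh_repr h) (coh_repr h')).

Definition casimir (f : smoothfun R n) := schouten pi (mvf_fun f) = 0.

Definition casimir_act (f : smoothfun R n) k (h : cohomology pi k) :
  cohomology pi k := cup (coh_class pi 0 (mvf_fun f)) h.

(* [g] is a basis of H^k as a module over the Casimir functions *)
Definition free_basis k m (g : m.-tuple (cohomology pi k)) :=
  forall h, exists! c : {ffun 'I_m -> smoothfun R n},
    (forall i, casimir (c i)) /\ h = \sum_(i < m) casimir_act (c i) (tnth g i).

End CohomologyOperations.

Section R3.
Context {R : realType}.

Definition ix : 'I_3 := @Ordinal 3 0 isT.
Definition iy : 'I_3 := @Ordinal 3 1 isT.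
Definition iz : 'I_3 := @Ordinal 3 2 isT.

Definition dx : mvf R 3 := mvf_partial ix.
Definition dy : mvf R 3 := mvf_partial iy.
Definition dz : mvf R 3 := mvf_partial iz.

Definition euler : mvf R 3 :=
  wedge (mvf_fun (coord ix)) dx + wedge (mvf_fun (coord iy)) dy.

Definition rotation : mvf R 3 :=
  - wedge (mvf_fun (coord iy)) dx + wedge (mvf_fun (coord ix)) dy.

Definition pi_tau (tau : R) : mvf R 3 := wedge (tau *: euler + rotation) dz.

(* the linear span over R of the representatives 1, E, d/dz and E /\ d/dz *)
Definition representative (P : mvf R 3) : Prop :=
  exists a b c e : R,
    P = a *: mvf_fun 1 + b *: euler + c *: dz + e *: wedge euler dz.

End R3.

(* Main.v *)
(** Put V = tau E + T, so that pi = V /\ d/dz and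
      d_pi P = V /\ (d/dz P) - d/dz /\ L_V P.
    The flow of V retracts R^3 onto the z-axis along logarithmic spirals. Written with the
    parameter s = exp (tau t / 2) it is v |-> v *m spiral s, which extends continuously to
    s = 0, and integrating a function g that vanishes on the axis against ds / s inverts L_V:
    by Hadamard's lemma g = x a + y b, which provides the factor s^2 that makes the integral
    converge and remain smooth. The same integral with cos and sin weights inverts L_V + i w.
    Averages of the form int_0^1 c(s) f(v *m L(s)) ds thus yield at once Hadamard's lemma,
    primitives in z and solutions of the transport equations. With these, a cocycle is first
    made independent of z, and a z-independent planar vector field or a function is then a
    coboundary up to its 1-jet on the axis, where only 1, E, d/dz and E /\ d/dz survive.

    For the operations on cohomology, d_pi is a derivation of both products because L_V and
    the z-derivative are, and on the span of the representatives the Schouten bracket is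
    identically 0. *)
From HB Require Import structures.
Require Import Defs.
From mathcomp Require Import all_boot all_order all_algebra.
From mathcomp Require Import all_classical all_reals all_analysis.
From mathcomp Require Import ring lra.
Set Implicit Arguments.
Unset Strict Implicit.
Unset Printing Implicit Defensive.
Import Order.TTheory GRing.Theory Num.Theory.
Import numFieldNormedType.Exports.
Local Open Scope ring_scope.
Local Notation coord := Defs.coord.

Local Open Scope classical_set_scope.

(** The contraction rate s^2 is deliberate. The measure dt = (2 / tau) ds / s costs one factor s,
    and a second one is needed because cos (k ln s) and sin (k ln s) have no limit at s = 0, whereas
    s times a bounded continuous function of ln s is continuous there. Continuity in s is all that
    smoothness of an average requires: a derivative in v multiplies the weight by an entry of L and
    never differentiates in s. Hence no formal power series or flat functions enter.

    What survives are the resonances of L_V. On constant planar fields L_V is invertible, with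
    determinant tau^2 + 1. On linear planar fields it rotates the traceless symmetric ones with
    frequency 2, which is invertible, and annihilates E and T. Since V = d_pi z and pi = d_pi (z
    d/dz), the class of T is -tau times that of E in degree 1, and likewise after a product with
    d/dz.

    Since pi is a product of two commuting vector fields, the graded Jacobi identity is needed only
    with a vector field as first argument. *)

Section ChainRule.
Context {R : realType} {n : nat}.
Implicit Types (f : 'rV[R]_n -> R) (v x y : 'rV[R]_n).

Let e i : 'rV[R]_n := delta_mx 0 i.

Lemma is_derive_line f i v t : derivable f (v + t *: e i) (e i) ->
  is_derive t 1 (fun s => f (v + s *: e i)) (pderive i f (v + t *: e i)).
Proof.
have E : (fun h : R => h^-1 *: ((fun s => f (v + s *: e i)) (h *: 1 + t) - f (v + t *: e i)))
   = (fun h : R => h^-1 *: (f (h *: e i + (v + t *: e i)) - f (v + t *: e i))).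
  apply/funext => h; congr (_ *: (f _ - _)).
  by rewrite [h *: 1]mulr1 scalerDl addrCA.
by move=> df; apply: DeriveDef; rewrite /derivable /derive /= ?E.
Qed.

Lemma mean_value_line f i v h : (forall w, derivable f w (e i)) ->
  exists2 c, `|c| <= `|h| & f (v + h *: e i) - f v = h * pderive i f (v + c *: e i).
Proof.
move=> df.
have pos w (k : R) : 0 <= k -> exists2 c, 0 <= c <= k &
    f (w + k *: e i) - f w = k * pderive i f (w + c *: e i).
  move=> k0.
  have dl (t : R) := is_derive_line (df (w + t *: e i)).
  have cl : {within `[0, k], continuous (fun s => f (w + s *: e i))}.
    by apply: derivable_within_continuous => t _; have [] := dl t.
  have [c c0k] := MVT_segment k0 (fun t _ => dl t) cl.
  rewrite scale0r addr0 subr0 mulrC => E; exists c => //.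
have [h0|h0] := leP 0 h.
  have [c /andP[c0 ch] E] := pos v h h0; exists c => //.
  by rewrite !ger0_norm.
have [|c /andP[c0 ch]] := pos (v + h *: e i) (- h); first by rewrite oppr_ge0 ltW.
rewrite scaleNr addrK -addrA -scalerDl => E; exists (h + c).
  by rewrite !ler0_norm; lra.
by rewrite -opprB E mulNr opprK.
Qed.

(** [Ck] speaks of partial derivatives only, so [x] is joined to [y] by changing one coordinate at a
    time and the increments telescope. The bound on [xi] lets these points converge to [x] as [y]
    does. *)
Lemma mean_value f x y : Ck 1 f ->
  exists xi : 'I_n -> 'rV[R]_n, (forall i j, `|xi i 0 j - x 0 j| <= `|y 0 j - x 0 j|) /\
    f y - f x = \sum_i (y 0 i - x 0 i) * pderive i f (xi i).
Proof.
move=> [_ Cf].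
pose w k : 'rV[R]_n := \row_j (if (j < k)%N then y 0 j else x 0 j).
have wS (i : 'I_n) : w i.+1 = w i + (y 0 i - x 0 i) *: e i.
  apply/rowP => j; rewrite !mxE /= ltnS leq_eqVlt.
  have [->|ji] := eqVneq j i; first by rewrite eqxx ltnn/= mulr1 addrC subrK.
  by rewrite val_eqE (negPf ji) /= mulr0 addr0.
have /choice[c /all_and2[cP cE]] (i : 'I_n) : exists c, `|c| <= `|y 0 i - x 0 i| /\
    f (w i.+1) - f (w i) = (y 0 i - x 0 i) * pderive i f (w i + c *: e i).
  have [c c1 c2] := @mean_value_line f i (w i) (y 0 i - x 0 i) (Cf i).1.
  by exists c; rewrite wS.
exists (fun i : 'I_n => w i + c i *: e i); split.
  move=> i j; rewrite !mxE /=; have [->|ji] := eqVneq j i.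
    by rewrite ltnn mulr1 addrAC subrr add0r.
  rewrite mulr0 addr0; case: ifP => _ //.
  by rewrite subrr normr0.
under eq_bigr => i _ do rewrite -cE.
rewrite -(big_mkord xpredT (fun i => f (w (S i)) - f (w i))).
rewrite telescope_sumr //; congr (f _ - f _); apply/rowP => j; rewrite mxE ?ltn_ord //.
Qed.

(** The mean value formula stands in for total differentiability: the difference quotient of
    [f \o g] is a sum of difference quotients of the coordinates of [g] times partial derivatives at
    points squeezed towards [g t]. *)
Lemma is_derive_curve f (g : R -> 'rV[R]_n) (d : 'rV[R]_n) (t : R) : Ck 1 f ->
  (forall j, is_derive t 1 (fun s => g s 0 j) (d 0 j)) ->
  is_derive t 1 (f \o g) (\sum_j d 0 j * pderive j f (g t)).
Proof.
move=> Cf dg.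
have /choice[xi /all_and2[xiP xiE]] (h : R) := mean_value (g t) (g (h *: 1 + t)) Cf.
have gc j : (fun h : R => g (h *: 1 + t) 0 j) @ (0 : R)^' --> g t 0 j.
  have /differentiable_continuous cg : differentiable (fun s => g s 0 j) t.
    by apply/derivable1_diffP; have [] := dg j.
  apply: (@cvg_comp _ _ _ (fun h : R => h *: 1 + t) (fun s => g s 0 j) _ (nbhs t)) => //.
  rewrite (_ : (fun h : R => _) = (fun h : R => h + t)); last first.
    by apply/funext => h; rewrite [h *: 1]mulr1.
  have : (fun h : R => h + t) @ (0 : R)^' --> 0 + t.
    apply: cvgD; last exact: cvg_cst.
    exact: nbhs_dnbhs.
  by rewrite add0r; exact.
have xic i : (fun h : R => xi h i) @ (0 : R)^' --> g t.
  apply/cvgrPdist_le => eps eps0.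
  have H : \forall h \near (0 : R)^', forall j, `|g t 0 j - g (h *: 1 + t) 0 j| <= eps.
    apply: filter_forall => j.
    by have /cvgrPdist_le/(_ _ eps0) := gc j.
  apply: filterS H => h H.
  rewrite /Num.Def.normr /= mx_normrE (bigmax_le _ (ltW eps0)) //= => -[k j] _ /=.
  rewrite !mxE (ord1 k) distrC (le_trans (xiP h i j)) // distrC.
  exact: H.
have L : (fun h : R => h^-1 *: ((f \o g) (h *: 1 + t) - (f \o g) t)) @ (0 : R)^'
    --> \sum_j d 0 j * pderive j f (g t).
  rewrite (_ : (fun h : R => _) = (fun h : R => \sum_j
     (h^-1 *: (g (h *: 1 + t) 0 j - g t 0 j)) * pderive j f (xi h j))); last first.
    apply/funext => h; rewrite /= xiE scaler_sumr; apply: eq_bigr => j _.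
    by rewrite scalerAl.
  apply: (@cvg_big _ _ +%R) => [|j _]; first exact: add_continuous.
  apply: cvgM; first by have [dj <-] := dg j; exact: dj.
  apply: (@cvg_comp _ _ _ (xi^~ j) (pderive j f) _ (nbhs (g t))); first exact: xic.
  by case: Cf => _ /(_ j) [_ [+ _]]; exact.
by apply: DeriveDef; [apply/cvg_ex; eexists; exact: L|exact: cvg_lim L].
Qed.

End ChainRule.

(** * Integrals over the unit interval and their dependence on parameters *)

Section UnitIntegral.
Context {R : realType}.
Implicit Types g h : R -> R.

Definition integral01 g : R := \int[@lebesgue_measure R]_(s in `[0%R, 1%R]) g s.

Lemma continuous_integrable01 g : continuous g ->
  (@lebesgue_measure R).-integrable `[0%R, 1%R] (EFin \o g).
Proof.
move=> cg; apply: continuous_compact_integrable; first exact: segment_compact.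
exact: continuous_subspaceT.
Qed.

Lemma eq_integral01 g h : (forall s, 0 <= s <= 1 -> g s = h s) ->
  integral01 g = integral01 h.
Proof. by move=> gh; apply: eq_Rintegral => s; rewrite inE /= in_itv => /gh. Qed.

Lemma integral01D g h : continuous g -> continuous h ->
  integral01 (fun s => g s + h s) = integral01 g + integral01 h.
Proof. by move=> cg ch; apply: RintegralD => //; exact: continuous_integrable01. Qed.

Lemma integral01Z g a : continuous g ->
  integral01 (fun s => a * g s) = a * integral01 g.
Proof. by move=> cg; apply: RintegralZl => //; exact: continuous_integrable01. Qed.

Lemma integral01_cst a : integral01 (cst a) = a.
Proof.
rewrite /integral01 Rintegral_cst //= lebesgue_measure_itv /= lte_fin ltr01.
by rewrite oppr0 addr0 mulr1.
Qed.

Lemma integral01_sum n (g : 'I_n -> R -> R) : (forall i, continuous (g i)) ->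
  integral01 (fun s => \sum_i g i s) = \sum_i integral01 (g i).
Proof.
elim: n g => [|n IH] g cg.
  rewrite big_ord0 -[RHS](integral01_cst 0); apply: eq_integral01 => s _.
  by rewrite big_ord0.
rewrite big_ord_recl -IH // -integral01D //; last first.
  by move=> x; apply: (@cvg_big _ _ +%R) => [|i _]; [exact: add_continuous|exact: cg].
by apply: eq_integral01 => s _; rewrite big_ord_recl.
Qed.

(** The derivative is required on the open interval only, because formulas in [ln s] can be
    differentiated for [s > 0] but are merely continuous at [s = 0]. *)
Lemma integral01_derive g h : continuous g -> continuous h ->
  (forall s : R, 0 < s < 1 -> is_derive s 1 g (h s)) -> integral01 h = g 1 - g 0.
Proof.
move=> cg ch dg; rewrite /integral01 /Rintegral.
rewrite (@continuous_FTC2 _ h g 0 1) //.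
- exact: continuous_subspaceT.
- split.
  + by move=> s; rewrite in_itv => /dg [].
  + exact/cvg_at_right_filter/cg.
  + exact/cvg_at_left_filter/cg.
- by move=> s; rewrite in_itv => /dg [? <-]; rewrite derive1E.
Qed.

End UnitIntegral.

Section ParameterIntegral.
Context {R : realType} {n : nat}.
Implicit Types (phi : R -> 'rV[R]_n -> R) (v : 'rV[R]_n).

Lemma cvg_rV (T : Type) (F : set_system T) (g : T -> 'rV[R]_n) (l : 'rV[R]_n) :
  Filter F -> (forall j, (fun t => g t 0 j) @ F --> l 0 j) -> g @ F --> l.
Proof.
move=> FF gl; apply/cvgrPdist_le => e e0.
have H : \forall t \near F, forall j, `|l 0 j - g t 0 j| <= e.
  by apply: filter_forall => j; have /cvgrPdist_le/(_ _ e0) := gl j.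
apply: filterS H => t H.
rewrite /Num.Def.normr /= mx_normrE (bigmax_le _ (ltW e0)) //= => -[k j] _ /=.
by rewrite !mxE (ord1 k); exact: H.
Qed.

Definition jointly_continuous phi :=
  continuous (fun p : R * 'rV[R]_n => phi p.1 p.2).

Lemma jointly_continuousl phi v : jointly_continuous phi -> continuous (phi^~ v).
Proof.
move=> cphi s; apply: (@continuous_comp _ _ _ (fun s => (s, v)) (fun p => phi p.1 p.2)).
  exact: (@cvg_pair _ _ _ (nbhs s) (nbhs s) (nbhs v) _ _ _ id (fun=> v) cvg_id (cvg_cst v)).
exact: cphi.
Qed.

(** Tube lemma: the estimate holds near each point [(s, v)], and compactness of the unit interval
    yields one neighbourhood of [v] for all [s]. *)
Lemma jointly_continuous_uniform phi v e : jointly_continuous phi -> 0 < e ->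
  \forall w \near v, forall s, 0 <= s <= 1 -> `|phi s w - phi s v| <= e.
Proof.
move=> cphi e0.
have cpt : compact (`[0%R, 1%R]%classic : set R) by exact: segment_compact.
have cphi' := @jointly_continuousl phi v cphi.
suff H : \forall w \near v, `[0%R, 1%R]%classic `<=` (fun s => `|phi s w - phi s v| <= e).
  by apply: filterS H => w H s s01; apply: H; rewrite /= in_itv.
apply: ((compact_near_coveringP _).1 cpt _ (nbhs v) (fun w s => `|phi s w - phi s v| <= e)) => s _.
have e2 : 0 < e / 2 by rewrite divr_gt0.
have /cvgrPdist_le/(_ _ e2) := cphi (s, v).
move=> [[/= U W] [Us Wv]] UW.
have /cvgrPdist_le/(_ _ e2) U's := cphi' s.
exists (U `&` [set t | `|phi s v - phi t v| <= e / 2], W); first by split=> //; exact: filterI.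
move=> [t w] /= [[Ut Vt] Ww]; have := UW (t, w) (conj Ut Ww).
rewrite /= => H; rewrite -(subrKA (phi s v)) (splitr e) (le_trans (ler_normD _ _)) //.
by rewrite lerD // distrC.
Qed.

Lemma continuous_integral01 phi : jointly_continuous phi ->
  continuous (fun v => integral01 (phi^~ v)).
Proof.
move=> cphi v.
apply: (cvgrPdist_le (F := nbhs v) _ _).2 => e e0.
have H := @jointly_continuous_uniform phi v e cphi e0.
near=> w.
have H1 : forall s, 0 <= s <= 1 -> `|phi s w - phi s v| <= e by near: w; exact: H.
have cw x := @jointly_continuousl phi x cphi.
rewrite /integral01 -RintegralB //; [|exact: continuous_integrable01..].
apply: le_trans (le_normr_Rintegral _ _) _ => //.
  by apply: continuous_integrable01 => s; apply: continuousB; exact: cw.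
rewrite -[leRHS](integral01_cst e); apply: le_Rintegral => //.
- apply: continuous_integrable01 => s; apply: (@continuous_comp _ _ _ (fun s => phi s v - phi s w) Num.norm); last exact: norm_continuous.
  by apply: continuousB; exact: cw.
- by apply: continuous_integrable01; exact: cst_continuous.
- by move=> s; rewrite /= in_itv => /H1; rewrite distrC.
Unshelve. all: by end_near. Qed.

Lemma is_derive_shift0 (f : 'rV[R]_n -> R) v u d :
  is_derive (0 : R) 1 (fun h : R => f (h *: u + v)) d -> is_derive v u f d.
Proof.
have E : (fun h : R => h^-1 *: (f (h *: u + v) - f v)) =
    (fun h : R => h^-1 *: (f ((h *: 1 + 0) *: u + v) - f (0 *: u + v))).
  by apply/funext => h; rewrite addr0 [h *: 1]mulr1 scale0r add0r.
case=> d1 d2; apply: DeriveDef; first by rewrite /derivable E.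
by rewrite /derive E.
Qed.

(** Domination: near [v], and uniformly in [s], the partial derivative differs by at most 1 from its
    value at [v], so the modulus of that value plus 1 is the integrable bound [G]. *)
Lemma is_derive_integral01 phi i v :
  jointly_continuous phi -> jointly_continuous (fun s => pderive i (phi s)) ->
  (forall s w, derivable (phi s) w (delta_mx 0 i)) ->
  is_derive v (delta_mx 0 i) (fun w => integral01 (phi^~ w))
    (integral01 (fun s => pderive i (phi s) v)).
Proof.
set e : 'rV[R]_n := delta_mx 0 i.
move=> cphi cdphi dphi; apply: is_derive_shift0.
pose f (h s : R) := phi s (h *: e + v).
have df (h s : R) : is_derive h 1 (f^~ s) (pderive i (phi s) (h *: e + v)).
  rewrite /f; under eq_fun do rewrite addrC.
  by rewrite addrC; apply: is_derive_line; exact: dphi.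
have df1 (h s : R) : partial1of2 f h s = pderive i (phi s) (h *: e + v).
  by rewrite partial1of2E; have [] := df h s.
have [d /= d0 Hd] : \forall h \near (0 : R), forall s, 0 <= s <= 1 ->
    `|pderive i (phi s) (h *: e + v) - pderive i (phi s) v| <= 1.
  have := @jointly_continuous_uniform _ v _ cdphi ltr01.
  have L : (fun h : R => h *: e + v) @ (0 : R) --> v.
    apply: (@cvg_rV _ (nbhs (0 : R))) => j.
    rewrite (_ : v 0 j = 0 * e 0 j + v 0 j); last by rewrite mul0r add0r.
    under eq_fun do rewrite 2!mxE.
    by apply: cvgD; [apply: cvgMr_tmp; exact: cvg_id|exact: cvg_cst].
  by move=> /L.
have cp w := @jointly_continuousl phi w cphi; have cdp w := @jointly_continuousl _ w cdphi.
pose G s := `|pderive i (phi s) v| + 1.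
have cG : continuous G.
  move=> s; apply: cvgD; last exact: cvg_cst.
  by apply: (@continuous_comp _ _ _ (fun s => pderive i (phi s) v) Num.norm); [exact: cdp|exact: norm_continuous].
have I0 : `](- d), d[%classic (0 : R) by rewrite /= in_itv /= oppr_lt0 d0.
have intf (h : R) : `](- d), d[%classic h ->
    (@lebesgue_measure R).-integrable `[0%R, 1%R] (EFin \o f h).
  by move=> _; apply: continuous_integrable01; exact: cp.
have der h s : `](- d), d[%classic h -> `[0%R, 1%R]%classic s -> derivable (f^~ s) h 1.
  by move=> _ _; have [] := df h s.
have G0 s : 0 <= G s by rewrite addr_ge0.
have iG := continuous_integrable01 cG.
have Gub h s : `](- d), d[%classic h -> `[0%R, 1%R]%classic s -> `|partial1of2 f h s| <= G s.
  rewrite /= !in_itv /= df1 => hd s01.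
  have H : `|pderive i (phi s) (h *: e + v) - pderive i (phi s) v| <= 1.
    by apply: (Hd h) => //; rewrite /= sub0r normrN ltr_norml.
  by rewrite -(subrK (pderive i (phi s) v) (pderive i (phi s) (h *: e + v)))
     (le_trans (ler_normD _ _)) // addrC lerD.
have D := @derivable_under_integral R _ _ (@lebesgue_measure R) f _ (measurable_itv _) 0 (- d) d I0 intf der G G0 iG Gub.
apply: DeriveDef; first exact: D.
rewrite -derive1E; have := @differentiation_under_integral R _ _ (@lebesgue_measure R) f _ (measurable_itv _) 0 (- d) d I0 intf der G G0 iG Gub.
rewrite /integral01 /f => ->; apply: eq_Rintegral => s _.
by rewrite df1 scale0r add0r.
Qed.

End ParameterIntegral.

(** * Smooth functions and their averages along matrix curves *)

Section SmoothRing.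
Context {R : realType} {n : nat}.
Local Notation C := (smoothfun R n).
Implicit Types (f g : C) (v : 'rV[R]_n) (i j : 'I_n) (a : R).

Lemma sfunP f g : (forall v, f v = g v) -> f = g.
Proof. by move=> fg; apply/val_inj/funext. Qed.

Lemma sfunDE f g v : (f + g) v = f v + g v. Proof. by []. Qed.
Lemma sfunNE f v : (- f) v = - f v. Proof. by []. Qed.
Lemma sfunME f g v : (f * g) v = f v * g v. Proof. by []. Qed.
Lemma sfunZE a f v : (a *: f) v = a * f v. Proof. by []. Qed.
Lemma sfun0E v : (0 : C) v = 0. Proof. by []. Qed.
Lemma sfun1E v : (1 : C) v = 1. Proof. by []. Qed.
Lemma coordE i v : coord i v = v 0 i. Proof. by []. Qed.
Lemma sfun_sumE (I : finType) (P : pred I) (F : I -> C) v :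
  (\sum_(k | P k) F k) v = \sum_(k | P k) F k v.
Proof. by elim/big_ind2: _ => // x1 x2 y1 y2 <- <-. Qed.

Definition sfunE := (sfunDE, sfunNE, sfunME, sfunZE, sfun0E, sfun1E, coordE).

Lemma smooth_Ck k f : Ck k f.
Proof. by have /asboolP/(_ k) := valP f. Qed.

Lemma smooth_continuous f : continuous f.
Proof. exact: Ck_continuous (smooth_Ck 0 f). Qed.

Lemma smooth_derivable f i v : derivable f v (delta_mx 0 i).
Proof. by have [_ /(_ i)[]] := smooth_Ck 1 f. Qed.

Lemma partialM i f g : partial i (f * g) = partial i f * g + f * partial i g.
Proof.
apply: sfunP => v; rewrite !sfunE /= /pderive deriveM; last 2 first.
- exact: smooth_derivable.
- exact: smooth_derivable.
by rewrite addrC [RHS]addrC /GRing.scale /= addrC; congr (_ + _); rewrite mulrC.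
Qed.

(** Scalars are moved into the ring of functions so that [ring] can treat [a *: f] as a product, by
    way of [scale_smoothfun]. *)
Definition sconst a : C := a *: (1 : C).

Lemma partial_sconst i a : partial i (sconst a) = 0.
Proof.
have E : (sconst a : 'rV[R]_n -> R) = cst a by apply/funext => w; exact: mulr1.
by apply: sfunP => v; rewrite -[LHS]/(pderive i (sconst a : _ -> _) v) E /pderive derive_cst.
Qed.

Lemma partial1 i : partial i (1 : C) = 0.
Proof. by rewrite -(partial_sconst i 1) /sconst scale1r. Qed.

Lemma partial_coord i j : partial i (coord j) = (j == i)%:R :> C.
Proof.
apply: sfunP => v; rewrite /= /pderive.
have := derive_mx (@derivable_id _ _ v (delta_mx 0 i : 'rV[R]_n)).
move=> /matrixP/(_ 0 j); rewrite derive_id !mxE /= => <-.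
by case: (j == i).
Qed.

Lemma scale_smoothfun a f : a *: f = sconst a * f.
Proof. by apply: sfunP => v; rewrite !sfunE mulr1. Qed.

Lemma sconstE a v : sconst a v = a.
Proof. exact: mulr1. Qed.

Lemma is_derive_sfun_curve f (g : R -> 'rV[R]_n) (d : 'rV[R]_n) (t : R) :
  (forall j, is_derive t 1 (fun s => g s 0 j) (d 0 j)) ->
  is_derive t 1 (f \o g) (\sum_j d 0 j * partial j f (g t)).
Proof. exact/is_derive_curve/smooth_Ck. Qed.

End SmoothRing.

Section Average.
Context {R : realType} {n : nat}.
Implicit Types (c : R -> R) (L : R -> 'M[R]_n) (f : 'rV[R]_n -> R).

Definition continuous_mx_curve L := forall i j, continuous (fun s => L s i j).

Definition avg c L f : 'rV[R]_n -> R :=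
  fun v => integral01 (fun s => c s * f (v *m L s)).

Lemma avg_jointly_continuous c L f : continuous c -> continuous_mx_curve L ->
  continuous f -> jointly_continuous (fun s v => c s * f (v *m L s)).
Proof.
move=> cc cL cf [s v] /=.
have cfst (T : topologicalType) (h : R -> T) : continuous h ->
    h p.1 @[p --> nbhs ((s, v) : R * 'rV[R]_n)] --> h s.
  move=> ch; apply: (@cvg_comp _ _ _ fst h _ (nbhs s)); first exact: cvg_fst.
  exact: ch.
apply: cvgM; first exact: cfst.
apply: (@cvg_comp _ _ _ (fun p : R * 'rV[R]_n => p.2 *m L p.1) f _ (nbhs (v *m L s))); last first.
  exact: cf.
apply: (@cvg_rV _ _ _ (nbhs ((s, v) : R * 'rV[R]_n))) => j.
rewrite mxE; under eq_fun do rewrite mxE.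
apply: (@cvg_big _ _ +%R) => [|k _]; first exact: add_continuous.
apply: cvgM; last by apply: (cfst _ (fun s => L s k j)); exact: cL.
apply: (@cvg_comp _ _ _ snd (fun w : 'rV[R]_n => w 0 k) _ (nbhs v)); first exact: cvg_snd.
exact: coord_continuous.
Qed.

Lemma is_derive_mulmx (c0 : R) (M : 'M[R]_n) f i v : Ck 1 f ->
  is_derive v (delta_mx 0 i) (fun w => c0 * f (w *m M))
    (\sum_j (c0 * M i j) * pderive j f (v *m M)).
Proof.
move=> Cf; apply: is_derive_shift0.
have E : \sum_j (c0 * M i j) * pderive j f (v *m M) =
    c0 *: (\sum_j (delta_mx 0 i *m M : 'rV_n) 0 j * pderive j f ((0 *: delta_mx 0 i + v) *m M)).
  rewrite scaler_sumr scale0r add0r; apply: eq_bigr => j _.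
  by rewrite -rowE mxE [RHS]mulrA.
rewrite E; apply: is_deriveZ.
apply: (@is_derive_curve _ _ f (fun h : R => (h *: delta_mx 0 i + v) *m M)) => // j.
under eq_fun do rewrite mulmxDl -scalemxAl 2!mxE.
rewrite -[X in is_derive _ _ _ X]addr0; apply: is_deriveD.
rewrite (_ : (fun h : R => _) = ((delta_mx 0 i *m M : 'rV_n) 0 j) \*: id); last first.
  by apply/funext => h; rewrite /= /GRing.scale /= mulrC.
by rewrite -[X in is_derive _ _ _ X]mulr1; apply: is_deriveZ.
Qed.

(** By the chain rule for [v *m L s], the weight [c] is only multiplied by entries of [L s]; the
    outcome is a sum of averages of the same kind, and nothing beyond continuity of [c] and [L] is
    used up. *)
Lemma is_derive_avg c L f i v : continuous c -> continuous_mx_curve L -> Ck 1 f ->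
  is_derive v (delta_mx 0 i) (avg c L f)
    (\sum_j avg (fun s => c s * L s i j) L (pderive j f) v).
Proof.
move=> cc cL Cf.
have E s : pderive i (fun w => c s * f (w *m L s)) =
    fun v => \sum_j (c s * L s i j) * pderive j f (v *m L s).
  by apply/funext => w; rewrite /pderive; have [_ ->] := is_derive_mulmx (c s) (L s) i w Cf.
have ccL j : continuous (fun s => c s * L s i j).
  by move=> s; apply: cvgM; [exact: cc|exact: cL].
have cpf j : continuous (pderive j f) by case: Cf => _ /(_ j)[_ []].
have := @is_derive_integral01 R n (fun s w => c s * f (w *m L s)) i v.
have -> : integral01 (fun s => pderive i (fun w => c s * f (w *m L s)) v) =
    \sum_j avg (fun s => c s * L s i j) L (pderive j f) v.
  under eq_fun do rewrite E.
  apply: integral01_sum => j.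
  exact: (jointly_continuousl (avg_jointly_continuous (ccL j) cL (cpf j))).
apply.
- by apply: avg_jointly_continuous => //; case: Cf.
- rewrite /jointly_continuous (_ : (fun p => _) = fun p : R * 'rV[R]_n =>
      \sum_j (c p.1 * L p.1 i j) * pderive j f (p.2 *m L p.1)); last first.
    by apply/funext => p; rewrite E.
  move=> p; apply: (@cvg_big _ _ +%R) => [|j _]; first exact: add_continuous.
  exact: (avg_jointly_continuous (ccL j) cL (cpf j)).
- by move=> s w; have [] := is_derive_mulmx (c s) (L s) i w Cf.
Qed.

Lemma Ck_sum k (g : 'I_n -> 'rV[R]_n -> R) : (forall i, Ck k (g i)) ->
  Ck k (fun v => \sum_i g i v).
Proof.
move=> Cg; rewrite (_ : (fun v => _) = \sum_i g i); last first.
  by apply/funext => v; rewrite fct_sumE.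
by elim/big_ind: _ => //; [exact: Ck_cst|move=> x y; exact: CkD].
Qed.

(** The induction runs over all weights [c] at once, since each derivative changes the weight. *)
Lemma Ck_avg k c L f : continuous c -> continuous_mx_curve L -> Ck k f -> Ck k (avg c L f).
Proof.
elim: k c f => [|k IH] c f cc cL Cf.
  by split=> //; apply/continuous_integral01/avg_jointly_continuous => //; case: Cf.
have C1f : Ck 1 f.
  by case: Cf => cf Hf; split=> // i; have [df /Ck_continuous cdf] := Hf i; split.
split.
  by apply/continuous_integral01/avg_jointly_continuous => //; case: Cf.
move=> i; split=> [v|]; first by have [] := is_derive_avg i v cc cL C1f.
rewrite (_ : pderive i _ = fun v => \sum_j avg (fun s => c s * L s i j) L (pderive j f) v).
  apply: Ck_sum => j; apply: IH => //; last by case: Cf => _ /(_ j)[].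
  by move=> s; apply: cvgM; [exact: cc|exact: cL].
by apply/funext => v; rewrite /pderive; have [_ ->] := is_derive_avg i v cc cL C1f.
Qed.

Variables (c : R -> R) (cc : continuous c) (L : R -> 'M[R]_n) (cL : continuous_mx_curve L).

Lemma avg_smooth (f : smoothfun R n) : avg c L f \in smooth.
Proof. by apply/asboolP => k; apply: Ck_avg => //; exact: smooth_Ck. Qed.

Definition savg (f : smoothfun R n) : smoothfun R n := SmoothFun (avg_smooth f).

Lemma savg_integrand_continuous (f : smoothfun R n) v :
  continuous (fun s => c s * f (v *m L s)).
Proof. exact: (jointly_continuousl (avg_jointly_continuous cc cL (@smooth_continuous _ _ f))). Qed.

Lemma savg_is_linear : linear savg.
Proof.
move=> a f g; apply: sfunP => v; transitivity (a * avg c L f v + avg c L g v); last by [].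
rewrite /= /avg.
rewrite -integral01Z; last exact: savg_integrand_continuous.
rewrite -integral01D.
- apply: eq_integral01 => s _; rewrite mulrCA -mulrDr; exact: erefl.
- by move=> s; apply: cvgM; [exact: cvg_cst|exact: savg_integrand_continuous].
- exact: savg_integrand_continuous.
Qed.
HB.instance Definition _ :=
  GRing.isLinear.Build R (smoothfun R n) (smoothfun R n) _ savg savg_is_linear.

End Average.

Lemma partial_savg {R : realType} {n : nat} (c : R -> R) (cc : continuous c)
    (L : R -> 'M[R]_n) (cL : continuous_mx_curve L) i (f : smoothfun R n)
    (cc' : forall j, continuous (fun s => c s * L s i j)) :
  partial i (savg cc cL f) = \sum_j savg (cc' j) cL (partial j f).
Proof.
apply: sfunP => v; rewrite sfun_sumE /=.
by rewrite /pderive; have [_ ->] := is_derive_avg i v cc cL (smooth_Ck 1 f).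
Qed.

(** * Hadamard's lemma, primitives and symmetry of second derivatives *)

Section Hadamard.
Context {R : realType} {n : nat}.
Local Notation C := (smoothfun R n).
Implicit Types (f g : C) (v : 'rV[R]_n) (i j : 'I_n) (S : {set 'I_n}) (s : R).

(** A curve from the projection that kills the coordinates in [S], at [s = 0], to the identity, at
    [s = 1]. *)
Definition dilation S s : 'M[R]_n := diag_mx (\row_i (if i \in S then s else 1)).

Lemma mul_dilationE v S s j : (v *m dilation S s) 0 j = v 0 j * (if j \in S then s else 1).
Proof. by rewrite mul_mx_diag !mxE. Qed.

Lemma dilation1 S : dilation S 1 = 1%:M.
Proof. by apply/matrixP => i j; rewrite !mxE if_same. Qed.

Lemma dilation_continuous S : continuous_mx_curve (dilation S).
Proof.
move=> i j; under eq_fun do rewrite !mxE.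
case: (i == j); last exact: cst_continuous.
by case: (i \in S); [move=> s; exact: cvg_id|exact: cst_continuous].
Qed.

Lemma cst1_continuous : continuous (fun _ : R => 1 : R).
Proof. exact: cst_continuous. Qed.

Definition mean_on S f : C := savg cst1_continuous (@dilation_continuous S) f.

Lemma is_derive_dilation f v S s :
  is_derive s 1 (fun s => f (v *m dilation S s))
    (\sum_(j in S) v 0 j * partial j f (v *m dilation S s)).
Proof.
pose d : 'rV[R]_n := \row_j (if j \in S then v 0 j else 0).
have -> : \sum_(j in S) v 0 j * partial j f (v *m dilation S s) =
    \sum_j d 0 j * partial j f (v *m dilation S s).
  rewrite big_mkcond; apply: eq_bigr => j _; rewrite mxE; case: ifP => // _.
  by rewrite mul0r.
apply: is_derive_sfun_curve => j; under eq_fun do rewrite mul_dilationE.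
rewrite mxE; case: ifP => _; last first.
  exact: (is_derive_cst (v 0 j * 1) s 1).
have := @is_deriveZ _ _ _ id (v 0 j) s 1 1 (is_derive_id _ _).
by rewrite /GRing.scale /= mulr1.
Qed.

Lemma sfun_dilation_continuous f v S : continuous (fun s => f (v *m dilation S s)).
Proof.
have := @savg_integrand_continuous R n _ cst1_continuous _ (@dilation_continuous S) f v.
by under eq_fun do rewrite mul1r.
Qed.

(** The fundamental theorem of calculus for [f] along [v *m dilation S s]; the factors [v 0 j] do
    not depend on [s] and leave the integral. *)
Lemma hadamard S f v :
  f v = f (v *m dilation S 0) + (\sum_(j in S) coord j * mean_on S (partial j f)) v.
Proof.
apply/eqP; rewrite addrC -subr_eq -{1}[v]mulmx1 -(dilation1 S) eq_sym; apply/eqP.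
pose h s := \sum_j (if j \in S then v 0 j else 0) * partial j f (v *m dilation S s).
have ch j : continuous (fun s => (if j \in S then v 0 j else 0) * partial j f (v *m dilation S s)).
  by move=> s; apply: cvgM; [exact: cvg_cst|exact: sfun_dilation_continuous].
have <- : integral01 h = f (v *m dilation S 1) - f (v *m dilation S 0).
  apply: (@integral01_derive R (fun s => f (v *m dilation S s))).
  - exact: sfun_dilation_continuous.
  - by move=> s; apply: (@cvg_big _ _ +%R) => [|j _]; [exact: add_continuous|exact: ch].
  move=> s _; rewrite /h.
  rewrite (eq_bigr (fun j => if j \in S then v 0 j * partial j f (v *m dilation S s) else 0)).
    by rewrite -big_mkcond; exact: is_derive_dilation.
  by move=> j _; case: ifP; rewrite ?mul0r.
rewrite /h integral01_sum // sfun_sumE big_mkcond; apply: eq_bigr => j _.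
case: ifP => _.
  rewrite sfunME coordE integral01Z; last exact: sfun_dilation_continuous.
  by congr (_ * _); apply: eq_integral01 => s _; rewrite mul1r.
by rewrite -[LHS](integral01_cst 0); apply: eq_integral01 => s _; rewrite mul0r.
Qed.

Lemma eq_savg (c c' : R -> R) (cc : continuous c) (cc' : continuous c')
    (L L' : R -> 'M[R]_n) (cL : continuous_mx_curve L) (cL' : continuous_mx_curve L') f :
  c =1 c' -> L =1 L' -> savg cc cL f = savg cc' cL' f.
Proof.
by move=> ec eL; apply: sfunP => v; apply: eq_integral01 => s _; rewrite ec eL.
Qed.

Lemma savg0 (c : R -> R) (cc : continuous c) (L : R -> 'M[R]_n)
    (cL : continuous_mx_curve L) f : c =1 (fun=> 0) -> savg cc cL f = 0.
Proof.
move=> c0; apply: sfunP => v; rewrite -[RHS](integral01_cst 0).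
by apply: eq_integral01 => s _; rewrite c0 mul0r.
Qed.

Lemma partial_mean_on_notin S i f : i \notin S ->
  partial i (mean_on S f) = mean_on S (partial i f).
Proof.
move=> iS.
have cc' j : continuous (fun s => 1 * dilation S s i j).
  by move=> s; apply: cvgM; [exact: cvg_cst|exact: dilation_continuous].
rewrite (partial_savg _ _ _ cc') (bigD1 i) //= big1 ?addr0; last first.
  move=> j ji; apply: savg0 => s; rewrite !mxE eq_sym (negPf ji) mulr0 //.
by apply: eq_savg => s //; rewrite !mxE eqxx (negPf iS) mulr1.
Qed.

(** The integral of [f] in its [i]-th coordinate from 0 to [v 0 i], rescaled to the unit interval so
    that it is an average, hence smooth. *)
Definition primitive i f : C := coord i * mean_on [set i] f.

Lemma partial_primitive_ne i j f : j != i ->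
  partial j (primitive i f) = primitive i (partial j f).
Proof.
move=> ji; rewrite /primitive partialM partial_coord eq_sym (negPf ji) mul0r add0r.
by rewrite partial_mean_on_notin // inE.
Qed.

Lemma partial_primitive i f : partial i (primitive i f) = f.
Proof.
apply: sfunP => v.
have cc' j : continuous (fun s => 1 * dilation [set i] s i j).
  by move=> s; apply: cvgM; [exact: cvg_cst|exact: dilation_continuous].
rewrite /primitive partialM partial_coord eqxx mul1r (partial_savg _ _ _ cc').
rewrite (bigD1 i) // big1; last first.
  by move=> j /= ji; apply: savg0 => s; rewrite !mxE eq_sym (negPf ji) mulr0.
pose fd s := f (v *m dilation [set i] s).
pose dfd s := partial i f (v *m dilation [set i] s).
have cfd : continuous fd by exact: sfun_dilation_continuous.
have cdfd : continuous dfd by exact: sfun_dilation_continuous.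
have csdfd : continuous (fun s => s * dfd s).
  by move=> s; apply: cvgM; [exact: cvg_id|exact: cdfd].
have csdfd' : continuous (fun s => v 0 i * (s * dfd s)).
  by move=> s; apply: cvgM; [exact: cvg_cst|exact: csdfd].
rewrite sfunDE sfunME coordE sfunDE sfun0E addr0 /= /avg.
transitivity (integral01 fd + v 0 i * integral01 (fun s => s * dfd s)).
  congr (_ + _ * _). 
    by apply: eq_integral01 => s _; rewrite mul1r.
  apply: eq_integral01 => s _.
  by rewrite !mxE eqxx inE eqxx mul1r.
rewrite -integral01Z // -integral01D //.
(* By the product rule, the integrand is the derivative of [s * fd s]. *)
transitivity (1 * fd 1 - 0 * fd 0); last by rewrite mul1r mul0r subr0 /fd dilation1 mulmx1.
apply: (@integral01_derive R (fun s => s * fd s)).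
- by move=> s; apply: cvgM; [exact: cvg_id|exact: cfd].
- by move=> s; apply: cvgD; [exact: cfd|exact: csdfd'].
move=> s _; have := is_derive_dilation f v [set i] s.
rewrite big_set1 => D.
have := @is_deriveM _ _ id fd s 1 1 _ (is_derive_id _ _) D.
rewrite addrC; congr is_derive; rewrite /GRing.scale /= mulr1 -/(dfd s).
by rewrite mulrCA.
Qed.

(** For [j != i], [f] is its restriction to the hyperplane where coordinate [i] vanishes plus the
    [i]-primitive of [partial i f]. Restriction and primitive commute with [partial j]; [partial i]
    kills the first and undoes the second. *)
Lemma partialC i j f : partial i (partial j f) = partial j (partial i f).
Proof.
have [->//|ji] := eqVneq j i.
pose L0 (_ : R) := dilation [set i] 0.
have cL0 : continuous_mx_curve L0 by move=> k l; exact: cst_continuous.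
pose res f := savg cst1_continuous cL0 f.
have di_res g : partial i (res g) = 0.
  have cc' k : continuous (fun s : R => 1 * L0 s i k) by rewrite /L0; exact: cst_continuous.
  rewrite (partial_savg _ _ _ cc') big1 // => k _; apply: savg0 => s.
  by rewrite !mxE inE eqxx mul0rn mulr0.
have dj_res g : partial j (res g) = res (partial j g).
  have cc' k : continuous (fun s : R => 1 * L0 s j k) by rewrite /L0; exact: cst_continuous.
  rewrite (partial_savg _ _ _ cc') (bigD1 j) //= big1 ?addr0; last first.
    by move=> k kj; apply: savg0 => s; rewrite !mxE eq_sym (negPf kj) mulr0.
  by apply: eq_savg => s //; rewrite !mxE eqxx inE (negPf ji) mulr1.
have E : f = res f + primitive i (partial i f).
  apply: sfunP => v; rewrite (hadamard [set i] f v) big_set1 sfunDE; congr (_ + _).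
  by rewrite /= -[LHS]integral01_cst; apply: eq_integral01 => s _; rewrite mul1r.
rewrite {1}E linearD /= dj_res partial_primitive_ne // linearD /= di_res add0r.
by rewrite partial_primitive.
Qed.

End Hadamard.

(** * Derivations along linear vector fields, and functions of the logarithm *)

Section LinearVectorField.
Context {R : realType} {n : nat}.
Local Notation C := (smoothfun R n).
Variable M : 'M[R]_n.

Definition linfield (i : 'I_n) : C := \sum_k M k i *: coord k.

Definition linder (f : C) : C := \sum_i linfield i * partial i f.

Lemma linfieldE i v : linfield i v = (v *m M) 0 i.
Proof.
rewrite sfun_sumE mxE; apply: eq_bigr => k _.
by rewrite !sfunE mulrC.
Qed.

Lemma linderE (f : C) v : linder f v = \sum_i (v *m M) 0 i * partial i f v.
Proof. by rewrite sfun_sumE; apply: eq_bigr => i _; rewrite sfunME linfieldE. Qed.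

Lemma linder_is_linear : linear linder.
Proof.
move=> a f g; rewrite /linder scaler_sumr -big_split; apply: eq_bigr => i _ /=.
by rewrite linearP mulrDr smoothfun_scaleAr.
Qed.
HB.instance Definition _ := GRing.isLinear.Build R C C _ linder linder_is_linear.

Lemma linderM (f g : C) : linder (f * g) = linder f * g + f * linder g.
Proof.
rewrite /linder mulr_suml mulr_sumr -big_split; apply: eq_bigr => i _ /=.
by rewrite partialM mulrDr mulrA [linfield i * (f * _)]mulrCA.
Qed.

(** A linear map that commutes with [M] preserves the linear field of [M], so pullback along [L s]
    commutes with the derivation for each [s] separately. *)
Lemma linder_savg (c : R -> R) (cc : continuous c) (L : R -> 'M[R]_n)
    (cL : continuous_mx_curve L) (f : C) :
  (forall s, M *m L s = L s *m M) -> linder (savg cc cL f) = savg cc cL (linder f).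
Proof.
move=> ML; apply: sfunP => v; rewrite linderE.
have cc' i j : continuous (fun s => c s * L s i j).
  by move=> s; apply: cvgM; [exact: cc|exact: cL].
have cf i j := @savg_integrand_continuous R n _ (cc' i j) L cL (partial j f) v.
have cg i j : continuous (fun s => (v *m M) 0 i * (c s * L s i j * partial j f (v *m L s))).
  by move=> s; apply: cvgM; [exact: cvg_cst|exact: cf].
rewrite (eq_bigr (fun i => integral01 (fun s =>
   \sum_j (v *m M) 0 i * (c s * L s i j * partial j f (v *m L s))))); last first.
  move=> i _; rewrite (partial_savg _ _ _ (cc' i)) sfun_sumE mulr_sumr.
  rewrite integral01_sum; last by move=> j; exact: cg.
  by apply: eq_bigr => j _; rewrite integral01Z.
rewrite -integral01_sum; last first.
  move=> i s; apply: (@cvg_big _ _ +%R) => [|j _]; first exact: add_continuous.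
  exact: cg.
apply: eq_integral01 => s _; rewrite exchange_big linderE mulr_sumr.
apply: eq_bigr => j _; rewrite -mulmxA -ML mulmxA mxE mulr_suml mulr_sumr.
by apply: eq_bigr => i _; rewrite mulrA mulrCA !mulrA.
Qed.

End LinearVectorField.

Section LogFunctions.
Context {R : realType}.
Implicit Types (u : R -> R) (k s : R).

(** [ln] is 0 on nonpositive numbers, so the function is linear there; at 0 the factor [s] damps the
    bounded oscillation of [u (k * ln s)]. *)
Lemma ln_comp_continuous u k : continuous u -> (forall t, `|u t| <= 1) ->
  continuous (fun s => s * u (k * ln s)).
Proof.
move=> cu bu s; have [s0|s0|->] := ltgtP s 0.
- have E : {near nbhs s, (fun s => s * u (k * ln 0)) =1 (fun s => s * u (k * ln s))}.
    near=> t; rewrite !ln0 //; apply/ltW; near: t; exact: lt_nbhsl.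
  rewrite /continuous_at (ln0 (ltW s0)) -{1}(ln0 (lexx (0 : R))).
  apply: cvg_trans (near_eq_cvg E) _.
  by apply: cvgM; [exact: cvg_id|exact: cvg_cst].
- apply: cvgM; first exact: cvg_id.
  apply: (@cvg_comp _ _ _ (fun s => k * ln s) u _ (nbhs (k * ln s))); last exact: cu.
  by apply: cvgM; [exact: cvg_cst|exact: continuous_ln].
- rewrite /continuous_at mul0r.
  suff : (fun t => t * u (k * ln t)) @ nbhs (0 : R) --> (0 : R) by [].
  apply/cvgr0Pnorm_le => e e0.
  have H := (@cvgr0Pnorm_le _ _ _ (nbhs (0 : R)) _ id).1 cvg_id e e0.
  near=> t; have te : `|t| <= e by near: t; exact: H.
  by rewrite normrM -[leRHS]mulr1 ler_pM.
Unshelve. all: by end_near. Qed.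

Lemma is_derive_ln_comp u (du : R) k s : 0 < s -> is_derive (k * ln s) 1 u du ->
  is_derive s 1 (fun s => u (k * ln s)) (du * (k / s)).
Proof.
move=> s0 Du.
have D1 : is_derive s 1 (fun s => k * ln s) (k / s).
  exact: (@is_deriveZ _ _ _ (@ln R) k s 1 s^-1 (is_derive1_ln s0)).
exact (@is_derive1_comp R u (fun s => k * ln s) s _ _ Du D1).
Qed.

End LogFunctions.

(** * The flow of the spiral field *)

Lemma sum3 (V : nmodType) (F : 'I_3 -> V) : \sum_i F i = F ix + F iy + F iz.
Proof.
rewrite !big_ord_recl big_ord0 addr0 addrA.
by congr (F _ + F _ + F _); apply/val_inj.
Qed.

Lemma forall3 (P : 'I_3 -> Prop) : P ix -> P iy -> P iz -> forall i, P i.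
Proof.
move=> Px Py Pz [[|[|[|//]]] Hi].
- by rewrite (_ : Ordinal Hi = ix) //; exact/val_inj.
- by rewrite (_ : Ordinal Hi = iy) //; exact/val_inj.
- by rewrite (_ : Ordinal Hi = iz) //; exact/val_inj.
Qed.

Section Spiral.
Context {R : realType}.
Local Notation C := (smoothfun R 3).
Variables (tau : R) (tau_gt0 : 0 < tau).
Implicit Types (f g : C) (v : 'rV[R]_3) (s : R).

Definition matrix3 (a b c d e : R) : 'M[R]_3 := \matrix_(i, j)
  match val i, val j with
  | 0%N, 0%N => a | 0%N, 1%N => b | 1%N, 0%N => c | 1%N, 1%N => d | 2%N, 2%N => e
  | _, _ => 0 end.

Lemma mul_matrix3 v a b c d e :
  [/\ (v *m matrix3 a b c d e) 0 ix = v 0 ix * a + v 0 iy * c,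
      (v *m matrix3 a b c d e) 0 iy = v 0 ix * b + v 0 iy * d &
      (v *m matrix3 a b c d e) 0 iz = v 0 iz * e].
Proof. by split; rewrite mxE sum3 !mxE /= ?mulr0 ?addr0 ?add0r. Qed.

Definition spiral_field : 'M[R]_3 := matrix3 tau 1 (- 1) tau 0.

Let k := 2 / tau.

(* [spiral s] is the flow of [spiral_field] at time [k * ln s], so that it
   contracts the (x, y)-plane by [s ^ 2] as [s] goes from [1] to [0]. *)
Definition spiral s : 'M[R]_3 :=
  matrix3 (s * (s * cos (k * ln s))) (s * (s * sin (k * ln s)))
    (- (s * (s * sin (k * ln s)))) (s * (s * cos (k * ln s))) 1.

Lemma spiral1 : spiral 1 = 1%:M.
Proof.
apply/matrixP; apply: forall3; apply: forall3; rewrite !mxE /=;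
  by rewrite ?ln1 ?mulr0 ?cos0 ?sin0 ?mulr0 ?mulr1 ?oppr0.
Qed.

Lemma spiral_axis v : (v *m spiral 0) 0 ix = 0 /\ (v *m spiral 0) 0 iy = 0.
Proof.
rewrite /spiral !mul0r oppr0.
by have [-> -> _] := mul_matrix3 v 0 0 0 0 1; rewrite !mulr0 addr0.
Qed.

Lemma cos_ln_continuous : continuous (fun s : R => s * cos (k * ln s)).
Proof. by apply: ln_comp_continuous; [exact: continuous_cos|exact: cos_max]. Qed.

Lemma sin_ln_continuous : continuous (fun s : R => s * sin (k * ln s)).
Proof. by apply: ln_comp_continuous; [exact: continuous_sin|exact: sin_max]. Qed.

Lemma spiral_continuous : continuous_mx_curve spiral.
Proof.
have c1 : continuous (fun s : R => s * (s * cos (k * ln s))).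
  by move=> s; apply: cvgM; [exact: cvg_id|exact: cos_ln_continuous].
have c2 : continuous (fun s : R => s * (s * sin (k * ln s))).
  by move=> s; apply: cvgM; [exact: cvg_id|exact: sin_ln_continuous].
have c3 : continuous (fun s : R => - (s * (s * sin (k * ln s)))).
  by move=> s; apply: cvgN; exact: c2.
have cc (a : R) : continuous (fun _ : R => a) by exact: cst_continuous.
apply: forall3; apply: forall3; under eq_fun do rewrite mxE /=;
  first [exact: c1|exact: c2|exact: c3|exact: cc].
Qed.

Lemma spiral_comm s : spiral_field *m spiral s = spiral s *m spiral_field.
Proof.
by apply/matrixP; apply: forall3; apply: forall3; rewrite !mxE !sum3 !mxE /=; ring.
Qed.

(** The factor [k / s] is the derivative of the time [k * ln s]. The identity [k * tau = 2] matches
    the derivative of [s ^ 2] with the dilation part of the field. *)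
Lemma is_derive_spiral f v s : 0 < s ->
  is_derive s 1 (fun s => f (v *m spiral s)) (k / s * linder spiral_field f (v *m spiral s)).
Proof.
move=> s0; rewrite linderE mulr_sumr.
pose d : 'rV[R]_3 := \row_i (k / s * (v *m spiral s *m spiral_field) 0 i).
rewrite (eq_bigr (fun i => d 0 i * partial i f (v *m spiral s))); last first.
  by move=> i _; rewrite [d 0 i]mxE mulrA.
apply: is_derive_sfun_curve.
have D2 : is_derive s 1 (fun s => s * s) (s + s).
  have := @is_deriveM _ _ id id s 1 1 1 (is_derive_id _ _) (is_derive_id _ _).
  by rewrite /GRing.scale /= mulr1.
pose cs s := s * (s * cos (k * ln s)).
pose sn s := s * (s * sin (k * ln s)).
have Dc : is_derive s 1 cs (k / s * (tau * cs s - sn s)).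
  have := @is_deriveM _ _ _ _ s 1 _ _ D2 (is_derive_ln_comp s0 (is_derive_cos (k * ln s))).
  rewrite /GRing.scale /= => H; rewrite /cs; under eq_fun do rewrite mulrA.
  apply: is_derive_eq.
  rewrite /sn; have -> : k = 2 / tau by []. 
  by field; rewrite !gt_eqF.
have Ds : is_derive s 1 sn (k / s * (cs s + tau * sn s)).
  have := @is_deriveM _ _ _ _ s 1 _ _ D2 (is_derive_ln_comp s0 (is_derive_sin (k * ln s))).
  rewrite /GRing.scale /= => H; rewrite /sn; under eq_fun do rewrite mulrA.
  apply: is_derive_eq.
  rewrite /cs; have -> : k = 2 / tau by [].
  by field; rewrite !gt_eqF.
have lin (da db x y : R) (fa fb : R -> R) : is_derive s 1 fa da -> is_derive s 1 fb db ->
    is_derive s 1 (fun s => x * fa s + y * fb s) (x * da + y * db).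
  by move=> Da Db; exact (@is_deriveD _ _ _ _ _ s 1 _ _ (@is_deriveZ _ _ _ fa x s 1 da Da) (@is_deriveZ _ _ _ fb y s 1 db Db)).
have E (w : 'rV[R]_3) : (w *m spiral_field) 0 ix = tau * w 0 ix - w 0 iy /\
    (w *m spiral_field) 0 iy = w 0 ix + tau * w 0 iy /\ (w *m spiral_field) 0 iz = 0.
  by have [-> -> ->] := mul_matrix3 w tau 1 (- 1) tau 0; split; [|split]; ring.
have L t : [/\ (v *m spiral t) 0 ix = v 0 ix * cs t + - v 0 iy * sn t,
    (v *m spiral t) 0 iy = v 0 ix * sn t + v 0 iy * cs t & (v *m spiral t) 0 iz = v 0 iz].
  have [-> -> ->] := mul_matrix3 v (cs t) (sn t) (- sn t) (cs t) 1.
  by rewrite mulr1 mulrN mulNr.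
have [Ex [Ey Ez]] := E (v *m spiral s); have [Lx Ly Lz] := L s.
apply: forall3; rewrite mxE.
- rewrite Ex Lx Ly (_ : (fun t => _) = fun t => v 0 ix * cs t + - v 0 iy * sn t); last first.
    by apply/funext => t; case: (L t).
  by have := lin _ _ (v 0 ix) (- v 0 iy) _ _ Dc Ds; congr is_derive; ring.
- rewrite Ey Lx Ly (_ : (fun t => _) = fun t => v 0 ix * sn t + v 0 iy * cs t); last first.
    by apply/funext => t; case: (L t).
  by have := lin _ _ (v 0 ix) (v 0 iy) _ _ Ds Dc; congr is_derive; ring.
- rewrite Ez mulr0 (_ : (fun t => _) = cst (v 0 iz)); first exact: is_derive_cst.
  by apply/funext => t; case: (L t).
Qed.

Lemma sfun_spiral_continuous f v : continuous (fun s => f (v *m spiral s)).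
Proof.
have := @savg_integrand_continuous R 3 _ cst1_continuous _ spiral_continuous f v.
by under eq_fun do rewrite mul1r.
Qed.

(* [m = 0] and [m > 0] are the two cases used: functions invariant under the
   flow are constant along the orbits, and those that grow towards the axis vanish. *)
Lemma spiral_homogeneous m f : linder spiral_field f = - (m%:R * tau / 2) *: f ->
  forall v, f v = 0 ^+ m * f (v *m spiral 0).
Proof.
move=> Df v; apply/eqP; rewrite -subr_eq0 -{1}[v]mulmx1 -spiral1; apply/eqP.
rewrite -{1}[f _]mul1r -{1}(expr1n _ m).
rewrite -[RHS](integral01_cst 0); apply/esym.
(* This product is constant along the orbit: as [k * tau = 2], the derivative of [s ^+ m] cancels
   the factor [k / s * (m%:R * tau / 2)] produced by the hypothesis on [f]. Its values at 1 and 0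
   are the two sides of the claim. *)
apply: (@integral01_derive R (fun s => s ^+ m * f (v *m spiral s))).
- move=> s; apply: cvgM; last exact: sfun_spiral_continuous.
  exact: exprn_continuous.
- exact: cst_continuous.
move=> s /andP[s0 _].
have Dm : is_derive s 1 (fun s : R => s ^+ m) (m%:R * s ^+ m.-1).
  apply: DeriveDef; first exact: exprn_derivable.
  by rewrite exp_derive /GRing.scale /= mulr1.
have := @is_deriveM _ _ _ _ s 1 _ _ Dm (is_derive_spiral f v s0).
rewrite Df sfunZE /GRing.scale /= => H.
move: H; congr is_derive.
rewrite /k; case: (m) => [|m']; first by rewrite !mul0r oppr0 mul0r !mulr0 addr0.
by rewrite exprS /=; field; rewrite !gt_eqF.
Qed.

Definition vanishes_on_axis f := forall v, v 0 ix = 0 -> v 0 iy = 0 -> f v = 0.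

Let D := linder spiral_field.

Lemma linder_spiralE f :
  D f = (tau *: coord ix - coord iy) * partial ix f + (coord ix + tau *: coord iy) * partial iy f.
Proof.
rewrite /D /linder sum3 /linfield !sum3 !mxE /= !scale0r !addr0 !scaleN1r scale1r.
by rewrite mul0r addr0.
Qed.

Lemma vanishes_on_axis_linder f : vanishes_on_axis (D f).
Proof.
move=> v vx vy; rewrite linder_spiralE !(sfunDE, sfunME, sfunNE, sfunZE, coordE) vx vy.
by rewrite mulr0 subrr addr0 !mul0r addr0.
Qed.

Lemma hadamard_axis g : vanishes_on_axis g ->
  exists a b : C, g = coord ix * a + coord iy * b.
Proof.
move=> g0; exists (mean_on [set ix; iy] (partial ix g)), (mean_on [set ix; iy] (partial iy g)).
apply: sfunP => v; rewrite (hadamard [set ix; iy] g v) g0 ?add0r.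
- by rewrite big_setU1 ?inE //= big_set1.
- by rewrite mul_dilationE !inE eqxx mulr0.
- by rewrite mul_dilationE !inE eqxx orbT mulr0.
Qed.

(** The integrand of [u t] times [g] along the flow, after the substitution [t = k * ln s],
    [dt = k / s ds]. *)
Definition spiral_kernel (u : R -> R) g v s := k / s * u (k * ln s) * g (v *m spiral s).

(** With [g = x a + y b], the coordinates of [v *m spiral s] supply a factor [s ^ 2]; one [s]
    cancels [1 / s], the other keeps the weights continuous. So [psi] combines smooth averages of
    [a] and [b] with coefficients [x] and [y], and [D] passes through the averages to [g]. *)
Lemma spiral_integral (u : R -> R) g : continuous u -> (forall t, `|u t| <= 1) ->
  vanishes_on_axis g ->
  exists psi : C, forall v,
    [/\ continuous (spiral_kernel u g v), psi v = integral01 (spiral_kernel u g v) &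
        D psi v = integral01 (spiral_kernel u (D g) v)].
Proof.
move=> cu bu g0.
have c1 : continuous (fun s => k * (s * (u (k * ln s) * cos (k * ln s)))).
  have cuc : continuous (fun t => u t * cos t).
    by move=> t; apply: cvgM; [exact: cu|exact: continuous_cos].
  have buc t : `|u t * cos t| <= 1.
    by rewrite normrM -[leRHS]mulr1 ler_pM // ?bu ?cos_max.
  by move=> s; apply: cvgM; [exact: cvg_cst|exact: (ln_comp_continuous (k := k) cuc buc)].
have c2 : continuous (fun s => k * (s * (u (k * ln s) * sin (k * ln s)))).
  have cuc : continuous (fun t => u t * sin t).
    by move=> t; apply: cvgM; [exact: cu|exact: continuous_sin].
  have buc t : `|u t * sin t| <= 1.
    by rewrite normrM -[leRHS]mulr1 ler_pM // ?bu ?sin_max.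
  by move=> s; apply: cvgM; [exact: cvg_cst|exact: (ln_comp_continuous (k := k) cuc buc)].
pose Ac := savg c1 spiral_continuous; pose As := savg c2 spiral_continuous.
pose psi (a b : C) := coord ix * (Ac a + As b) + coord iy * (Ac b - As a).
have psiE a b v : continuous (spiral_kernel u (coord ix * a + coord iy * b) v) /\
    psi a b v = integral01 (spiral_kernel u (coord ix * a + coord iy * b) v).
  have cc := @savg_integrand_continuous R 3 _ c1 _ spiral_continuous ^~ v.
  have cs := @savg_integrand_continuous R 3 _ c2 _ spiral_continuous ^~ v.
  pose h s := v 0 ix * (k * (s * (u (k * ln s) * cos (k * ln s))) * a (v *m spiral s)
      + k * (s * (u (k * ln s) * sin (k * ln s))) * b (v *m spiral s))
    + v 0 iy * (k * (s * (u (k * ln s) * cos (k * ln s))) * b (v *m spiral s)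
      + - 1 * (k * (s * (u (k * ln s) * sin (k * ln s))) * a (v *m spiral s))).
  have -> : spiral_kernel u (coord ix * a + coord iy * b) v = h.
    apply/funext => s; rewrite /spiral_kernel /h !sfunE.
    have [-> -> _] := mul_matrix3 v (s * (s * cos (k * ln s))) (s * (s * sin (k * ln s)))
      (- (s * (s * sin (k * ln s)))) (s * (s * cos (k * ln s))) 1.
    (* At [s = 0] the inverse is 0 by convention and both sides vanish. *)
    have [->|s0] := eqVneq s 0; first by rewrite invr0 !(mulr0, mul0r, addr0, oppr0).
    by field.
  have h1 : continuous (fun s => k * (s * (u (k * ln s) * cos (k * ln s))) * a (v *m spiral s)
      + k * (s * (u (k * ln s) * sin (k * ln s))) * b (v *m spiral s)).
    by move=> s; apply: cvgD; [exact: cc|exact: cs].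
  have h2' : continuous (fun s => - 1 * (k * (s * (u (k * ln s) * sin (k * ln s))) * a (v *m spiral s))).
    by move=> s; apply: cvgM; [exact: cvg_cst|exact: cs].
  have h2 : continuous (fun s => k * (s * (u (k * ln s) * cos (k * ln s))) * b (v *m spiral s)
      + - 1 * (k * (s * (u (k * ln s) * sin (k * ln s))) * a (v *m spiral s))).
    by move=> s; apply: cvgD; [exact: cc|exact: h2'].
  have hh1 : continuous (fun s => v 0 ix * (k * (s * (u (k * ln s) * cos (k * ln s))) * a (v *m spiral s)
      + k * (s * (u (k * ln s) * sin (k * ln s))) * b (v *m spiral s))).
    by move=> s; apply: cvgM; [exact: cvg_cst|exact: h1].
  have hh2 : continuous (fun s => v 0 iy * (k * (s * (u (k * ln s) * cos (k * ln s))) * b (v *m spiral s)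
      + - 1 * (k * (s * (u (k * ln s) * sin (k * ln s))) * a (v *m spiral s)))).
    by move=> s; apply: cvgM; [exact: cvg_cst|exact: h2].
  split; first by move=> s; apply: cvgD; [exact: hh1|exact: hh2].
  rewrite /h (integral01D hh1 hh2) (integral01Z _ h1) (integral01Z _ h2).
  rewrite (integral01D (cc a) (cs b)) (integral01D (cc b) h2') (integral01Z _ (cs a)).
  by rewrite /psi !sfunE mulN1r.
have [a [b gab]] := hadamard_axis g0.
have Dx : D (coord ix) = tau *: coord ix - coord iy.
  by rewrite linder_spiralE !partial_coord /= mulr1 mulr0 addr0.
have Dy : D (coord iy) = coord ix + tau *: coord iy.
  by rewrite linder_spiralE !partial_coord /= mulr1 mulr0 add0r.
(* Hadamard coefficients of [D g], read off from [D x = tau x - y] and [D y = x + tau y]. *)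
pose a' := D a + tau *: a + b; pose b' := D b + tau *: b - a.
have DD p q : D (p + q) = D p + D q by rewrite /D linearD.
have DB p q : D (p - q) = D p - D q by rewrite /D linearB.
have DM p q : D (p * q) = D p * q + p * D q by rewrite /D linderM.
have Dg : D g = coord ix * a' + coord iy * b'.
  rewrite gab DD !DM Dx Dy /a' /b' !(scale_smoothfun tau).
  by ring.
have AL (c : R -> R) (cc : continuous c) (p q r : C) x :
    savg cc spiral_continuous (p + x *: q + r) =
    savg cc spiral_continuous p + x *: savg cc spiral_continuous q + savg cc spiral_continuous r.
  by rewrite 2!linearD linearZ.
have AN (c : R -> R) (cc : continuous c) (p : C) :
    savg cc spiral_continuous (- p) = - savg cc spiral_continuous p by rewrite linearN.
have DA (c : R -> R) (cc : continuous c) p :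
    D (savg cc spiral_continuous p) = savg cc spiral_continuous (D p).
  exact/linder_savg/spiral_comm.
have Dpsi : D (psi a b) = psi a' b'.
  rewrite /psi DD !DM DB DD !DA Dx Dy /Ac /As /a' /b' !AL !AN.
  by rewrite !(scale_smoothfun tau); ring.
exists (psi a b) => v; rewrite Dpsi Dg [in X in [/\ X, _ & _]]gab [in X in [/\ _, X & _]]gab.
by have [h1 h2] := psiE a b v; have [_ h3] := psiE a' b' v.
Qed.

Lemma spiral_kernel_linder (u du : R -> R) g v s : (forall t : R, is_derive t 1 u (du t)) -> 0 < s ->
  is_derive s 1 (fun s => u (k * ln s) * g (v *m spiral s))
    (spiral_kernel u (D g) v s + spiral_kernel du g v s).
Proof.
move=> Du s0.
have := @is_deriveM _ _ _ _ s 1 _ _ (is_derive_ln_comp s0 (Du (k * ln s))) (is_derive_spiral g v s0).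
congr is_derive; rewrite /spiral_kernel /GRing.scale /= -/D; ring.
Qed.

(* Over the complex numbers this is the equation [(D + i w) (psi1 + i psi2) = g1 + i g2],
   solved by integrating [exp (i w t) (g1 + i g2)] along the flow of the spiral field. *)
Lemma spiral_transport w g1 g2 : vanishes_on_axis g1 -> vanishes_on_axis g2 ->
  exists psi1 psi2 : C, D psi1 - w *: psi2 = g1 /\ D psi2 + w *: psi1 = g2.
Proof.
move=> g10 g20.
pose uc t := cos (w * t); pose us t := sin (w * t).
have lin_c : continuous (fun t : R => w * t) by move=> t; apply: cvgM; [exact: cvg_cst|exact: cvg_id].
have cuc : continuous uc.
  by move=> t; apply: (@cvg_comp _ _ _ _ cos _ (nbhs (w * t))); [exact: lin_c|exact: continuous_cos].
have cus : continuous us.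
  by move=> t; apply: (@cvg_comp _ _ _ _ sin _ (nbhs (w * t))); [exact: lin_c|exact: continuous_sin].
have buc t : `|uc t| <= 1 by exact: cos_max.
have bus t : `|us t| <= 1 by exact: sin_max.
have Dlin (t : R) : is_derive t 1 (fun t => w * t) w.
  by have := @is_deriveZ _ _ _ id w t 1 1 (is_derive_id _ _); rewrite /GRing.scale /= mulr1.
have Duc (t : R) : is_derive t 1 uc (- w * us t).
  have := @is_derive1_comp R cos (fun t => w * t) t _ _ (is_derive_cos _) (Dlin t).
  by congr is_derive; rewrite /us; ring.
have Dus (t : R) : is_derive t 1 us (w * uc t).
  have := @is_derive1_comp R sin (fun t => w * t) t _ _ (is_derive_sin _) (Dlin t).
  by congr is_derive; rewrite /uc; ring.
have KZ (c : R) u g v : spiral_kernel (fun t => c * u t) g v = fun s => c * spiral_kernel u g v s.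
  by apply/funext => s; rewrite /spiral_kernel; ring.
have [pc1 Pc1] := spiral_integral cuc buc g10; have [ps1 Ps1] := spiral_integral cus bus g10.
have [pc2 Pc2] := spiral_integral cuc buc g20; have [ps2 Ps2] := spiral_integral cus bus g20.
have cD u g v : continuous u -> (forall t, `|u t| <= 1) -> continuous (spiral_kernel u (D g) v).
  move=> cu bu; have [psi P] := spiral_integral cu bu (@vanishes_on_axis_linder g).
  by have [] := P v.
have cK (c : R) h : continuous h -> continuous (fun s : R => c * h s).
  by move=> ch s; apply: cvgM; [exact: cvg_cst|exact: ch].
have cA (h1 h2 : R -> R) : continuous h1 -> continuous h2 -> continuous (fun s : R => h1 s + h2 s).
  by move=> c1 c2 s; apply: cvgD; [exact: c1|exact: c2].
(* This gives continuity of the boundary term at [s = 0], where both sides vanish because [spiral 0]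
   projects to the axis. *)
have kE u g v s : vanishes_on_axis g ->
    u (k * ln s) * g (v *m spiral s) = k^-1 * (s * spiral_kernel u g v s).
  move=> g0; rewrite /spiral_kernel; have [->|s0] := eqVneq s 0.
    by have [zx zy] := spiral_axis v; rewrite (g0 _ zx zy) !mulr0.
  have k0 : k != 0 by rewrite /k mulf_neq0 ?invr_neq0 // gt_eqF.
  by field; rewrite s0 k0.
(* Integration by parts over the whole orbit; the end [s = 0] lies on the axis and contributes
   nothing. *)
have fund (u du : R -> R) g v : continuous u -> (forall t, `|u t| <= 1) -> vanishes_on_axis g ->
    (forall t : R, is_derive t 1 u (du t)) -> continuous (spiral_kernel du g v) ->
    integral01 (spiral_kernel u (D g) v) + integral01 (spiral_kernel du g v) = u 0 * g v.
  move=> cu bu g0 Du cdu; have [psi P] := spiral_integral cu bu g0.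
  rewrite -integral01D //; last exact: cD.
  transitivity (u (k * ln 1) * g (v *m spiral 1) - u (k * ln 0) * g (v *m spiral 0)); last first.
    have [zx zy] := spiral_axis v; rewrite (g0 _ zx zy) mulr0 subr0.
    by rewrite ln1 mulr0 spiral1 mulmx1.
  apply: (@integral01_derive R (fun s => u (k * ln s) * g (v *m spiral s))).
  + rewrite (_ : (fun s => _) = fun s => k^-1 * (s * spiral_kernel u g v s)); last first.
      by apply/funext => s; exact: kE.
    apply: cK => s; apply: cvgM; first exact: cvg_id.
    by have [+ _ _] := P v; exact.
  + by apply: cA => //; exact: cD.
  + by move=> s /andP[s0 _]; exact: spiral_kernel_linder.
have key g (pc ps : C) : vanishes_on_axis g ->
    (forall v, [/\ continuous (spiral_kernel uc g v), pc v = integral01 (spiral_kernel uc g v) &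
      D pc v = integral01 (spiral_kernel uc (D g) v)]) ->
    (forall v, [/\ continuous (spiral_kernel us g v), ps v = integral01 (spiral_kernel us g v) &
      D ps v = integral01 (spiral_kernel us (D g) v)]) ->
    forall v, D pc v = g v + w * ps v /\ D ps v = - w * pc v.
  move=> g0 Pc Ps v; have [cc -> ->] := Pc v; have [cs -> ->] := Ps v; split.
  - have := fund uc (fun t => - w * us t) g v cuc buc g0 Duc.
    rewrite KZ integral01Z // /uc mulr0 cos0 mul1r => /(_ (cK _ _ cs)) <-.
    by rewrite mulNr addrNK.
  - have := fund us (fun t => w * uc t) g v cus bus g0 Dus.
    rewrite KZ integral01Z // /us mulr0 sin0 mul0r => /(_ (cK _ _ cc)) /eqP.
    by rewrite addr_eq0 => /eqP ->; rewrite mulNr.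
(* Real and imaginary parts of the complex integral, split by the cosine and sine weights. *)
exists (pc1 - ps2), (pc2 + ps1); split; apply: sfunP => v;
  have [E1 E2] := key g1 pc1 ps1 g10 Pc1 Ps1 v; have [E3 E4] := key g2 pc2 ps2 g20 Pc2 Ps2 v.
- have -> : D (pc1 - ps2) = D pc1 - D ps2 by rewrite /D linearB.
  by rewrite !(sfunDE, sfunNE, sfunZE) E1 E4; ring.
- have -> : D (pc2 + ps1) = D pc2 + D ps1 by rewrite /D linearD.
  by rewrite !(sfunDE, sfunNE, sfunZE) E2 E3; ring.
Qed.

End Spiral.

Local Close Scope classical_set_scope.
Local Notation setT := finset.setT.
Local Notation set0 := finset.set0.

(** * The graded algebra of multivector fields *)

Section Inversions.
Context {n : nat}.
Implicit Types (I J K : {set 'I_n}) (i j : 'I_n).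

Lemma inversionsE I J : inversions I J = (\sum_(i in I) \sum_(j in J) (j < i))%N.
Proof.
rewrite /inversions -sum1_card (pair_big_dep (mem I) (fun i => mem J)) /=.
rewrite [RHS](bigID (fun p : 'I_n * 'I_n => (p.2 < p.1)%N)) /= [X in (_ + X)%N]big1.
  rewrite addn0; apply: eq_big => [p|p]; case: p => a b; rewrite inE finset.in_setX //.
  by move=> /andP[_ ->].
by move=> p /andP[_ /negPf ->].
Qed.

Lemma inversionsUl I I' J : [disjoint I & I'] ->
  inversions (I :|: I') J = (inversions I J + inversions I' J)%N.
Proof.
move=> dI; rewrite !inversionsE -bigU //; apply: eq_bigl => i.
by rewrite !inE.
Qed.

Lemma inversionsUr I J J' : [disjoint J & J'] ->
  inversions I (J :|: J') = (inversions I J + inversions I J')%N.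
Proof.
move=> dJ; rewrite !inversionsE -big_split; apply: eq_bigr => i _.
by rewrite -bigU //; apply: eq_bigl => j; rewrite !inE.
Qed.

(** Two distinct elements are inverted in exactly one of the two orders. *)
Lemma inversionsC I J : [disjoint I & J] ->
  (inversions I J + inversions J I = #|I| * #|J|)%N.
Proof.
move=> dIJ; rewrite !inversionsE [X in (_ + X)%N]exchange_big -big_split /=.
rewrite -sum_nat_const; apply: eq_bigr => i iI; rewrite -big_split /=.
rewrite -sum1_card; apply: eq_bigr => j jJ.
have : i != j by apply: contraTneq iI => ->; rewrite (disjointFl dIJ).
by rewrite neq_ltn => /orP[] ij; rewrite ij ltnNge (ltnW ij).
Qed.

Lemma inversions0l J : inversions set0 J = 0%N.
Proof. by rewrite inversionsE big_set0. Qed.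

Lemma inversions0r I : inversions I set0 = 0%N.
Proof. by rewrite inversionsE big1 // => i _; rewrite big_set0. Qed.

Lemma setDU_disjoint I J : [disjoint I & J] -> (I :|: J) :\: I = J.
Proof.
move=> dIJ; apply/finset.setP => i; rewrite !inE; case: (boolP (i \in I)) => //= iI.
by rewrite (disjointFr dIJ iI).
Qed.

Lemma setUD_sub I J : J \subset I -> J :|: (I :\: J) = I.
Proof.
move=> JI; apply/finset.setP => i; rewrite !inE; case: (boolP (i \in J)) => //= iJ.
by rewrite (fintype.subsetP JI).
Qed.

Lemma subset_setD_disjoint I J K : (J \subset K :\: I) = (J \subset K) && [disjoint I & J].
Proof. by rewrite finset.subsetD disjoint_sym. Qed.

End Inversions.

Section GradedAlgebra.
Context {R : realType} {n : nat}.
Local Notation C := (smoothfun R n).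
Local Notation mvf := (mvf R n).
Local Notation e := (@mvf_partial R n).
Implicit Types (f g : C) (P Q S X Y : mvf) (I J K : {set 'I_n}) (i j : 'I_n).

Lemma wedgeE P Q K : wedge P Q K =
  \sum_(I : {set 'I_n} | I \subset K) (-1) ^+ inversions I (K :\: I) * (P I * Q (K :\: I)).
Proof. by rewrite ffunE. Qed.

Lemma mvfDE P Q K : (P + Q) K = P K + Q K. Proof. by rewrite ffunE. Qed.
Lemma mvfNE P K : (- P) K = - P K. Proof. by rewrite ffunE. Qed.
Lemma mvfZE (a : R) P K : (a *: P) K = a *: P K. Proof. by rewrite ffunE. Qed.
Lemma mvf0E K : (0 : mvf) K = 0. Proof. by rewrite ffunE. Qed.

Lemma signD (a b : nat) (x : C) : (-1) ^+ (a + b) * x = (-1) ^+ a * ((-1) ^+ b * x).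
Proof. by rewrite exprD mulrA. Qed.

Lemma eq_sign (a b : nat) (x : C) : odd a = odd b -> (-1) ^+ a * x = (-1) ^+ b * x.
Proof. by move=> ab; rewrite -signr_odd ab signr_odd. Qed.

(** Both sides sum over ordered partitions of [K] into three blocks; the right-hand sum over
    [J \subset I] is reindexed by the middle block [M = I :\: J]. *)
Lemma wedgeA P Q S : wedge P (wedge Q S) = wedge (wedge P Q) S.
Proof.
apply/ffunP => K; rewrite !wedgeE.
under [RHS]eq_bigr => I IK do rewrite wedgeE mulr_suml mulr_sumr.
rewrite (exchange_big_dep (fun J : {set 'I_n} => J \subset K)) /=; last first.
  by move=> I J IK JI; exact: fintype.subset_trans JI IK.
apply: eq_bigr => J JK; rewrite wedgeE !mulr_sumr.
rewrite [RHS](reindex_onto (fun M : {set 'I_n} => J :|: M) (fun I : {set 'I_n} => I :\: J)) /=; last first.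
  by move=> I /andP[_ JI]; exact: setUD_sub.
apply: eq_big => [M|M].
  rewrite subset_setD_disjoint finset.subUset JK finset.subsetUl andbT /=.
  congr (_ && _); apply/idP/eqP => [|<-]; first exact: setDU_disjoint.
  by rewrite disjoint_sym finset.disjoints_subset; apply/fintype.subsetP => i; rewrite !inE => /andP[].
rewrite subset_setD_disjoint => /andP[MK dJM].
rewrite setDU_disjoint // finset.setDDl.
have dM : [disjoint M & K :\: (J :|: M)].
  by rewrite disjoint_sym finset.disjoints_subset; apply/fintype.subsetP => i; rewrite !inE negb_or => /andP[/andP[]].
have dJ : [disjoint J & K :\: (J :|: M)].
  by rewrite disjoint_sym finset.disjoints_subset; apply/fintype.subsetP => i; rewrite !inE negb_or => /andP[/andP[]].
have -> : K :\: J = M :|: (K :\: (J :|: M)).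
  apply/finset.setP => i; rewrite !inE; case: (boolP (i \in M)) => /= iM.
    by rewrite (fintype.subsetP MK) // (disjointFl dJM).
  by rewrite orbF.
rewrite inversionsUr // inversionsUl // !exprD; ring.
Qed.

Lemma wedgeDl P Q S : wedge (P + Q) S = wedge P S + wedge Q S.
Proof.
apply/ffunP => K; rewrite !ffunE -big_split; apply: eq_bigr => I _ /=.
by rewrite ffunE mulrDl mulrDr.
Qed.

Lemma wedgeDr P Q S : wedge P (Q + S) = wedge P Q + wedge P S.
Proof. by rewrite -[Q]scale1r wedge_linearr !scale1r. Qed.

Lemma wedge0l P : wedge 0 P = 0.
Proof. by apply: (addrI (wedge 0 P)); rewrite -wedgeDl !addr0. Qed.

Lemma wedge0r P : wedge P 0 = 0.
Proof. by apply: (addrI (wedge P 0)); rewrite -wedgeDr !addr0. Qed.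

Lemma wedgeNl P Q : wedge (- P) Q = - wedge P Q.
Proof. by apply: (addrI (wedge P Q)); rewrite -wedgeDl !subrr wedge0l. Qed.

Lemma wedgeNr P Q : wedge P (- Q) = - wedge P Q.
Proof. by apply: (addrI (wedge P Q)); rewrite -wedgeDr !subrr wedge0r. Qed.

Lemma wedgeZl a P Q : wedge (a *: P) Q = a *: wedge P Q.
Proof.
apply/ffunP => K; rewrite !ffunE scaler_sumr; apply: eq_bigr => I _ /=.
by rewrite ffunE !(scale_smoothfun a); ring.
Qed.

Lemma wedge_suml (T : finType) (F : T -> mvf) Q :
  wedge (\sum_t F t) Q = \sum_t wedge (F t) Q.
Proof. by elim/big_ind2: _ => [|x1 x2 y1 y2 <- <-|//]; rewrite ?wedge0l ?wedgeDl. Qed.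

Lemma wedge_sumr (T : finType) (F : T -> mvf) Q :
  wedge Q (\sum_t F t) = \sum_t wedge Q (F t).
Proof. by elim/big_ind2: _ => [|x1 x2 y1 y2 <- <-|//]; rewrite ?wedge0r ?wedgeDr. Qed.

Lemma wedge_funl f P K : wedge (mvf_fun f) P K = f * P K.
Proof.
rewrite wedgeE (bigD1 set0) ?finset.sub0set //= big1 ?addr0.
  by rewrite inversions0l ffunE eqxx finset.setD0 mul1r.
by move=> I /andP[_ /negPf I0]; rewrite ffunE I0 mul0r mulr0.
Qed.

Lemma wedge_funr f P K : wedge P (mvf_fun f) K = f * P K.
Proof.
rewrite wedgeE (bigD1 K) //= big1 ?addr0.
  by rewrite finset.setDv inversions0r ffunE eqxx mul1r mulrC.
move=> I /andP[IK I0]; rewrite ffunE finset.setD_eq0 ifN ?mulr0 //.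
by apply: contraNN I0 => KI; rewrite finset.eqEsubset IK.
Qed.

Lemma wedge_funC f P : wedge (mvf_fun f) P = wedge P (mvf_fun f).
Proof. by apply/ffunP => K; rewrite wedge_funl wedge_funr. Qed.

(** The grading involution. It expresses Koszul signs for fields that need not be homogeneous. *)
Definition parity P : mvf := [ffun I : {set 'I_n} => (-1) ^+ #|I| * P I].

Lemma parityK P : parity (parity P) = P.
Proof. by apply/ffunP => I; rewrite !ffunE mulrA -expr2 sqrr_sign mul1r. Qed.

Lemma parity_is_linear : linear parity.
Proof. by move=> a P Q; apply/ffunP => I; rewrite !ffunE mulrDr smoothfun_scaleAr. Qed.
HB.instance Definition _ := GRing.isLinear.Build R mvf mvf _ parity parity_is_linear.

Lemma homogeneous_parity k P : homogeneous k P -> parity P = (-1) ^+ k *: P.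
Proof.
move=> hP; apply/ffunP => I; rewrite !ffunE; have [<-|Ik] := eqVneq #|I| k.
  rewrite -[in LHS]signr_odd -[in RHS]signr_odd; case: (odd _).
    by rewrite !expr1 scaleN1r mulN1r.
  by rewrite !expr0 scale1r mul1r.
by rewrite hP // mulr0 scaler0.
Qed.

Lemma cardsDsub I K : I \subset K -> (#|I| + #|K :\: I| = #|K|)%N.
Proof. by move=> IK; rewrite cardsD (finset.setIidPr IK) subnKC // subset_leq_card. Qed.

Lemma parity_wedge P Q : parity (wedge P Q) = wedge (parity P) (parity Q).
Proof.
apply/ffunP => K; rewrite !ffunE mulr_sumr; apply: eq_bigr => I IK.
by rewrite !ffunE -(cardsDsub IK) exprD; ring.
Qed.

(** Reindexing by complements exchanges the factors; moving one element past a set of [m] elements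
    changes the sign by [(-1) ^+ m], which [parity P] carries. *)
Lemma wedge_homogeneous1C X P : homogeneous 1 X -> wedge X P = wedge (parity P) X.
Proof.
move=> hX; apply/ffunP => K; rewrite !wedgeE.
rewrite [RHS](reindex_onto (fun I : {set 'I_n} => K :\: I) (fun I : {set 'I_n} => K :\: I)) /=; last first.
  by move=> I IK; rewrite finset.setDDr finset.setDv finset.set0U; apply/finset.setIidPr.
apply: eq_big => [I|I IK].
  rewrite finset.subsetDl finset.setDDr finset.setDv finset.set0U /=.
  by apply/idP/eqP => /finset.setIidPr.
have KK : K :\: (K :\: I) = I.
  by rewrite finset.setDDr finset.setDv finset.set0U; apply/finset.setIidPr.
rewrite KK ffunE; have [I1|I1] := eqVneq #|I| 1%N; last by rewrite hX // mul0r !mulr0.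
have dI : [disjoint I & K :\: I].
  by rewrite disjoint_sym finset.disjoints_subset; apply/fintype.subsetP => i; rewrite !inE => /andP[].
have -> : (-1) ^+ inversions I (K :\: I) =
    (-1) ^+ inversions (K :\: I) I * (-1) ^+ #|K :\: I| :> C; last by ring.
rewrite -exprD -signr_odd -[RHS]signr_odd; congr (_ ^+ nat_of_bool _).
by have := congr1 odd (inversionsC dI); rewrite I1 mul1n !oddD => <-; rewrite addbCA addbb addbF.
Qed.

Lemma mvf_dx_wedge i P Q :
  mvf_dx i (wedge P Q) = wedge (mvf_dx i P) Q + wedge P (mvf_dx i Q).
Proof.
apply/ffunP => K; rewrite !ffunE raddf_sum -big_split; apply: eq_bigr => I _ /=.
by rewrite raddfMsign /= partialM !ffunE mulrDr.
Qed.

Lemma mvf_dxC i j P : mvf_dx i (mvf_dx j P) = mvf_dx j (mvf_dx i P).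
Proof. by apply/ffunP => K; rewrite !ffunE partialC. Qed.

Lemma parity_dx i P : parity (mvf_dx i P) = mvf_dx i (parity P).
Proof. by apply/ffunP => K; rewrite !ffunE raddfMsign. Qed.

HB.instance Definition _ i := GRing.isLinear.Build R mvf mvf _ (mvf_dx i) (@mvf_dx_is_linear R n i).
HB.instance Definition _ i := GRing.isLinear.Build R mvf mvf _ (lcontr i) (@lcontr_is_linear R n i).

Lemma rcontrE i P : rcontr i P = parity (lcontr i P).
Proof.
apply/ffunP => I; rewrite !ffunE; case: ifP => iI; first by rewrite mulr0.
rewrite -signD; apply: eq_sign; have dI : [disjoint [set i] & I].
  by rewrite disjoints1 iI.
have := congr1 odd (inversionsC dI); rewrite cards1 mul1n !oddD => <-.
by rewrite addbC addbA addbb.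
Qed.

Lemma parity_lcontr i P : parity (lcontr i P) = - lcontr i (parity P).
Proof.
apply/ffunP => I; rewrite !ffunE; case: ifP => iI; first by rewrite mulr0 oppr0.
rewrite cardsU1 iI exprS; ring.
Qed.

End GradedAlgebra.

Ltac mvf_abel :=
  repeat match goal with |- context [wedge ?P ?Q] => generalize (wedge P Q); intro end;
  apply/ffunP => ?; rewrite !ffunE; ring.

(** * Contractions and Leibniz rules for the Schouten bracket *)

Section Contraction.
Context {R : realType} {n : nat}.
Local Notation C := (smoothfun R n).
Local Notation mvf := (mvf R n).
Local Notation e := (@mvf_partial R n).
Implicit Types (f g : C) (P Q S X Y : mvf) (I J K : {set 'I_n}) (i j : 'I_n).

Lemma disjoint_setD (I K : {set 'I_n}) : [disjoint I & K :\: I].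
Proof.
by rewrite disjoint_sym finset.disjoints_subset; apply/fintype.subsetP => i; rewrite !inE => /andP[].
Qed.

Lemma big_subset_setU1 (F : {set 'I_n} -> C) i K : i \in K ->
  \sum_(I : {set 'I_n} | I \subset K) F I =
  \sum_(I : {set 'I_n} | I \subset K :\ i) (F (i |: I) + F I).
Proof.
move=> iK; rewrite big_split (bigID (fun I : {set 'I_n} => i \in I)) /=; congr (_ + _).
  rewrite (reindex_onto (fun I : {set 'I_n} => i |: I) (fun I : {set 'I_n} => I :\ i)) /=.
    apply: eq_bigl => I; rewrite !inE eqxx andbT finset.subUset finset.sub1set iK /=.
    rewrite finset.subsetD1; congr (_ && _); apply/eqP/idP => [<-|]; last exact: setU1K.
    by rewrite !inE eqxx.
  by move=> I /andP[_ iI]; exact: finset.setD1K.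
by apply: eq_bigl => I; rewrite finset.subsetD1.
Qed.

(** If [i \in K] the left side is 0, and on the right the term of the first sum at [I] cancels that
    of the second at [i |: I]. If [i \notin K], the contracted index comes from exactly one of the
    two factors, which splits the sum. *)
Lemma lcontr_wedge i P Q :
  lcontr i (wedge P Q) = wedge (lcontr i P) Q + wedge (parity P) (lcontr i Q).
Proof.
apply/ffunP => K; rewrite [LHS]ffunE [RHS]ffunE !wedgeE.
have [iK|iK] := boolP (i \in K).
  rewrite !(big_subset_setU1 _ iK) -big_split big1 // => I /=.
  rewrite finset.subsetD1 => /andP[IK iI]; rewrite !ffunE !inE eqxx iI iK /=.
  rewrite (negPf iI) /= mul0r mulr0 add0r !mulr0 addr0.
  have -> : i |: K :\: (i |: I) = K :\: I.
    apply/finset.setP => j; rewrite !inE; have [->|ji] := eqVneq j i; last by rewrite /=.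
    by rewrite iK iI.
  have dI : [disjoint I & [set i]] by rewrite disjoint_sym disjoints1.
  have dKI : [disjoint [set i] & K :\: (i |: I)] by rewrite disjoints1 !inE eqxx.
  have EK : K :\: I = [set i] :|: (K :\: (i |: I)).
    apply/finset.setP => j; rewrite !inE; have [->|ji] := eqVneq j i; last by rewrite /=.
    by rewrite iK iI.
  rewrite [in inversions I (K :\: I)]EK inversionsUr // inversionsUl; last by rewrite disjoint_sym.
  rewrite cardsU1 iI !exprD expr1.
  have := inversionsC dI; rewrite cards1 muln1 => E.
  have -> : (-1) ^+ #|I| = (-1) ^+ inversions I [set i] * (-1) ^+ inversions [set i] I :> C.
    by rewrite -exprD E.
  set a := _ ^+ inversions I [set i]; set b := _ ^+ inversions I _.
  set c := _ ^+ inversions [set i] I; set d := _ ^+ inversions [set i] _.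
  have dd : d * d = 1 by rewrite -expr2 sqrr_sign.
  set p := P _; set q := Q _; transitivity (a * b * (c * p * q) * (1 - d * d)); first by ring.
  by rewrite dd subrr mulr0.
rewrite (big_subset_setU1 _ (finset.setU11 i K)) setU1K // mulr_sumr -big_split.
apply: eq_bigr => I IK /=; rewrite !ffunE !inE.
have iI : i \notin I by apply: contraNN iK => /(fintype.subsetP IK).
rewrite (negPf iI) (negPf iK) andbF.
have E1 : (i |: K) :\: (i |: I) = K :\: I.
  apply/finset.setP => j; rewrite !inE; have [->|ji] := eqVneq j i; last by rewrite /=.
  by rewrite (negPf iK) andbF.
have E2 : (i |: K) :\: I = i |: (K :\: I).
  apply/finset.setP => j; rewrite !inE; have [->|ji] := eqVneq j i; last by rewrite /=.
  by rewrite iI.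
have d1 : [disjoint [set i] & I] by rewrite disjoints1.
have d2 : [disjoint [set i] & K :\: I] by rewrite disjoints1 !inE (negPf iK) andbF.
rewrite E1 E2 inversionsUl // inversionsUr //.
have -> : inversions [set i] K = (inversions [set i] I + inversions [set i] (K :\: I))%N.
  by rewrite -inversionsUr; [rewrite setUD_sub|exact: disjoint_setD].
have -> : (-1) ^+ #|I| = (-1) ^+ inversions I [set i] * (-1) ^+ inversions [set i] I :> C.
  by rewrite -exprD addnC (inversionsC d1) cards1 mul1n.
rewrite !exprD.
set a := _ ^+ inversions [set i] I; set b := _ ^+ inversions [set i] _.
set c := _ ^+ inversions I (K :\: I); set d := _ ^+ inversions I _.
have bb : b * b = 1 by rewrite -expr2 sqrr_sign.
apply/eqP; rewrite -subr_eq0; apply/eqP.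
transitivity ((b * b - 1) * (a * c * (P (i |: I) * Q (K :\: I)))); first by ring.
by rewrite bb subrr mul0r.
Qed.

Lemma lcontrC i j P : lcontr i (lcontr j P) = - lcontr j (lcontr i P).
Proof.
apply/ffunP => I; rewrite !ffunE !inE.
have [->|ij] := eqVneq i j.
  by case: ifP => _; rewrite ?eqxx /= ?mulr0 oppr0.
rewrite /=; case: (boolP (i \in I)) => iI; case: (boolP (j \in I)) => jI;
  rewrite ?mulr0 ?oppr0 //.
have d1 : [disjoint [set i] & I] by rewrite disjoints1.
have d2 : [disjoint [set j] & I] by rewrite disjoints1.
have d3 : [disjoint [set i] & [set j]] by rewrite disjoints1 !inE.
rewrite !inversionsUr // finset.setUCA.
have -> : (-1) ^+ (inversions [set j] [set i] + inversions [set j] I) =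
   - ((-1) ^+ (inversions [set i] [set j] + inversions [set j] I)) :> C.
  have /(congr1 odd) := inversionsC d3; rewrite !cards1 oddD /= => E.
  rewrite !exprD -mulNr; congr (_ * _); rewrite -signr_odd -[in RHS]signr_odd; move: E.
  by case: (odd (inversions [set i] [set j])); case: (odd (inversions [set j] [set i]));
    rewrite //= ?expr0 ?expr1 ?opprK.
by rewrite !exprD; ring.
Qed.

Lemma lcontr_dx i j P : lcontr i (mvf_dx j P) = mvf_dx j (lcontr i P).
Proof.
by apply/ffunP => I; rewrite !ffunE; case: ifP; rewrite ?raddf0 ?raddfMsign.
Qed.

Lemma rcontr_dx i j P : rcontr i (mvf_dx j P) = mvf_dx j (rcontr i P).
Proof. by rewrite !rcontrE lcontr_dx parity_dx. Qed.

Lemma rcontr_parity i P : rcontr i (parity P) = - lcontr i P.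
Proof. by rewrite rcontrE parity_lcontr parityK. Qed.

Lemma schoutenE P Q : schouten P Q =
  \sum_i (wedge (rcontr i P) (mvf_dx i Q) - wedge (mvf_dx i P) (lcontr i Q)).
Proof. by []. Qed.

Lemma schoutenDl P P' Q : schouten (P + P') Q = schouten P Q + schouten P' Q.
Proof.
rewrite !schoutenE -big_split; apply: eq_bigr => i _.
by rewrite !rcontrE !raddfD !wedgeDl opprD addrACA.
Qed.

Lemma schoutenZl a P Q : schouten (a *: P) Q = a *: schouten P Q.
Proof.
rewrite !schoutenE scaler_sumr; apply: eq_bigr => i _.
by rewrite !rcontrE !linearZ !wedgeZl scalerBr.
Qed.

Lemma schoutenDr P Q Q' : schouten P (Q + Q') = schouten P Q + schouten P Q'.
Proof. exact: raddfD. Qed.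

Lemma mvf_dx_schouten k P Q :
  mvf_dx k (schouten P Q) = schouten (mvf_dx k P) Q + schouten P (mvf_dx k Q).
Proof.
rewrite !schoutenE raddf_sum -big_split; apply: eq_bigr => i _.
by rewrite raddfB /= !mvf_dx_wedge rcontr_dx lcontr_dx !(mvf_dxC i k) opprD addrACA.
Qed.

Lemma homogeneous_dx k i P : homogeneous k P -> homogeneous k (mvf_dx i P).
Proof. by move=> hP I Ik; rewrite ffunE hP // raddf0. Qed.

Lemma lcontr_homogeneous1 i X : homogeneous 1 X -> lcontr i X = mvf_fun (X [set i]).
Proof.
move=> hX; apply/ffunP => I; rewrite !ffunE; case: eqVneq => [->|I0].
  by rewrite inE inversions0r mul1r finset.setU0.
case: ifP => // iI; rewrite hX ?mulr0 // cardsU1 iI.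
by rewrite eqSS cards_eq0.
Qed.

Lemma parity_fun f : parity (mvf_fun f) = mvf_fun f.
Proof.
by apply/ffunP => I; rewrite !ffunE; case: eqP => [->|]; rewrite ?cards0 ?mul1r ?mulr0.
Qed.

Lemma rcontr_homogeneous1 i X : homogeneous 1 X -> rcontr i X = mvf_fun (X [set i]).
Proof. by move=> hX; rewrite rcontrE lcontr_homogeneous1 // parity_fun. Qed.

Lemma parity_homogeneous1 X : homogeneous 1 X -> parity X = - X.
Proof. by move=> /homogeneous_parity ->; rewrite expr1 scaleN1r. Qed.

Lemma wedge_homogeneous1Cr X P : homogeneous 1 X -> wedge P X = wedge X (parity P).
Proof. by move=> hX; rewrite [RHS]wedge_homogeneous1C // parityK. Qed.

(** Splitting off a factor of degree 1 is enough to expand brackets with a product of two vector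
    fields. *)
Lemma schouten_wedge1l X P Q : homogeneous 1 X ->
  schouten (wedge X P) Q = wedge X (schouten P Q) + wedge (parity P) (schouten X Q).
Proof.
move=> hX; rewrite !schoutenE !wedge_sumr -big_split; apply: eq_bigr => i _ /=.
rewrite rcontrE lcontr_wedge raddfD /= !parity_wedge parityK -!rcontrE.
rewrite mvf_dx_wedge rcontr_homogeneous1 // !wedgeDl wedge_funC.
rewrite (wedge_homogeneous1C P (homogeneous_dx i hX)) !wedgeDr !wedgeNr !wedgeA.
by mvf_abel.
Qed.

Lemma schouten_wedge1r X P Q : homogeneous 1 X ->
  schouten P (wedge X Q) = - wedge (schouten X P) Q - wedge X (schouten (parity P) Q).
Proof.
move=> hX; rewrite !schoutenE wedge_suml wedge_sumr -!sumrN -big_split; apply: eq_bigr => i _ /=.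
rewrite lcontr_wedge mvf_dx_wedge (lcontr_homogeneous1 _ hX) (rcontr_homogeneous1 _ hX).
rewrite (parity_homogeneous1 hX) rcontr_parity -parity_dx !(wedgeDl, wedgeDr, wedgeNl, wedgeNr) !wedgeA.
rewrite -(wedge_homogeneous1Cr _ hX) -wedge_funC.
rewrite (wedge_homogeneous1C _ (homogeneous_dx i hX)) -rcontrE.
rewrite (wedge_homogeneous1C (lcontr i P) hX) -rcontrE.
by mvf_abel.
Qed.

End Contraction.

(** * Lie derivatives along vector fields *)

Section LieDerivative.
Context {R : realType} {n : nat}.
Local Notation C := (smoothfun R n).
Local Notation mvf := (mvf R n).
Local Notation e := (@mvf_partial R n).
Implicit Types (f g : C) (P Q S X Y : mvf) (I J K : {set 'I_n}) (i j k : 'I_n).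

Lemma lcontr_fun i f : lcontr i (mvf_fun f) = 0.
Proof.
apply/ffunP => I; rewrite !ffunE; case: ifP => // _.
rewrite ifN ?mulr0 //; apply/finset.set0Pn; exists i; exact: finset.setU11.
Qed.

Lemma lcontr_wedge_fun i f P : lcontr i (wedge (mvf_fun f) P) = wedge (mvf_fun f) (lcontr i P).
Proof. by rewrite lcontr_wedge lcontr_fun wedge0l add0r parity_fun. Qed.

Lemma schouten1E X P : homogeneous 1 X -> schouten X P =
  \sum_i (wedge (mvf_fun (X [set i])) (mvf_dx i P) - wedge (mvf_dx i X) (lcontr i P)).
Proof. by move=> hX; rewrite schoutenE; apply: eq_bigr => i _; rewrite rcontr_homogeneous1. Qed.

Lemma parity_schouten1 X P : homogeneous 1 X -> parity (schouten X P) = schouten X (parity P).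
Proof.
move=> hX; rewrite !schouten1E // raddf_sum; apply: eq_bigr => i _.
rewrite raddfB /= !parity_wedge parity_fun parity_dx.
rewrite (parity_homogeneous1 (homogeneous_dx i hX)) parity_lcontr.
by rewrite wedgeNl wedgeNr opprK.
Qed.

Lemma schouten1_wedge X P Q : homogeneous 1 X ->
  schouten X (wedge P Q) = wedge (schouten X P) Q + wedge P (schouten X Q).
Proof.
move=> hX; rewrite !schouten1E // wedge_suml wedge_sumr -big_split; apply: eq_bigr => i _ /=.
rewrite mvf_dx_wedge lcontr_wedge !(wedgeDl, wedgeDr, wedgeNl, wedgeNr) !wedgeA.
rewrite -[in RHS](wedge_funC _ P) (wedge_homogeneous1C (parity P) (homogeneous_dx i hX)) parityK.
by mvf_abel.
Qed.

(** The commutator of the Lie derivative with contraction by [dx_k] is contraction by the Lie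
    derivative of [dx_k], the differential of the [k]-th coefficient of [X]. *)
Lemma schouten1_lcontr X k P : homogeneous 1 X -> schouten X (lcontr k P) =
  lcontr k (schouten X P) + \sum_i wedge (mvf_fun (partial i (X [set k]))) (lcontr i P).
Proof.
move=> hX; rewrite !schouten1E // raddf_sum -big_split; apply: eq_bigr => i _ /=.
rewrite raddfB /= lcontr_wedge_fun lcontr_wedge.
rewrite (lcontr_homogeneous1 _ (homogeneous_dx i hX)) (parity_homogeneous1 (homogeneous_dx i hX)).
rewrite lcontr_dx [lcontr k (lcontr i P)]lcontrC !(wedgeDl, wedgeDr, wedgeNl, wedgeNr) ffunE.
by mvf_abel.
Qed.

Lemma schouten1_rcontr X k P : homogeneous 1 X -> schouten X (rcontr k P) =
  rcontr k (schouten X P) + \sum_i wedge (mvf_fun (partial i (X [set k]))) (rcontr i P).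
Proof.
move=> hX; rewrite !rcontrE -parity_schouten1 // schouten1_lcontr // raddfD [X in _ + X = _]raddf_sum /=.
by congr (_ + _); apply: eq_bigr => i _; rewrite rcontrE parity_wedge parity_fun.
Qed.

Lemma schouten1_dx X k P : homogeneous 1 X ->
  schouten X (mvf_dx k P) = mvf_dx k (schouten X P) - schouten (mvf_dx k X) P.
Proof. by move=> hX; rewrite mvf_dx_schouten addrC addKr. Qed.

(** The Lie derivative along [X] is a derivation of the product, so it moves through the formula of
    the bracket. Its commutators with [mvf_dx k] and with the contractions leave double sums that
    cancel in pairs after exchanging the indices. *)
Lemma schouten1_jacobi X P Q : homogeneous 1 X ->
  schouten X (schouten P Q) = schouten (schouten X P) Q + schouten P (schouten X Q).
Proof.
move=> hX; pose F i k : mvf := mvf_fun (partial i (X [set k])).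
rewrite [schouten P Q]schoutenE raddf_sum /=.
under eq_bigr => k _.
  rewrite raddfB /= !schouten1_wedge // schouten1_rcontr // !schouten1_dx // schouten1_lcontr //.
  rewrite !(wedgeDl, wedgeDr, wedgeNl, wedgeNr).
  over.
rewrite [schouten (schouten X P) Q]schoutenE [schouten P (schouten X Q)]schoutenE -big_split /=.
apply/eqP; rewrite -subr_eq0 -sumrB; apply/eqP.
have ddX k := homogeneous_dx k hX.
(* [A] and [D] carry first derivatives of the coefficients of [X]; [B] carries second derivatives,
   whose symmetry is used in its cancellation. *)
pose A i k := wedge (wedge (F i k) (rcontr i P)) (mvf_dx k Q).
pose B i k := wedge (mvf_dx i (mvf_dx k X)) (wedge (lcontr k P) (lcontr i Q)).
pose D i k := wedge (wedge (F i k) (mvf_dx k P)) (lcontr i Q).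
transitivity ((\sum_k \sum_i A i k - \sum_k \sum_i A k i) + (\sum_k \sum_i B i k -
    \sum_k \sum_i B k i) + (\sum_k \sum_i D k i - \sum_k \sum_i D i k)).
  rewrite -!sumrB -!big_split /=; apply: eq_bigr => k _.
  have E1 : wedge (\sum_i wedge (F i k) (rcontr i P)) (mvf_dx k Q) = \sum_i A i k.
    by rewrite wedge_suml.
  have E2 : wedge (mvf_dx k P) (\sum_i wedge (F i k) (lcontr i Q)) = \sum_i D i k.
    by rewrite wedge_sumr; apply: eq_bigr => i _; rewrite /D /F wedgeA -(wedge_funC _ (mvf_dx k P)).
  have E3 : wedge (rcontr k P) (schouten (mvf_dx k X) Q) = \sum_i (A k i - B i k).
    rewrite schouten1E // wedge_sumr; apply: eq_bigr => i _.
    rewrite /A /B /F wedgeDr wedgeNr ffunE !wedgeA (wedge_funC _ (rcontr k P)).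
    by rewrite (wedge_homogeneous1C (lcontr k P) (homogeneous_dx i (ddX k))) -rcontrE.
  have E4 : wedge (schouten (mvf_dx k X) P) (lcontr k Q) = \sum_i (D k i - B k i).
    rewrite schouten1E // wedge_suml; apply: eq_bigr => i _.
    by rewrite /D /B /F wedgeDl wedgeNl ffunE !wedgeA (mvf_dxC k).
  rewrite -/(F _ _) E1 E2 E3 E4.
  rewrite !sumrB.
  move: (\sum_i A i k) (\sum_i A k i) (\sum_i B i k) (\sum_i B k i) (\sum_i D i k) (\sum_i D k i).
  by move=> a1 a2 b1 b2 d1 d2; mvf_abel.
rewrite [X in X - _ + _ + _]exchange_big subrr add0r [X in X - _ + _]exchange_big subrr add0r.
by rewrite [X in X - _]exchange_big subrr.
Qed.

Lemma schouten0l P : schouten 0 P = 0.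
Proof. by have := schoutenZl 0 0 P; rewrite !scale0r. Qed.

Lemma schoutenBr P Q Q' : schouten P (Q - Q') = schouten P Q - schouten P Q'.
Proof. exact: raddfB. Qed.

Lemma schoutenNr P Q : schouten P (- Q) = - schouten P Q.
Proof. exact: raddfN. Qed.

Lemma schoutenNl P Q : schouten (- P) Q = - schouten P Q.
Proof. by rewrite -scaleN1r schoutenZl scaleN1r. Qed.

Lemma schouten11C X Y : homogeneous 1 X -> homogeneous 1 Y -> schouten X Y = - schouten Y X.
Proof.
move=> hX hY; rewrite !schouten1E // -sumrN; apply: eq_bigr => i _.
rewrite !lcontr_homogeneous1 // -(wedge_funC _ (mvf_dx i X)) -(wedge_funC _ (mvf_dx i Y)).
by rewrite opprB.
Qed.

Lemma mvf_eq_opp P : P = - P -> P = 0.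
Proof.
move=> E; have : 2%:R *: P = 0 by rewrite scaler_nat mulr2n {1}E addNr.
move=> /(congr1 (fun Q => 2%:R^-1 *: Q)); rewrite scalerA mulVf ?scale1r ?scaler0 // pnatr_eq0.
Qed.

Lemma wedge11C X Y : homogeneous 1 X -> homogeneous 1 Y -> wedge X Y = - wedge Y X.
Proof. by move=> hX hY; rewrite wedge_homogeneous1C // parity_homogeneous1 // wedgeNl. Qed.

Lemma wedge11 X : homogeneous 1 X -> wedge X X = 0.
Proof. by move=> hX; apply/mvf_eq_opp/wedge11C. Qed.

Lemma schouten11 X : homogeneous 1 X -> schouten X X = 0.
Proof. by move=> hX; apply/mvf_eq_opp/schouten11C. Qed.

End LieDerivative.

(* The product and the bracket are abstract here: unfolding [wedge] and [schouten]
   while looking for rewriting redexes is prohibitively slow. *)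
Section AbstractCommutingPair.
Context {R : realType} {n : nat}.
Local Notation mvf := (mvf R n).
Variables (w s : mvf -> mvf -> mvf) (par : mvf -> mvf) (X Y : mvf).
Hypotheses
  (wA : forall P Q S, w P (w Q S) = w (w P Q) S)
  (wDl : forall P Q S, w (P + Q) S = w P S + w Q S)
  (wDr : forall P Q S, w P (Q + S) = w P Q + w P S)
  (wNl : forall P Q, w (- P) Q = - w P Q)
  (wNr : forall P Q, w P (- Q) = - w P Q)
  (sDl : forall P Q S, s (P + Q) S = s P S + s Q S)
  (sDr : forall P Q S, s P (Q + S) = s P Q + s P S)
  (sNl : forall P Q, s (- P) Q = - s P Q)
  (sNr : forall P Q, s P (- Q) = - s P Q)
  (parK : forall P, par (par P) = P)
  (wXC : forall P, w X P = w (par P) X) (wYC : forall P, w Y P = w (par P) Y)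
  (parY : par Y = - Y)
  (sXw : forall P Q, s X (w P Q) = w (s X P) Q + w P (s X Q))
  (sYw : forall P Q, s Y (w P Q) = w (s Y P) Q + w P (s Y Q))
  (sXs : forall P Q, s X (s P Q) = s (s X P) Q + s P (s X Q))
  (sYs : forall P Q, s Y (s P Q) = s (s Y P) Q + s P (s Y Q))
  (sXpar : forall P, par (s X P) = s X (par P))
  (sYpar : forall P, par (s Y P) = s Y (par P))
  (swXl : forall P Q, s (w X P) Q = w X (s P Q) + w (par P) (s X Q))
  (swYl : forall P Q, s (w Y P) Q = w Y (s P Q) + w (par P) (s Y Q))
  (swXr : forall P Q, s P (w X Q) = - w (s X P) Q - w X (s (par P) Q))
  (swYr : forall P Q, s P (w Y Q) = - w (s Y P) Q - w Y (s (par P) Q))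
  (sXX : s X X = 0) (sYY : s Y Y = 0) (sXY : s X Y = 0) (sYX : s Y X = 0)
  (wXX : w X X = 0) (wYY : w Y Y = 0) (wYX : w Y X = - w X Y).

Ltac abel :=
  repeat match goal with
  | |- context [w ?P ?Q] => generalize (w P Q); intro
  | |- context [s ?P ?Q] => generalize (s P Q); intro
  end;
  apply/ffunP => ?; rewrite !ffunE; ring.

Local Notation d := (s (w X Y)).

Let w0l P : w 0 P = 0. Proof. by apply: (addrI (w 0 P)); rewrite -wDl !addr0. Qed.
Let w0r P : w P 0 = 0. Proof. by apply: (addrI (w P 0)); rewrite -wDr !addr0. Qed.
Let s0l P : s 0 P = 0. Proof. by apply: (addrI (s 0 P)); rewrite -sDl !addr0. Qed.

Let dE P : d P = w X (s Y P) - w Y (s X P).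
Proof.
by rewrite swXl parY wNl.
Qed.

Let sC P : s X (s Y P) = s Y (s X P).
Proof. by rewrite sXs sXY s0l add0r. Qed.

(** As [d = X L_Y - Y L_X], only the mixed terms of the square survive; they cancel because the Lie
    derivatives commute while [X] and [Y] anticommute. *)
Lemma abstract_dd P : d (d P) = 0.
Proof.
rewrite [d P]dE dE sDr sNr sDr sNr !sXw !sYw sXX sYY sXY sYX !w0l !add0r.
rewrite !(wDr, wNr) !wA wXX wYY !w0l sC wYX wNl.
by abel.
Qed.

Lemma abstract_dw P Q : d (w P Q) = w (d P) Q + w (par P) (d Q).
Proof.
rewrite !dE sXw sYw !(wDl, wDr, wNl, wNr) !wA wXC (wXC P) (wYC P).
by abel.
Qed.

Lemma abstract_ds P Q : d (s P Q) = s (d P) Q - s (par P) (d Q).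
Proof.
rewrite !dE sXs sYs sDl sNl sDr sNr swXl swYl swXr swYr !parK.
rewrite -sXpar -sYpar !wDr.
by abel.
Qed.

Lemma abstract_dpi : d (w X Y) = 0.
Proof. by rewrite dE sXw sYw sXX sYY sXY sYX !(w0l, w0r, addr0, subr0). Qed.

End AbstractCommutingPair.

Section CommutingPair.
Context {R : realType} {n : nat}.
Local Notation mvf := (mvf R n).
Variables (X Y : mvf) (hX : homogeneous 1 X) (hY : homogeneous 1 Y).
Hypothesis XY0 : schouten X Y = 0.

Let YX0 : schouten Y X = 0. Proof. by rewrite schouten11C // XY0 oppr0. Qed.

Let pY : parity Y = - Y. Proof. exact: parity_homogeneous1. Qed.
Let sXw P Q : schouten X (wedge P Q) = _ := schouten1_wedge P Q hX.
Let sYw P Q : schouten Y (wedge P Q) = _ := schouten1_wedge P Q hY.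
Let sXs P Q : schouten X (schouten P Q) = _ := schouten1_jacobi P Q hX.
Let sYs P Q : schouten Y (schouten P Q) = _ := schouten1_jacobi P Q hY.
Let swXl P Q : schouten (wedge X P) Q = _ := schouten_wedge1l P Q hX.
Let swYl P Q : schouten (wedge Y P) Q = _ := schouten_wedge1l P Q hY.
Let swXr P Q : schouten P (wedge X Q) = _ := schouten_wedge1r P Q hX.
Let swYr P Q : schouten P (wedge Y Q) = _ := schouten_wedge1r P Q hY.

Lemma schouten_pair_pair P : schouten (wedge X Y) (schouten (wedge X Y) P) = 0.
Proof.
exact (abstract_dd (@wedgeA R n) (@wedgeDl R n) (@wedgeDr R n) (@wedgeNl R n) (@wedgeNr R n)
  (@schoutenDl R n) (@schoutenDr R n) (@schoutenNr R n) pY sXw sYw sXs swXl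
  (schouten11 hX) (schouten11 hY) XY0 YX0 (wedge11 hX) (wedge11 hY) (wedge11C hY hX) P).
Qed.

Lemma schouten_pair_wedge P Q : schouten (wedge X Y) (wedge P Q) =
  wedge (schouten (wedge X Y) P) Q + wedge (parity P) (schouten (wedge X Y) Q).
Proof.
exact (abstract_dw (@wedgeA R n) (@wedgeDl R n) (@wedgeDr R n) (@wedgeNl R n) (@wedgeNr R n)
  (fun P => wedge_homogeneous1C P hX) (fun P => wedge_homogeneous1C P hY) pY sXw sYw swXl P Q).
Qed.

Lemma schouten_pair_schouten P Q : schouten (wedge X Y) (schouten P Q) =
  schouten (schouten (wedge X Y) P) Q - schouten (parity P) (schouten (wedge X Y) Q).
Proof.
exact (abstract_ds (@wedgeDr R n) (@wedgeNl R n) (@schoutenDl R n) (@schoutenDr R n)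
  (@schoutenNl R n) (@schoutenNr R n) (@parityK R n) pY sXs sYs
  (fun P => parity_schouten1 P hX) (fun P => parity_schouten1 P hY) swXl swYl swXr swYr P Q).
Qed.

Lemma schouten_pair_self : schouten (wedge X Y) (wedge X Y) = 0.
Proof.
exact (abstract_dpi (@wedgeDl R n) (@wedgeDr R n) (@wedgeNl R n) pY sXw sYw swXl
  (schouten11 hX) (schouten11 hY) XY0 YX0).
Qed.

End CommutingPair.

(** * Degrees, and independence of the operations from representatives *)

Section Degrees.
Context {R : realType} {n : nat}.
Local Notation mvf := (mvf R n).
Implicit Types (P Q : mvf) (K : {set 'I_n}) (a b : pred nat).

(** Degrees are predicates, so that a primitive of degree [k - 1] is described by [m.+1 == k], which
    nothing satisfies when [k = 0]. *)
Lemma wedge_degree a b P Q K :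
  (forall I : {set 'I_n}, ~~ a #|I| -> P I = 0) ->
  (forall I : {set 'I_n}, ~~ b #|I| -> Q I = 0) ->
  (forall x y, a x -> b y -> (x + y)%N != #|K|) -> wedge P Q K = 0.
Proof.
move=> aP bQ abK; rewrite wedgeE big1 // => I IK.
case: (boolP (a #|I|)) => [aI|/aP->]; last by rewrite mul0r mulr0.
case: (boolP (b #|K :\: I|)) => [bI|/bQ->]; last by rewrite mulr0 mulr0.
by have := abK _ _ aI bI; rewrite cardsDsub // eqxx.
Qed.

Lemma schouten_degree a b P Q K :
  (forall I : {set 'I_n}, ~~ a #|I| -> P I = 0) ->
  (forall I : {set 'I_n}, ~~ b #|I| -> Q I = 0) ->
  (forall x y, a x -> b y -> (x + y)%N != #|K|.+1) -> schouten P Q K = 0.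
Proof.
move=> aP bQ abK; rewrite schoutenE sum_ffunE big1 // => i _.
rewrite mvfDE mvfNE (@wedge_degree (fun m => a m.+1) b _ _ K).
- rewrite (@wedge_degree a (fun m => b m.+1) _ _ K) ?subr0 //.
  + by move=> I aI; rewrite ffunE aP // raddf0.
  + move=> I bI; rewrite ffunE; case: ifP => // iI.
    by rewrite bQ ?mulr0 // cardsU1 iI.
  + by move=> x y ax byy; have := abK _ _ ax byy; rewrite addnS eqSS.
- move=> I aI; rewrite ffunE; case: ifP => // iI.
  by rewrite aP ?mulr0 // cardsU1 iI.
- by move=> I bI; rewrite ffunE bQ // raddf0.
- by move=> x y ax byy; have := abK _ _ ax byy; rewrite addSn eqSS.
Qed.

End Degrees.

Section Operations.
Context {R : realType} {n : nat}.
Local Notation mvf := (mvf R n).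
Variable pi : mvf.
Local Notation d := (schouten pi).

Lemma cocycleP k P : reflect (homogeneous k P /\ d P = 0) (P \in cocycle_pred pi k).
Proof.
rewrite inE /=; apply: (iffP andP) => [[/asboolP hP /eqP dP]|[hP dP]] //.
by split; [exact/asboolP|exact/eqP].
Qed.

Definition primitive_degree k (Q : mvf) := forall I : {set 'I_n}, #|I|.+1 != k -> Q I = 0.

Lemma coh_class_eqP k P P' : P \in cocycle_pred pi k -> P' \in cocycle_pred pi k ->
  coh_class pi k P = coh_class pi k P' <-> exists2 Q, primitive_degree k Q & P - P' = d Q.
Proof.
move=> kP kP'; have vP (S : mvf) (kS : S \in cocycle_pred pi k) : val (insubd (0 : cocycle pi k) S) = S.
  by rewrite val_insubd kS.
rewrite /coh_class; split.
  move=> /eqP; rewrite -Quotient.idealrBE => /asboolP[Q hQ E]; exists Q => //.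
  by rewrite -E /= -[in LHS](vP _ kP) -[X in _ - X](vP _ kP').
move=> [Q hQ E]; apply/eqP; rewrite -Quotient.idealrBE; apply/asboolP; exists Q => //.
by rewrite -E -[in RHS](vP _ kP) -[X in _ = _ - X](vP _ kP').
Qed.

Lemma coh_reprP k (h : cohomology pi k) :
  coh_repr h \in cocycle_pred pi k /\ coh_class pi k (coh_repr h) = h.
Proof.
split; first exact: valP.
by rewrite /coh_class /coh_repr valKd reprK.
Qed.

Lemma coh_repr_class k P : P \in cocycle_pred pi k ->
  exists2 Q, primitive_degree k Q & coh_repr (coh_class pi k P) = P + d Q.
Proof.
move=> kP; have [kr E] := coh_reprP (coh_class pi k P).
have [Q hQ EQ] := (coh_class_eqP kr kP).1 E; exists Q => //.
by rewrite -EQ addrC subrK.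
Qed.

Hypotheses (dd : forall P, d (d P) = 0)
  (dw : forall P Q, d (wedge P Q) = wedge (d P) Q + wedge (parity P) (d Q))
  (ds : forall P Q, d (schouten P Q) = schouten (d P) Q - schouten (parity P) (d Q)).

Lemma d_parity k P : homogeneous k P -> d P = 0 -> d (parity P) = 0.
Proof. by move=> hP dP; rewrite (homogeneous_parity hP) linearZ /= dP scaler0. Qed.

Lemma wedge_cocycle p q P Q : P \in cocycle_pred pi p -> Q \in cocycle_pred pi q ->
  wedge P Q \in cocycle_pred pi (p + q).
Proof.
move=> /cocycleP[hP dP] /cocycleP[hQ dQ]; apply/cocycleP; split.
  move=> K Kpq; apply: (@wedge_degree R n (pred1 p) (pred1 q) _ _ K hP hQ) => x y /eqP-> /eqP->.
  by rewrite eq_sym.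
by rewrite dw dP dQ wedge0l wedge0r addr0.
Qed.

Lemma schouten_cocycle p q P Q : P \in cocycle_pred pi p -> Q \in cocycle_pred pi q ->
  schouten P Q \in cocycle_pred pi (p + q).-1.
Proof.
move=> /cocycleP[hP dP] /cocycleP[hQ dQ]; apply/cocycleP; split.
  move=> K Kpq; apply: (@schouten_degree R n (pred1 p) (pred1 q) _ _ K hP hQ) => x y /eqP-> /eqP->.
  by apply: contraNneq Kpq => ->.
rewrite ds dP dQ schouten0l [X in _ - X](_ : _ = 0) ?subr0 //.
exact: linear0.
Qed.

Lemma cup_coh_class p q P Q : P \in cocycle_pred pi p -> Q \in cocycle_pred pi q ->
  cup (coh_class pi p P) (coh_class pi q Q) = coh_class pi (p + q) (wedge P Q).
Proof.
move=> kP kQ; have [A hA EA] := coh_repr_class kP; have [B hB EB] := coh_repr_class kQ.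
have [kP' _] := coh_reprP (coh_class pi p P); have [kQ' _] := coh_reprP (coh_class pi q Q).
rewrite /cup; apply/coh_class_eqP; [exact: wedge_cocycle|exact: wedge_cocycle|].
have /cocycleP[hP dP] := kP; have /cocycleP[hQ' dQ'] := kQ'.
have dpP := d_parity hP dP.
(* With chosen representatives [P + d A] and [Q' = Q + d B], the products differ by
   [P /\ d B + d A /\ Q']. The [parity] on [P] offsets the one in the Leibniz rule. *)
exists (wedge (parity P) B + wedge A (coh_repr (coh_class pi q Q))).
  move=> K Kpq; rewrite mvfDE (@wedge_degree R n (pred1 p) (fun m => m.+1 == q)).
  - rewrite (@wedge_degree R n (fun m => m.+1 == p) (pred1 q)) ?addr0 //.
    by move=> x y /eqP Ex /eqP Ey; apply: contraNneq Kpq => <-; rewrite -Ex -Ey addSn.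
  - by move=> I /= Ip; rewrite ffunE hP ?mulr0.
  - exact: hB.
  - by move=> x y /eqP Ex /eqP Ey; apply: contraNneq Kpq => <-; rewrite -Ex -Ey addnS.
rewrite raddfD /= !dw dpP dQ' parityK wedge0l wedge0r add0r addr0 EA wedgeDl.
rewrite EB wedgeDr; mvf_abel.
Qed.

Lemma cbracket_coh_class p q P Q : P \in cocycle_pred pi p -> Q \in cocycle_pred pi q ->
  cbracket (coh_class pi p P) (coh_class pi q Q) = coh_class pi (p + q).-1 (schouten P Q).
Proof.
move=> kP kQ; have [A hA EA] := coh_repr_class kP; have [B hB EB] := coh_repr_class kQ.
have [kP' _] := coh_reprP (coh_class pi p P); have [kQ' _] := coh_reprP (coh_class pi q Q).
rewrite /cbracket; apply/coh_class_eqP; [exact: schouten_cocycle|exact: schouten_cocycle|].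
have /cocycleP[hP dP] := kP; have /cocycleP[hQ' dQ'] := kQ'.
have dpP := d_parity hP dP.
(* The same primitive as for the product, except that the Leibniz rule [ds] has a minus sign. *)
exists (schouten A (coh_repr (coh_class pi q Q)) - schouten (parity P) B).
  move=> K Kpq; rewrite mvfDE mvfNE (@schouten_degree R n (fun m => m.+1 == p) (pred1 q)) //.
  - rewrite (@schouten_degree R n (pred1 p) (fun m => m.+1 == q)) ?subr0 //.
    + by move=> I /= Ip; rewrite ffunE hP ?mulr0.
    + by move=> x y /eqP Ex /eqP Ey; apply: contraNneq Kpq => E; rewrite -Ex -Ey addnS /= E.
  - by move=> x y /eqP Ex /eqP Ey; apply: contraNneq Kpq => E; rewrite -Ex -Ey addSn /= E.
have s0r S : schouten S 0 = 0 by exact: linear0.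
rewrite schoutenBr !ds dpP dQ' parityK !s0r schouten0l subr0 sub0r opprK EA schoutenDl.
rewrite EB !schoutenDr.
move: (schouten P Q) (schouten P (d B)) (schouten (d A) Q) (schouten (d A) (d B)) => w1 w2 w3 w4.
by mvf_abel.
Qed.

End Operations.

(** * Components of multivector fields on R^3 *)

Section Subsets3.

(** Bit triples turn a multivector field on R^3 into eight functions, and identities between such
    fields into a finite case analysis. *)
Definition set3 (a b c : bool) : {set 'I_3} := [set i : 'I_3 | nth false [:: a; b; c] i].

Lemma in_set3 a b c i : (i \in set3 a b c) = nth false [:: a; b; c] i.
Proof. by rewrite inE. Qed.

Lemma set3P (I : {set 'I_3}) : I = set3 (ix \in I) (iy \in I) (iz \in I).
Proof.
by apply/finset.setP; apply: forall3; rewrite in_set3.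
Qed.

Lemma set3_inj a b c a' b' c' :
  (set3 a b c == set3 a' b' c') = [&& a == a', b == b' & c == c'].
Proof.
apply/eqP/and3P => [/finset.setP E|[/eqP-> /eqP-> /eqP->] //].
by have := E ix; have := E iy; have := E iz; rewrite !in_set3 /= => -> -> ->.
Qed.

Lemma set1_set3 : [/\ [set ix] = set3 true false false, [set iy] = set3 false true false &
  [set iz] = set3 false false true].
Proof. by split; apply/finset.setP; apply: forall3; rewrite in_set3 !inE. Qed.

Lemma set0_set3 : set0 = set3 false false false.
Proof. by apply/finset.setP; apply: forall3; rewrite in_set3 !inE. Qed.

Lemma setD_set3 a b c a' b' c' :
  set3 a b c :\: set3 a' b' c' = set3 (a && ~~ a') (b && ~~ b') (c && ~~ c').
Proof.
by apply/finset.setP; apply: forall3; rewrite finset.in_setD !in_set3 /= andbC.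
Qed.

Lemma setU_set3 a b c a' b' c' :
  set3 a b c :|: set3 a' b' c' = set3 (a || a') (b || b') (c || c').
Proof. by apply/finset.setP; apply: forall3; rewrite finset.in_setU !in_set3. Qed.

Lemma big_set3 (V : nmodType) a b c (F : 'I_3 -> V) :
  \sum_(i in set3 a b c) F i = (if a then F ix else 0) + (if b then F iy else 0) + (if c then F iz else 0).
Proof. by rewrite big_mkcond sum3 !in_set3. Qed.

Lemma card_set3 a b c : #|set3 a b c| = (a + b + c)%N.
Proof.
rewrite -sum1_card; have := @big_set3 nat a b c (fun=> 1%N).
by case: a; case: b; case: c.
Qed.

Lemma inversions_set3 a b c a' b' c' :
  inversions (set3 a b c) (set3 a' b' c') = ((b && a') + (c && a') + (c && b'))%N.
Proof.
rewrite inversionsE (@big_set3 nat).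
rewrite !(@big_set3 nat a' b' c') /=.
by case: a; case: b; case: c; case: a'; case: b'; case: c'.
Qed.

Lemma sum_subset_set3 (V : nmodType) (F : {set 'I_3} -> V) a b c :
  let s (a : bool) (G : bool -> V) := if a then G true + G false else G false in
  \sum_(I : {set 'I_3} | I \subset set3 a b c) F I =
  s a (fun a => s b (fun b => s c (fun c => F (set3 a b c)))).
Proof.
pose h (t : bool * bool * bool) := set3 t.1.1 t.1.2 t.2.
pose g (I : {set 'I_3}) := ((ix \in I, iy \in I), iz \in I).
move=> s; rewrite (reindex_onto h g) /=; last by move=> I _; rewrite /h /g /= -set3P.
rewrite (eq_bigl (fun t => [&& t.1.1 ==> a, t.1.2 ==> b & t.2 ==> c])); last first.
  move=> [[a' b'] c']; rewrite /h /g !in_set3 /= eqxx andbT.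
  apply/fintype.subsetP/and3P => [H|[ha hb hc]].
    have := H ix; have := H iy; have := H iz; rewrite !in_set3 /=.
    by move=> h1 h2 h3; split; apply/implyP.
  by apply: forall3; rewrite !in_set3 /=; apply/implyP.
rewrite big_mkcond /=.
rewrite -(pair_bigA _ (fun (t : bool * bool) c' =>
  if [&& t.1 ==> a, t.2 ==> b & c' ==> c] then F (h (t, c')) else 0)) /=.
rewrite -(pair_bigA _ (fun a' b' => \sum_c'
  if [&& a' ==> a, b' ==> b & c' ==> c] then F (h ((a', b'), c')) else 0)) /=.
rewrite !big_bool /h /s /=.
by case: a; case: b; case: c => /=; rewrite ?addr0 ?add0r ?addrA.
Qed.

End Subsets3.

Section CoordinateFields.
Context {R : realType} {n : nat}.
Implicit Types (P : mvf R n) (i : 'I_n).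

Lemma mvf_partial_homogeneous i : homogeneous 1 (@mvf_partial R n i).
Proof. by move=> I I1; rewrite ffunE; case: (I =P [set i]) I1 => // ->; rewrite cards1. Qed.

Lemma mvf_dx_partial i j : mvf_dx j (@mvf_partial R n i) = 0.
Proof.
by apply/ffunP => I; rewrite !ffunE; case: ifP => _; rewrite ?partial1 ?raddf0.
Qed.

Lemma wedge_fun1 P : wedge (mvf_fun 1) P = P.
Proof. by apply/ffunP => I; rewrite wedge_funl mul1r. Qed.

Lemma schouten_mvf_partial i P : schouten (mvf_partial i) P = mvf_dx i P.
Proof.
rewrite schouten1E; last exact: mvf_partial_homogeneous.
rewrite (bigD1 i) //= big1 ?addr0.
  by rewrite ffunE eqxx mvf_dx_partial wedge0l subr0 wedge_fun1.
move=> j ji; rewrite mvf_dx_partial wedge0l subr0 ffunE.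
rewrite ifN; last by apply: contraNneq ji => /finset.set1_inj ->.
by apply/ffunP => I; rewrite wedge_funl mul0r mvf0E.
Qed.

End CoordinateFields.

Section Components3.
Context {R : realType}.
Local Notation C := (smoothfun R 3).
Local Notation mvf := (mvf R 3).
Implicit Types (P Q : mvf) (a b c : bool).

Lemma mvf3_ext P Q : (forall a b c, P (set3 a b c) = Q (set3 a b c)) -> P = Q.
Proof. by move=> PQ; apply/ffunP => I; rewrite (set3P I). Qed.

Lemma wedge_set3 P Q a b c :
  let s (a : bool) (G : bool -> C) := if a then G true + G false else G false in
  wedge P Q (set3 a b c) = s a (fun a' => s b (fun b' => s c (fun c' =>
    (-1) ^+ ((b' && (a && ~~ a')) + (c' && (a && ~~ a')) + (c' && (b && ~~ b')))%N *
    (P (set3 a' b' c') * Q (set3 (a && ~~ a') (b && ~~ b') (c && ~~ c')))))).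
Proof.
move=> s; rewrite wedgeE sum_subset_set3 /s.
by case: a; case: b; case: c; rewrite /= ?setD_set3 ?inversions_set3.
Qed.

Lemma homogeneous3P k P :
  homogeneous k P <-> forall a b c, (a + b + c)%N != k -> P (set3 a b c) = 0.
Proof.
split=> H; first by move=> a b c abc; apply: H; rewrite card_set3.
by move=> I; rewrite (set3P I) card_set3; exact: H.
Qed.

Lemma dx_set3 (i : 'I_3) a b c : @mvf_partial R 3 i (set3 a b c) =
  [&& a == (i == ix), b == (i == iy) & c == (i == iz)]%:R.
Proof.
rewrite ffunE; have -> : [set i] = set3 (i == ix) (i == iy) (i == iz).
  by rewrite [LHS]set3P !inE ![_ == i]eq_sym.
by rewrite set3_inj; case: ifP.
Qed.

Lemma wedge1_set3 X P a b c : homogeneous 1 X -> wedge X P (set3 a b c) =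
  (if a then X (set3 true false false) * P (set3 false b c) else 0) +
  (if b then (-1) ^+ a * (X (set3 false true false) * P (set3 a false c)) else 0) +
  (if c then (-1) ^+ (a + b)%N * (X (set3 false false true) * P (set3 a b false)) else 0).
Proof.
move=> /homogeneous3P hX.
have h0 : X (set3 false false false) = 0 by exact: hX.
have h1 : X (set3 true true false) = 0 by exact: hX.
have h2 : X (set3 true false true) = 0 by exact: hX.
have h3 : X (set3 false true true) = 0 by exact: hX.
have h4 : X (set3 true true true) = 0 by exact: hX.
by rewrite wedge_set3; case: a; case: b; case: c; rewrite /= ?h0 ?h1 ?h2 ?h3 ?h4; ring.
Qed.

Variables (al be : R).

(** One family contains both V, for [(tau, 1)], and E, for [(1, 0)], so Lie derivatives along them
    are computed once. *)
Definition planar_field : mvf := al *: euler + be *: rotation.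

Let p : C := al *: coord ix - be *: coord iy.
Let q : C := be *: coord ix + al *: coord iy.

Lemma euler_set3 a b c : (euler : mvf) (set3 a b c) =
  if c then 0 else if a then (if b then 0 else coord ix) else if b then coord iy else 0.
Proof.
rewrite /euler mvfDE !wedge_funl !dx_set3.
by case: a; case: b; case: c; rewrite /= ?mulr0 ?mulr1 ?addr0 ?add0r.
Qed.

Lemma rotation_set3 a b c : (rotation : mvf) (set3 a b c) =
  if c then 0 else if a then (if b then 0 else - coord iy) else if b then coord ix else 0.
Proof.
rewrite /rotation mvfDE mvfNE !wedge_funl !dx_set3.
by case: a; case: b; case: c; rewrite /= ?mulr0 ?mulr1 ?oppr0 ?addr0 ?add0r.
Qed.

Lemma planar_field_set3 a b c : planar_field (set3 a b c) =
  if c then 0 else if a then (if b then 0 else p) else if b then q else 0.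
Proof.
rewrite /planar_field mvfDE !mvfZE euler_set3 rotation_set3 /p /q.
by case: a; case: b; case: c; rewrite /= ?scaler0 ?addr0 ?scalerN // addrC.
Qed.

Lemma planar_field_homogeneous : homogeneous 1 planar_field.
Proof. by apply/homogeneous3P => a b c; rewrite planar_field_set3; case: a; case: b; case: c. Qed.

Lemma wedge_planar_set3 P a b c : wedge planar_field P (set3 a b c) =
  (if a then p * P (set3 false b c) else 0) +
  (if b then (-1) ^+ a * (q * P (set3 a false c)) else 0).
Proof.
rewrite wedge_set3; case: a; case: b; case: c; rewrite /= !planar_field_set3 /=;
  rewrite !(mul0r, mulr0, add0r, addr0, expr0, mul1r) //.
Qed.

Lemma wedge_dz_set3 P a b c : wedge dz P (set3 a b c) =
  if c then (-1) ^+ (a + b)%N * P (set3 a b false) else 0.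
Proof.
rewrite wedge_set3; case: a; case: b; case: c; rewrite /= !dx_set3 /=;
  rewrite !(mul0r, mulr0, add0r, addr0, expr0, mul1r) //.
Qed.

Lemma lcontr_set3 P a b c :
  [/\ lcontr ix P (set3 a b c) = if a then 0 else P (set3 true b c),
      lcontr iy P (set3 a b c) = if b then 0 else (-1) ^+ a * P (set3 a true c) &
      lcontr iz P (set3 a b c) = if c then 0 else (-1) ^+ (a + b)%N * P (set3 a b true)].
Proof.
have [e1 e2 e3] := set1_set3.
by split; rewrite ffunE in_set3 /= ?e1 ?e2 ?e3 inversions_set3 setU_set3 /=;
  case: a; case: b; case: c; rewrite //= ?addn0 ?expr0 ?mul1r.
Qed.

Definition planar_der (f : C) : C := p * partial ix f + q * partial iy f.

Let partial_lin2 (i j k : 'I_3) (a b : R) : partial i (a *: coord j + b *: coord k) =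
  sconst (a * (j == i)%:R + b * (k == i)%:R) :> C.
Proof.
rewrite linearD !linearZ /= !partial_coord; apply: sfunP => v.
by rewrite sconstE !sfunE; case: (j == i); case: (k == i).
Qed.

Let pN : p = al *: coord ix + (- be) *: coord iy. Proof. by rewrite /p scaleNr. Qed.

Let sconstN (a : R) : sconst (- a) = - sconst a :> C. Proof. exact: scaleNr. Qed.

Let pq_partial : [/\ partial ix p = sconst al, partial iy p = - sconst be,
  partial ix q = sconst be & partial iy q = sconst al].
Proof.
by split; rewrite ?pN /q partial_lin2 /= ?mulr1 ?mulr0 ?addr0 ?add0r ?sconstN.
Qed.

Let pq_partial_z : partial iz p = 0 /\ partial iz q = 0.
Proof.
by split; rewrite ?pN /q partial_lin2 /= !mulr0 addr0 /sconst scale0r.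
Qed.

(** Each of d/dx and d/dy contributes a weight [- al] from the dilation; the rotation mixes them
    with coefficient [be] and leaves their product unchanged. *)
Lemma lie_planar_set3 P a b c : schouten planar_field P (set3 a b c) =
  planar_der (P (set3 a b c)) - sconst al * (a + b)%:R * P (set3 a b c)
  - (if b && ~~ a then sconst be * P (set3 true false c) else 0)
  + (if a && ~~ b then sconst be * P (set3 false true c) else 0).
Proof.
move: planar_field planar_field_set3 planar_field_homogeneous => X XE hX.
have dXE i a' b' c' : mvf_dx i X (set3 a' b' c') = partial i (X (set3 a' b' c')) by rewrite ffunE.
have dPE i : mvf_dx i P (set3 a b c) = partial i (P (set3 a b c)) by rewrite ffunE.
have [p1 p2 p3 p4] := pq_partial; have [p5 p6] := pq_partial_z.
have hdX i := homogeneous_dx i hX.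
rewrite schouten1E // sum_ffunE sum3 !mvfDE !mvfNE !wedge_funl.
have [-> -> ->] := set1_set3; rewrite !XE !dPE /= mul0r sub0r /planar_der.
rewrite !(wedge1_set3 _ _ _ _ (hdX _)) !dXE !XE /= p1 p2 p3 p4 p5 p6 !raddf0 !mul0r !mulr0 !if_same.
have Lx a' b' c' : lcontr ix P (set3 a' b' c') = if a' then 0 else P (set3 true b' c').
  by case: (lcontr_set3 P a' b' c').
have Ly a' b' c' :
    lcontr iy P (set3 a' b' c') = if b' then 0 else (-1) ^+ a' * P (set3 a' true c').
  by case: (lcontr_set3 P a' b' c').
by case: a {dPE}; case: b; case: c; rewrite /= ?Lx ?Ly /=; ring.
Qed.

Lemma d_planar_set3 P a b c : schouten (wedge planar_field dz) P (set3 a b c) =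
  (if a then p * partial iz (P (set3 false b c)) else 0) +
  (if b then (-1) ^+ a * (q * partial iz (P (set3 a false c))) else 0) -
  (if c then (-1) ^+ (a + b)%N * schouten planar_field P (set3 a b false) else 0).
Proof.
rewrite schouten_wedge1l; last exact: planar_field_homogeneous.
rewrite schouten_mvf_partial parity_homogeneous1; last exact: mvf_partial_homogeneous.
rewrite wedgeNl mvfDE mvfNE wedge_planar_set3 wedge_dz_set3.
by rewrite ![mvf_dx _ _ _]ffunE.
Qed.

Lemma schouten_planar_dz : schouten planar_field dz = 0.
Proof.
rewrite schouten11C; [|exact: planar_field_homogeneous|exact: mvf_partial_homogeneous].
rewrite schouten_mvf_partial; apply/eqP; rewrite oppr_eq0; apply/eqP.
have [p5 p6] := pq_partial_z.
apply: mvf3_ext => a b c; rewrite mvf0E ffunE planar_field_set3.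
by case: a; case: b; case: c; rewrite ?p5 ?p6 ?raddf0.
Qed.

End Components3.

(** * Transport equations in the plane *)

Section Pullback.
Context {R : realType} {n : nat}.
Local Notation C := (smoothfun R n).
Implicit Types (f g : C) (v : 'rV[R]_n) (i j : 'I_n) (L : 'M[R]_n).

Lemma constant_mx_curve_continuous L : continuous_mx_curve (fun _ : R => L).
Proof. by move=> i j; exact: cst_continuous. Qed.

Definition pull L f : C := savg cst1_continuous (@constant_mx_curve_continuous L) f.

Lemma pullE L f v : pull L f v = f (v *m L).
Proof. by rewrite -[RHS]integral01_cst; apply: eq_integral01 => s _; rewrite mul1r. Qed.

Lemma partial_pull L i f : partial i (pull L f) = \sum_j L i j *: pull L (partial j f).
Proof.
have cc' j : continuous (fun s : R => 1 * (fun _ : R => L) s i j) by exact: cst_continuous.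
rewrite (partial_savg _ _ _ cc'); apply: eq_bigr => j _; apply: sfunP => v.
rewrite sfunZE pullE -[RHS]integral01_cst; apply: eq_integral01 => s _.
by rewrite mul1r.
Qed.

Lemma partial_pull_dilation (S : {set 'I_n}) i f : i \in S ->
  partial i (pull (dilation S 0) f) = 0.
Proof.
move=> iS; rewrite partial_pull big1 // => j _.
by rewrite !mxE iS mul0rn scale0r.
Qed.

Lemma pull_dilation_id (S : {set 'I_n}) f :
  (forall i, i \in S -> partial i f = 0) -> pull (dilation S 0) f = f.
Proof.
move=> df; apply: sfunP => v; rewrite pullE [RHS](hadamard S).
rewrite big1 ?addr0 // => i iS; rewrite df // /mean_on linear0.
exact: mulr0.
Qed.

(** Where the coordinate vanishes, differentiating the hypothesis in direction [i] leaves [f]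
    itself. *)
Lemma coord_mul_eq0 i f : coord i * f = 0 -> f = 0.
Proof.
move=> xf0; apply: sfunP => v; have [vi0|vi0] := eqVneq (v 0 i) 0.
  have := congr1 (fun g : C => partial i g v) xf0.
  rewrite partialM partial_coord eqxx raddf0 mul1r sfunDE sfunME coordE vi0 mul0r addr0.
  exact.
have /eqP := congr1 (fun g : C => g v) xf0.
by rewrite sfunME coordE sfun0E mulf_eq0 (negPf vi0) => /eqP.
Qed.

Lemma sfun_natE (m : nat) v : (m%:R : C) v = m%:R.
Proof. by elim: m => [//|m IH]; rewrite !mulrS sfunDE IH. Qed.

Lemma mul0mx_dilationT v : v *m dilation finset.setT 0 = 0 :> 'rV[R]_n.
Proof. by apply/rowP => j; rewrite mul_dilationE inE mulr0 mxE. Qed.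

Lemma partial_eq0_const f : (forall i, partial i f = 0) -> forall v, f v = f 0.
Proof.
move=> df v; rewrite -[in LHS](@pull_dilation_id finset.setT f) ?pullE ?mul0mx_dilationT //.
Qed.

End Pullback.

Section PlanarPDE.
Context {R : realType}.
Local Notation C := (smoothfun R 3).
Variables (tau : R) (tau_gt0 : 0 < tau).
Implicit Types (f g h : C) (v : 'rV[R]_3).

Let D : C -> C := linder (spiral_field tau).
Let p : C := tau *: coord ix - coord iy.
Let q : C := coord ix + tau *: coord iy.
Local Notation rz := (dilation [set iz] 0 : 'M[R]_3).

(** The determinant of the passage from [(x, y)] to the coefficients [(p, q)] of V, so that [p] and
    [q] can replace [x] and [y] in division arguments. *)
Let delta0 : tau ^+ 2 + 1 != 0.
Proof. by rewrite gt_eqF // ltr_pwDr // sqr_ge0. Qed.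

Let DE f : D f = p * partial ix f + q * partial iy f.
Proof. exact: linder_spiralE. Qed.

Let DD f g : D (f + g) = D f + D g. Proof. exact: linearD. Qed.
Let DN f : D (- f) = - D f. Proof. exact: linearN. Qed.
Let DM f g : D (f * g) = D f * g + f * D g. Proof. exact: linderM. Qed.
Lemma coord_eq0 f : p * f = 0 -> q * f = 0 -> f = 0.
Proof.
move=> pf qf; apply: (@coord_mul_eq0 _ _ ix); apply: sfunP => v.
have := congr1 (fun g : C => g v) pf; have := congr1 (fun g : C => g v) qf.
rewrite /p /q !sfunE => E1 E2; apply/eqP.
have : (tau ^+ 2 + 1) * (v 0 ix * f v) = 0.
  transitivity ((v 0 ix + tau * v 0 iy) * f v + tau * ((tau * v 0 ix - v 0 iy) * f v)); first by ring.
  by rewrite E1 E2 mulr0 addr0.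
by move/eqP; rewrite mulf_eq0 (negPf delta0).
Qed.

Lemma axis_pq f : vanishes_on_axis f -> exists u w : C, f = p * u + q * w.
Proof.
move=> /hadamard_axis[a [b ->]]; pose c := (tau ^+ 2 + 1)^-1.
exists (c *: (tau *: a - b)), (c *: (a + tau *: b)).
by apply: sfunP => v; rewrite /p /q !sfunE /c; field.
Qed.

(** Exactness of the Koszul complex of [(p, q)]: a planar field parallel to V is a smooth multiple
    of V. The linear change to [w1'], [w2'] reduces it to the pair [(x, y)]. *)
Lemma division_pq w1 w2 : w1 * q = w2 * p -> exists u : C, w1 = p * u /\ w2 = q * u.
Proof.
move=> E; pose w1' := tau *: w1 + w2; pose w2' := tau *: w2 - w1.
have E' : coord iy * w1' = coord ix * w2'.
  apply: sfunP => v; have := congr1 (fun g : C => g v) E.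
  rewrite /w1' /w2' /p /q !sfunE => Ev; apply/eqP; rewrite -subr_eq0; apply/eqP.
  transitivity (w1 v * (v 0 ix + tau * v 0 iy) - w2 v * (tau * v 0 ix - v 0 iy)); first by ring.
  by rewrite Ev subrr.
(* On the plane [x = 0] the relation [E'] reads [y * w1' = 0]; then Hadamard's lemma divides [w1']
   by [x]. *)
have r0 : pull (dilation [set ix] 0) w1' = 0.
  apply: (@coord_mul_eq0 _ _ iy); apply: sfunP => v; rewrite sfunME coordE pullE.
  have := congr1 (fun g : C => g (v *m dilation [set ix] 0)) E'.
  by rewrite !sfunME !coordE !mul_dilationE !inE /= mulr1 mulr0 mul0r.
pose u := mean_on [set ix] (partial ix w1').
have Ew1' : w1' = coord ix * u.
  apply: sfunP => v; rewrite (hadamard [set ix] w1' v) big_set1 -pullE r0.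
  by rewrite sfun0E add0r.
have Ew2' : w2' = coord iy * u.
  apply/eqP; rewrite -subr_eq0; apply/eqP/(@coord_mul_eq0 _ _ ix).
  by rewrite mulrBr -E' Ew1'; ring.
exists ((tau ^+ 2 + 1)^-1 *: u); split; apply: sfunP => v.
  have := congr1 (fun g : C => g v) Ew1'; have := congr1 (fun g : C => g v) Ew2'.
  rewrite /w1' /w2' /p /q !sfunE => e2 e1.
  apply: (mulfI delta0); transitivity (tau * (tau * w1 v + w2 v) - (tau * w2 v - w1 v)); first by ring.
  by rewrite e1 e2; field.
have := congr1 (fun g : C => g v) Ew1'; have := congr1 (fun g : C => g v) Ew2'.
rewrite /w1' /w2' /p /q !sfunE => e2 e1.
apply: (mulfI delta0); transitivity (tau * (tau * w2 v - w1 v) + (tau * w1 v + w2 v)); first by ring.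
by rewrite e1 e2; field.
Qed.

Let Dsconst a : D (sconst a) = 0.
Proof. by rewrite DE !partial_sconst !mulr0 addr0. Qed.

Let Dx : D (coord ix) = p. Proof. by rewrite DE !partial_coord /= mulr1 mulr0 addr0. Qed.
Let Dy : D (coord iy) = q. Proof. by rewrite DE !partial_coord /= mulr1 mulr0 add0r. Qed.

Let pz_pq : partial iz p = 0 /\ partial iz q = 0.
Proof.
split; first by rewrite /p linearB linearZ /= !partial_coord /= scaler0 subr0.
by rewrite /q linearD linearZ /= !partial_coord /= scaler0 addr0.
Qed.

Let mul_rz v : [/\ (v *m rz) 0 ix = v 0 ix, (v *m rz) 0 iy = v 0 iy & (v *m rz) 0 iz = 0].
Proof. by rewrite !mul_dilationE !inE /= !mulr1 mulr0. Qed.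

Lemma partial_z_linder f : partial iz (D f) = D (partial iz f).
Proof.
have [pz qz] := pz_pq.
by rewrite !DE linearD /= !partialM pz qz !mul0r !add0r (partialC iz ix) (partialC iz iy).
Qed.

Lemma linder_pull_z f : D (pull rz f) = pull rz (D f).
Proof.
apply: linder_savg => _; apply/matrixP; apply: forall3; apply: forall3;
  by rewrite !mxE !sum3 !mxE !inE /=; ring.
Qed.

Lemma pull_z_id f : partial iz f = 0 -> pull rz f = f.
Proof. by move=> fz; apply: pull_dilation_id => i; rewrite inE => /eqP->. Qed.

Lemma partial_pull_z f : partial iz (pull rz f) = 0.
Proof. by apply: partial_pull_dilation; rewrite inE. Qed.

Lemma sub_origin_vanishes_on_axis f : partial iz f = 0 ->
  vanishes_on_axis (f - sconst (f 0)).
Proof.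
move=> fz v vx vy; rewrite sfunDE sfunNE sconstE -{1}(pull_z_id fz) pullE.
rewrite (_ : v *m rz = 0) ?subrr //; apply/rowP; have [e1 e2 e3] := mul_rz v.
by apply: forall3; rewrite ?e1 ?e2 ?e3 mxE.
Qed.

Lemma transport_solution f : vanishes_on_axis f -> exists g, D g = f.
Proof.
have z0 : vanishes_on_axis (0 : C) by [].
move=> f0; have [g [g' [E _]]] := spiral_transport tau_gt0 0 f0 z0.
by exists g; rewrite -E scale0r subr0.
Qed.

Lemma transport_solution_z f : vanishes_on_axis f -> partial iz f = 0 ->
  exists2 g, D g = f & partial iz g = 0.
Proof.
move=> f0 fz; have [g Dg] := transport_solution f0; exists (pull rz g); last exact: partial_pull_z.
by rewrite linder_pull_z Dg pull_z_id.
Qed.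

(* [(lie_x a b, lie_y a b)] is the Lie derivative of [a d/dx + b d/dy] along
   the spiral field, for [a] and [b] functions on R^3. *)
Definition lie_x (a b : C) : C := D a - tau *: a + b.
Definition lie_y (a b : C) : C := D b - tau *: b - a.

(** Inverts the Lie derivative along V on planar fields up to its resonances, multiples of V and one
    multiple of E. Subtracting values at the origin makes functions of [(x, y)] vanish on the axis,
    where the transport equations are solvable. *)
Lemma planar_decomposition (b1 b2 : C) : partial iz b1 = 0 -> partial iz b2 = 0 ->
  exists (e : R) (k A1 A2 : C),
    [/\ partial iz k = 0, partial iz A1 = 0, partial iz A2 = 0,
        b1 = e *: coord ix + p * k + lie_x A1 A2 & b2 = e *: coord iy + q * k + lie_y A1 A2].
Proof.
move=> b1z b2z.
(* Independence of [z] comes for free: restriction to the plane [z = 0] commutes with [D] and fixes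
   [b1] and [b2]. *)
suff [e [k [A1 [A2 [E1 E2]]]]] : exists (e : R) (k A1 A2 : C),
    b1 = e *: coord ix + p * k + lie_x A1 A2 /\ b2 = e *: coord iy + q * k + lie_y A1 A2.
  exists e, (pull rz k), (pull rz A1), (pull rz A2); split; rewrite ?partial_pull_z //.
    rewrite -(pull_z_id b1z) E1 /lie_x linder_pull_z; apply: sfunP => v.
    by have [e1 e2 _] := mul_rz v; rewrite /p !(sfunE, pullE) e1 e2.
  rewrite -(pull_z_id b2z) E2 /lie_y linder_pull_z; apply: sfunP => v.
  by have [e1 e2 _] := mul_rz v; rewrite /q !(sfunE, pullE) e1 e2.
have had b : partial iz b = 0 -> exists m n : C, [/\ partial iz m = 0, partial iz n = 0 &
    b = sconst (b 0) + coord ix * m + coord iy * n].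
  move=> bz; have [m [n E]] := hadamard_axis (sub_origin_vanishes_on_axis bz).
  exists (pull rz m), (pull rz n); split; try exact: partial_pull_z.
  apply: sfunP => v; rewrite -{1}(pull_z_id bz) pullE.
  have := congr1 (fun g : C => g (v *m rz)) E; have [e1 e2 _] := mul_rz v.
  rewrite !(sconstE, pullE, sfunE) e1 e2 => Ev.
  by rewrite -addrA -Ev addrC subrK.
have [m11 [m12 [z11 z12 Eb1]]] := had _ b1z; have [m21 [m22 [z21 z22 Eb2]]] := had _ b2z.
(* Up to constants, [b1 d/dx + b2 d/dy = e1 E + e2 T + s1 S1 + s2 S2] where
   [S1 = x d/dx - y d/dy] and [S2 = y d/dx + x d/dy]. The flow rotates [(S1, S2)] with
   frequency 2, and modulo [tau E + T] one has [e1 E + e2 T = (e1 - tau e2) E]. *)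
pose e1 := 2^-1 *: (m11 + m22); pose e2 := 2^-1 *: (m21 - m12).
pose s1 := 2^-1 *: (m11 - m22); pose s2 := 2^-1 *: (m12 + m21).
have [e1z e2z s1z s2z] : [/\ partial iz e1 = 0, partial iz e2 = 0, partial iz s1 = 0 & partial iz s2 = 0].
  have zD m n : partial iz m = 0 -> partial iz n = 0 -> partial iz (2^-1 *: (m + n)) = 0.
    by move=> mz nz; rewrite linearZ linearD /= mz nz addr0 scaler0.
  have zN m : partial iz m = 0 -> partial iz (- m) = 0 by move=> mz; rewrite linearN /= mz oppr0.
  by split; apply: zD => //; exact: zN.
pose be := e1 - tau *: e2.
have bez : partial iz be = 0 by rewrite /be linearB /= e1z [partial iz (tau *: e2)]linearZ /= e2z scaler0 subr0.
have [f Df] := transport_solution (sub_origin_vanishes_on_axis bez).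
have [f1 [f2 [Df1 Df2]]] := spiral_transport tau_gt0 (- 2)
  (sub_origin_vanishes_on_axis s1z) (sub_origin_vanishes_on_axis s2z).
(* Values at the origin: on constant fields the Lie derivative is a matrix of determinant
   [tau ^+ 2 + 1], and the nonzero frequency 2 lets constants added to [f1] and [f2] absorb [s1 0]
   and [s2 0]. The value [be 0] has frequency 0 and remains as the coefficient of E. *)
pose c1 := b1 0; pose c2 := b2 0; pose dl := (tau ^+ 2 + 1)^-1.
pose psi1 := f1 + sconst (- (s2 0 / 2)); pose psi2 := f2 + sconst (s1 0 / 2).
exists (be 0), e2,
  (sconst (- (tau * c1 + c2) * dl) + (f * coord ix + (psi1 * coord ix + psi2 * coord iy))),
  (sconst ((c1 - tau * c2) * dl) + (f * coord iy + (psi2 * coord ix - psi1 * coord iy))).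
have {}Df v : D f v = be v - be 0 by rewrite Df !(sconstE, sfunE).
have {}Df1 v : D f1 v = s1 v - s1 0 - 2 * f2 v.
  have := congr1 (fun g : C => g v) Df1; rewrite -/D !(sconstE, sfunE) => <-; ring.
have {}Df2 v : D f2 v = s2 v - s2 0 + 2 * f1 v.
  have := congr1 (fun g : C => g v) Df2; rewrite -/D !(sconstE, sfunE) => <-; ring.
rewrite /lie_x /lie_y /psi1 /psi2 !(DD, DN, DM, Dsconst, Dx, Dy).
rewrite {1}Eb1 {1}Eb2 -/c1 -/c2.
split; apply: sfunP => v; rewrite /p /q !(sconstE, sfunE) Df ?Df1 ?Df2 /be /s1 /s2 /e1 /e2 /dl !sfunE;
  by field.
Qed.

Let px_pq : partial ix p = sconst tau /\ partial ix q = 1.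
Proof.
split; first by rewrite /p linearB linearZ /= !partial_coord /= subr0.
by rewrite /q linearD linearZ /= !partial_coord /= scaler0 addr0.
Qed.

Let py_pq : partial iy p = - 1 /\ partial iy q = sconst tau.
Proof.
split; first by rewrite /p linearB linearZ /= !partial_coord /= scaler0 sub0r.
by rewrite /q linearD linearZ /= !partial_coord /= add0r.
Qed.

Let partial_x_linder f :
  partial ix (D f) = sconst tau * partial ix f + partial iy f + D (partial ix f).
Proof.
have [px qx] := px_pq.
by rewrite !DE linearD /= !partialM px qx (partialC ix iy); ring.
Qed.

Let partial_y_linder f :
  partial iy (D f) = - partial ix f + sconst tau * partial iy f + D (partial iy f).
Proof.
have [py qy] := py_pq.
by rewrite !DE linearD /= !partialM py qy (partialC iy ix); ring.
Qed.

Let pD i f g : partial i (f + g) = partial i f + partial i g. Proof. exact: linearD. Qed.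
Let pN i f : partial i (- f) = - partial i f. Proof. exact: linearN. Qed.
Let pZ i a f : partial i (a *: f) = a *: partial i f. Proof. exact: linearZ. Qed.

(* Divergence and curl at the origin: both vanish on Lie derivatives along the
   spiral field, and they separate the Euler field from the spiral field. *)
Lemma lie_jet0 (e : R) (h a1 a2 : C) :
  e *: coord ix = p * h + lie_x a1 a2 -> e *: coord iy = q * h + lie_y a1 a2 ->
  e = 0 /\ h 0 = 0.
Proof.
move=> E1 E2; have [px qx] := px_pq; have [py qy] := py_pq.
have p0 : p 0 = 0 by rewrite /p !sfunE !mxE mulr0 subr0.
have q0 : q 0 = 0 by rewrite /q !sfunE !mxE mulr0 addr0.
have D0 f : D f 0 = 0 by rewrite DE sfunDE !sfunME p0 q0 !mul0r addr0.
have pLx i : partial i (lie_x a1 a2) = partial i (D a1) - tau *: partial i a1 + partial i a2.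
  by rewrite /lie_x !(pD, pN, pZ).
have pLy i : partial i (lie_y a1 a2) = partial i (D a2) - tau *: partial i a2 - partial i a1.
  by rewrite /lie_y !(pD, pN, pZ).
have pL i : [/\ partial i (e *: coord ix) = e *: ((ix == i)%:R : C),
    partial i (e *: coord iy) = e *: ((iy == i)%:R : C),
    partial i (p * h + lie_x a1 a2) = partial i p * h + p * partial i h + (partial i (D a1) - tau *: partial i a1 + partial i a2) &
    partial i (q * h + lie_y a1 a2) = partial i q * h + q * partial i h + (partial i (D a2) - tau *: partial i a2 - partial i a1)].
  by split; rewrite ?pZ ?partial_coord // [LHS]pD partialM ?pLx ?pLy.
have [F1 F2 F3 F4] := pL ix; have [G1 G2 G3 G4] := pL iy.
have ev (f g : C) : f = g -> f 0 = g 0 by move=> ->.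
have := ev _ _ (congr1 (partial ix) E1); have := ev _ _ (congr1 (partial iy) E1).
have := ev _ _ (congr1 (partial ix) E2); have := ev _ _ (congr1 (partial iy) E2).
rewrite F1 F2 F3 F4 G1 G2 G3 G4 !partial_x_linder !partial_y_linder px qx py qy.
rewrite !(sconstE, sfunE) !D0 ?p0 ?q0 !mxE /=.
move: (pderive ix a1 0) (pderive iy a1 0) (pderive ix a2 0) (pderive iy a2 0) (h 0).
move=> a b c d h0 H1 H2 H3 H4.
(* The difference of the two mixed equations, the curl, gives [2 * h0 = 0]; the sum of the other
   two, the divergence, gives [e = tau * h0]. *)
have h00 : h0 = 0 by lra.
by split => //; move: H1 H4; rewrite h00 !mulr0 => H1 H4; lra.
Qed.

(* If [a1 d/dx + a2 d/dy] is invariant under the spiral field, the squared norm of the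
   second derivatives [Q] of its coefficients satisfies [D Q = - 2 tau Q], so that [Q = 0]. *)
Lemma lie_eq0_linear (a1 a2 : C) : partial iz a1 = 0 -> partial iz a2 = 0 ->
  lie_x a1 a2 = 0 -> lie_y a1 a2 = 0 ->
  exists e b : R, a1 = e *: coord ix + b *: p /\ a2 = e *: coord iy + b *: q.
Proof.
move=> a1z a2z L1 L2.
have Da1 : D a1 = sconst tau * a1 - a2.
  by have := L1; rewrite /lie_x (scale_smoothfun tau) => /eqP; rewrite addr_eq0 subr_eq => /eqP ->; ring.
have Da2 : D a2 = sconst tau * a2 + a1.
  by have := L2; rewrite /lie_y (scale_smoothfun tau) => /eqP; rewrite subr_eq0 subr_eq => /eqP ->; ring.
set t := sconst tau in Da1 Da2.
have Dpx f : D (partial ix f) = partial ix (D f) - t * partial ix f - partial iy f.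
  by rewrite partial_x_linder -/t; ring.
have Dpy f : D (partial iy f) = partial iy (D f) + partial ix f - t * partial iy f.
  by rewrite partial_y_linder -/t; ring.
have pt i f : partial i (t * f) = t * partial i f.
  by rewrite partialM partial_sconst mul0r add0r.
(* The squared Frobenius norm of the planar Hessian; the factor 2 counts both mixed entries and
   makes it invariant under rotations. *)
pose sq (a : C) := partial ix (partial ix a) * partial ix (partial ix a)
  + 2 * (partial ix (partial iy a) * partial ix (partial iy a))
  + partial iy (partial iy a) * partial iy (partial iy a).
have Dsq (a : C) : D (sq a) =
    2 * (partial ix (partial ix a) * (partial ix (partial ix (D a))) +
    2 * (partial ix (partial iy a) * (partial ix (partial iy (D a)))) +
    partial iy (partial iy a) * (partial iy (partial iy (D a)))) - 4 * t * sq a.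
  have Dxx : D (partial ix (partial ix a)) = partial ix (partial ix (D a))
      - 2 * t * partial ix (partial ix a) - 2 * partial ix (partial iy a).
    rewrite Dpx Dpx pD pD pN pN pt (partialC iy ix); ring.
  have Dxy : D (partial ix (partial iy a)) = partial ix (partial iy (D a))
      + partial ix (partial ix a) - 2 * t * partial ix (partial iy a) - partial iy (partial iy a).
    rewrite Dpx Dpy pD pD pN pt; ring.
  have Dyy : D (partial iy (partial iy a)) = partial iy (partial iy (D a))
      + 2 * partial ix (partial iy a) - 2 * t * partial iy (partial iy a).
    rewrite Dpy Dpy pD pD pN pt (partialC iy ix); ring.
  have D2 f : D (2 * f) = 2 * D f by rewrite !mulr_natl /D raddfMn.
  rewrite /sq DD DD D2 !DM Dxx Dxy Dyy.
  move: (partial ix (partial ix a)) (partial ix (partial iy a)) (partial iy (partial iy a)) => X Y Z.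
  move: (partial ix (partial ix (D a))) (partial ix (partial iy (D a))) (partial iy (partial iy (D a))) => X' Y' Z'.
  by ring.
have Q0 : sq a1 + sq a2 = 0.
  (* A coefficient has weight [tau] and two derivatives lower it to [- tau]; squaring gives
     [- 2 * tau], the case [m = 4] of [spiral_homogeneous]. *)
  have DQ : D (sq a1 + sq a2) = - (4%:R * tau / 2) *: (sq a1 + sq a2).
    have -> : - (4%:R * tau / 2) *: (sq a1 + sq a2) = - 2 * t * (sq a1 + sq a2).
      apply: sfunP => v; rewrite sfunZE !sfunME /t sconstE.
      by rewrite sfunNE sfun_natE; field.
    rewrite DD !Dsq Da1 Da2 !(pD, pN, pt) /sq.
    move: (partial ix (partial ix a1)) (partial ix (partial iy a1)) (partial iy (partial iy a1)) => X Y Z.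
    move: (partial ix (partial ix a2)) (partial ix (partial iy a2)) (partial iy (partial iy a2)) => X' Y' Z'.
    by ring.
  apply: sfunP => v; rewrite (spiral_homogeneous tau_gt0 DQ) expr0n mul0r //.
have sq0 v : [/\ partial ix (partial ix a1) v = 0, partial ix (partial iy a1) v = 0,
    partial iy (partial iy a1) v = 0 & [/\ partial ix (partial ix a2) v = 0,
    partial ix (partial iy a2) v = 0 & partial iy (partial iy a2) v = 0]].
  have := congr1 (fun g : C => g v) Q0; rewrite /sq !(sfunDE, sfunME, sfun0E).
  move: (partial ix (partial ix a1) v) (partial ix (partial iy a1) v) (partial iy (partial iy a1) v).
  move: (partial ix (partial ix a2) v) (partial ix (partial iy a2) v) (partial iy (partial iy a2) v).
  rewrite ?sfun_natE => x y z x' y' z' E.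
  have E0 (c r : R) : c * c + r = 0 -> 0 <= r -> c = 0.
    by move=> cr r0; apply/eqP; rewrite -sqrf_eq0 expr2; have := sqr_ge0 c; rewrite expr2; lra.
  have s0 (c : R) : 0 <= c * c by rewrite -expr2 sqr_ge0.
  have [sx sy sz] := And3 (s0 x) (s0 y) (s0 z); have [sx' sy' sz'] := And3 (s0 x') (s0 y') (s0 z').
  pose T := x' * x' + 2 * (y' * y') + z' * z' + (x * x + 2 * (y * y) + z * z).
  have F (c : R) : 0 <= T - c * c -> c = 0.
    by move=> Tc; apply: (E0 c (T - c * c)) => //; rewrite addrC subrK; exact: E.
  by split; [| | |split]; apply: F; rewrite /T; lra.
have affine f : partial iz f = 0 -> (forall v, [/\ partial ix (partial ix f) v = 0,
    partial ix (partial iy f) v = 0 & partial iy (partial iy f) v = 0]) ->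
    [/\ partial ix f = sconst (partial ix f 0), partial iy f = sconst (partial iy f 0) &
     forall v, f v = f 0 + partial ix f 0 * v 0 ix + partial iy f 0 * v 0 iy].
  move=> fz fxy.
  have fxx : partial ix (partial ix f) = 0.
    by apply: sfunP => v; have [h _ _] := fxy v; rewrite h sfun0E.
  have fxy' : partial ix (partial iy f) = 0.
    by apply: sfunP => v; have [_ h _] := fxy v; rewrite h sfun0E.
  have fyy : partial iy (partial iy f) = 0.
    by apply: sfunP => v; have [_ _ h] := fxy v; rewrite h sfun0E.
  have Cx : partial ix f = sconst (partial ix f 0).
    apply: sfunP => v; rewrite sconstE; apply: partial_eq0_const.
    by apply: forall3; rewrite ?fxx ?(partialC iy ix) ?fxy' ?(partialC iz ix) ?fz ?raddf0.
  have Cy : partial iy f = sconst (partial iy f 0).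
    apply: sfunP => v; rewrite sconstE; apply: partial_eq0_const.
    by apply: forall3; rewrite ?fxy' ?fyy ?(partialC iz iy) ?fz ?raddf0.
  split => // v; pose g := f - (partial ix f 0 *: coord ix + partial iy f 0 *: coord iy).
  have g0 : g v = g 0.
    apply: partial_eq0_const; apply: forall3; rewrite /g pD pN pD !pZ !partial_coord /=.
    - by rewrite scaler0 addr0 -/(sconst _) -Cx subrr.
    - by rewrite scaler0 add0r -/(sconst _) -Cy subrr.
    - by rewrite !scaler0 addr0 fz subr0.
  move: g0; rewrite /g !(sfunDE, sfunNE, sfunZE, coordE) !mxE !mulr0 addr0 subr0 => <-; ring.
have [A1 B1 E1] := affine a1 a1z (fun v => let: And4 h1 h2 h3 _ := sq0 v in And3 h1 h2 h3).
have [A2 B2 E2] := affine a2 a2z (fun v => let: And4 _ _ _ h := sq0 v in h).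
have D1 := congr1 (fun g : C => g 0) Da1; have D2 := congr1 (fun g : C => g 0) Da2.
have Dx1 : partial iy a1 = - partial ix a2.
  have := congr1 (partial ix) Da1; rewrite partial_x_linder A1 Dsconst -A1 pD pN pt -/t addr0.
  by move=> /addrI.
have Dy1 : partial ix a1 = partial iy a2.
  have := congr1 (partial iy) Da1; rewrite partial_y_linder B1 Dsconst -B1 pD pN pt -/t addr0 addrC.
  by move=> /addrI /oppr_inj.
(* The constant terms solve a homogeneous linear system of determinant [tau ^+ 2 + 1]. *)
have z12 : a1 0 = 0 /\ a2 0 = 0.
  have D0 f : D f 0 = 0.
    by rewrite DE /p /q !sfunE !mxE !mulr0 subr0 addr0 !mul0r addr0.
  move: D1 D2; rewrite !D0 !(sfunDE, sfunME, sfunNE) /t !sconstE => D1 D2.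
  have a10 : a1 0 = 0.
    apply: (mulfI delta0); rewrite mulr0.
    transitivity (tau * (tau * a1 0 - a2 0) + (tau * a2 0 + a1 0)); first by ring.
    by rewrite -D1 -D2 mulr0 addr0.
  by split => //; move: D1; rewrite a10; lra.
have [a10 a20] := z12.
pose al := partial ix a1 0; pose be := partial iy a1 0.
(* The field is [(al x + be y, al y - be x)]; the coefficient of [y] in [p] is -1, which forces the
   second witness and then the first. *)
exists (al + tau * be), (- be); split; apply: sfunP => v; rewrite /p /q !sfunE.
  by rewrite E1 a10 -/al -/be; ring.
rewrite E2 a20 -Dy1 -[partial ix a2]opprK -Dx1 sfunNE -/al -/be; ring.
Qed.

End PlanarPDE.

(** * Cocycles and coboundaries *)

Section Cochains.
Context {R : realType}.
Local Notation C := (smoothfun R 3).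
Local Notation mvf := (mvf R 3).
Variables (tau : R) (tau_gt0 : 0 < tau).
Implicit Types (P Q : mvf) (f g h : C).

Local Notation d := (schouten (pi_tau tau)).
Let D : C -> C := linder (spiral_field tau).
Let p : C := tau *: coord ix - coord iy.
Let q : C := coord ix + tau *: coord iy.
Let lx : C -> C -> C := lie_x tau.
Let ly : C -> C -> C := lie_y tau.

Let DE f : D f = p * partial ix f + q * partial iy f.
Proof. exact: linder_spiralE. Qed.

Let pi_planar : pi_tau tau = wedge (planar_field tau 1) dz.
Proof. by rewrite /pi_tau /planar_field scale1r. Qed.

Let planar_derE f : planar_der tau 1 f = D f.
Proof. by rewrite /planar_der DE !scale1r. Qed.

Let sconst1 : sconst 1 = 1 :> C. Proof. exact: scale1r. Qed.

Lemma sfun_congr f g v : f = g -> f v = g v.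
Proof. by move=> ->. Qed.

(** The term [2 * tau] in top degree is the divergence of V; it is what makes the axis accessible in
    degrees 2 and 3. *)
Lemma d_set3 P :
  [/\ d P (set3 false false false) = 0,
      d P (set3 true false false) = p * partial iz (P (set3 false false false)),
      d P (set3 false true false) = q * partial iz (P (set3 false false false)) &
      d P (set3 false false true) = - D (P (set3 false false false))] /\
  [/\ d P (set3 true true false) =
        p * partial iz (P (set3 false true false)) - q * partial iz (P (set3 true false false)),
      d P (set3 true false true) = p * partial iz (P (set3 false false true)) +
        lx (P (set3 true false false)) (P (set3 false true false)),
      d P (set3 false true true) = q * partial iz (P (set3 false false true)) +
        ly (P (set3 true false false)) (P (set3 false true false)) &
      d P (set3 true true true) = p * partial iz (P (set3 false true true))
        - q * partial iz (P (set3 true false true)) - D (P (set3 true true false))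
        + 2 * tau *: P (set3 true true false)].
Proof.
rewrite pi_planar; split; split; rewrite d_planar_set3 ?lie_planar_set3 /= ?planar_derE
  ?scale1r -/p -/q ?sconst1 /lx /ly /lie_x /lie_y -/D ?(scale_smoothfun tau) ?(scale_smoothfun (2 * tau)); try ring.
rewrite (_ : sconst (2 * tau) = 2 * sconst tau); first by ring.
by apply: sfunP => v; rewrite sfunME !sconstE sfun_natE.
Qed.

Definition mvf3 (F : bool -> bool -> bool -> C) : mvf :=
  [ffun I : {set 'I_3} => F (ix \in I) (iy \in I) (iz \in I)].

Lemma mvf3E F a b c : mvf3 F (set3 a b c) = F a b c.
Proof. by rewrite ffunE !in_set3. Qed.

Definition span4 (a b c e : R) : mvf :=
  a *: mvf_fun 1 + b *: euler + c *: dz + e *: wedge euler dz.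

Lemma span4_set3 a b c e i j k : span4 a b c e (set3 i j k) =
  match i, j, k with
  | false, false, false => sconst a
  | true, false, false => b *: coord ix
  | false, true, false => b *: coord iy
  | false, false, true => sconst c
  | true, false, true => e *: coord ix
  | false, true, true => e *: coord iy
  | _, _, _ => 0
  end.
Proof.
rewrite /span4 !mvfDE !mvfZE euler_set3 dx_set3 wedge_set3 ffunE set0_set3 set3_inj.
case: i; case: j; case: k; rewrite /= ?euler_set3 ?dx_set3 /=;
  rewrite !(scaler0, mulr0, mul0r, addr0, add0r, mulr1, expr0, mul1r) //.
Qed.

Let z_pq : partial iz p = 0 /\ partial iz q = 0.
Proof.
split; first by rewrite /p linearB linearZ /= !partial_coord /= scaler0 subr0.
by rewrite /q linearD linearZ /= !partial_coord /= scaler0 addr0.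
Qed.

Lemma homogeneous_mvf3P k P : homogeneous k P -> forall a b c : bool, (a + b + c)%N != k ->
  P (set3 a b c) = 0.
Proof. by move=> /homogeneous3P. Qed.

Lemma primitive_degree3 k Q : (forall a b c : bool, (a + b + c).+1 != k -> Q (set3 a b c) = 0) ->
  primitive_degree k Q.
Proof. by move=> H I; rewrite (set3P I) card_set3; exact: H. Qed.

Lemma homogeneous3_ext k P Q : homogeneous k P -> homogeneous k Q ->
  (forall a b c : bool, (a + b + c)%N = k -> P (set3 a b c) = Q (set3 a b c)) -> P = Q.
Proof.
move=> /homogeneous_mvf3P hP /homogeneous_mvf3P hQ PQ; apply: mvf3_ext => a b c.
by have [/PQ //|abc] := eqVneq (a + b + c)%N k; rewrite hP ?hQ.
Qed.

Lemma homogeneous1_ext P Q : homogeneous 1 P -> homogeneous 1 Q ->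
  P (set3 true false false) = Q (set3 true false false) ->
  P (set3 false true false) = Q (set3 false true false) ->
  P (set3 false false true) = Q (set3 false false true) -> P = Q.
Proof. by move=> hP hQ e1 e2 e3; apply: (homogeneous3_ext hP hQ) => -[] [] []. Qed.

Lemma homogeneous2_ext P Q : homogeneous 2 P -> homogeneous 2 Q ->
  P (set3 true true false) = Q (set3 true true false) ->
  P (set3 true false true) = Q (set3 true false true) ->
  P (set3 false true true) = Q (set3 false true true) -> P = Q.
Proof. by move=> hP hQ e1 e2 e3; apply: (homogeneous3_ext hP hQ) => -[] [] []. Qed.

Lemma pi_tau_homogeneous : homogeneous 2 (pi_tau tau).
Proof.
rewrite pi_planar => K K2; apply: (@wedge_degree R 3 (pred1 1%N) (pred1 1%N)).
- exact: planar_field_homogeneous.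
- exact: mvf_partial_homogeneous.
- by move=> x y /eqP-> /eqP->; rewrite eq_sym.
Qed.

Lemma homogeneous_d k Q : primitive_degree k Q -> homogeneous k (d Q).
Proof.
move=> hQ K Kk; apply: (@schouten_degree R 3 (pred1 2%N) (fun m => m.+1 == k)).
- exact: pi_tau_homogeneous.
- exact: hQ.
- by move=> x y /eqP-> /eqP yk; apply: contraNneq Kk; rewrite -yk addSn => -[<-].
Qed.

(** Off its restriction [fa] to the axis, the coefficient is [p u + q w], matched by primitives in
    [z]. As [fa] depends on [z] alone, [D] kills it and the divergence term inverts it. *)
Lemma cocycle3_exact P : homogeneous 3 P -> exists2 Q, primitive_degree 3 Q & P = d Q.
Proof.
move=> hP; pose f := P (set3 true true true).
pose fa : C := pull (dilation [set ix; iy] 0) f.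
have f0 : vanishes_on_axis (f - fa).
  move=> v vx vy; rewrite sfunDE sfunNE pullE (_ : v *m _ = v) ?subrr //.
  apply/rowP; apply: forall3; rewrite mul_dilationE !inE /= ?mulr1 // ?vx ?vy mulr0 //.
have [u [w E]] := axis_pq tau f0.
have Dfa : D fa = 0.
  by rewrite DE !partial_pull_dilation ?inE ?eqxx ?orbT // !mulr0 addr0.
pose Q := mvf3 (fun a b c => match a, b, c with
  | true, true, false => (2 * tau)^-1 *: fa
  | true, false, true => - primitive iz w
  | false, true, true => primitive iz u
  | _, _, _ => 0 end).
have hQ : primitive_degree 3 Q by apply: primitive_degree3 => -[] [] []; rewrite mvf3E.
exists Q => //; apply: (homogeneous3_ext hP (homogeneous_d hQ)) => -[] [] [] // _.
have [_ [_ _ _ ->]] := d_set3 Q; rewrite !mvf3E raddfN /= !partial_primitive.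
have -> : D ((2 * tau)^-1 *: fa) = 0 by rewrite /D linearZ /= -/D Dfa scaler0.
rewrite subr0 mulrN opprK -E scalerA divff ?scale1r ?subrK //.
by rewrite mulf_neq0 // gt_eqF.
Qed.

Let dd P : d (d P) = 0.
Proof.
rewrite pi_planar; apply: schouten_pair_pair.
- exact: planar_field_homogeneous.
- exact: mvf_partial_homogeneous.
- exact: schouten_planar_dz.
Qed.

Let lxD a a' b b' : lx (a + a') (b + b') = lx a b + lx a' b'.
Proof. by rewrite /lx /lie_x linearD scalerDr /=; ring. Qed.

Let lyD a a' b b' : ly (a + a') (b + b') = ly a b + ly a' b'.
Proof. by rewrite /ly /lie_y linearD scalerDr /=; ring. Qed.

Lemma span4_homogeneous k a b c e : [/\ (0%N != k) -> a = 0, (1%N != k) -> b = 0,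
  (1%N != k) -> c = 0 & (2%N != k) -> e = 0] -> homogeneous k (span4 a b c e).
Proof.
move=> [Ha Hb Hc He]; apply/homogeneous3P => -[] [] [] /=; rewrite span4_set3 => kn //.
- by rewrite He // scale0r.
- by rewrite Hb // scale0r.
- by rewrite He // scale0r.
- by rewrite Hb // scale0r.
- by rewrite /sconst Hc // scale0r.
- by rewrite /sconst Ha // scale0r.
Qed.

Lemma mvfBE P Q K : (P - Q) K = P K - Q K.
Proof. by rewrite mvfDE mvfNE. Qed.

(** Once the xy-component is removed, the z-derivative of the rest is a multiple of V, which a
    primitive in [z] absorbs; [planar_decomposition] treats what no longer depends on [z]. *)
Lemma cocycle2_exact P : homogeneous 2 P -> d P = 0 ->
  exists e Q, primitive_degree 2 Q /\ P = span4 0 0 0 e + d Q.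
Proof.
move=> hP dP; have [pz qz] := z_pq.
have [_ [_ _ _ dP111]] := d_set3 P; rewrite dP mvf0E in dP111.
(* On the axis [p], [q] and the image of [D] vanish, so the cocycle equation reduces to [2 * tau]
   times this component being 0. *)
have g0 : vanishes_on_axis (P (set3 true true false)).
  move=> v vx vy; have := sfun_congr v dP111.
  have Dv f : D f v = 0 := @vanishes_on_axis_linder R tau f v vx vy.
  rewrite sfun0E !(sfunDE, sfunNE, sfunME, sfunZE) Dv.
  rewrite /p /q !(sfunDE, sfunNE, sfunZE, coordE) vx vy !(mulr0, subr0, addr0, mul0r, oppr0, add0r).
  by move=> /esym/eqP; rewrite !mulf_eq0 pnatr_eq0 (gt_eqF tau_gt0) /= => /eqP.
have [u [w Eg]] := axis_pq tau g0; rewrite -/p -/q in Eg.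
pose Q1 := mvf3 (fun a b c => match a, b, c with
  | true, false, false => - primitive iz w
  | false, true, false => primitive iz u
  | _, _, _ => 0 end).
have hQ1 : primitive_degree 2 Q1 by apply: primitive_degree3 => -[] [] []; rewrite mvf3E.
pose P1 := P - d Q1.
have P1_110 : P1 (set3 true true false) = 0.
  have [_ [E _ _ _]] := d_set3 Q1.
  by rewrite /P1 mvfBE E !mvf3E raddfN /= !partial_primitive mulrN opprK Eg subrr.
have dP1 : d P1 = 0 by rewrite /P1 schoutenBr dP dd subrr.
have hP1 : homogeneous 2 P1.
  by move=> I I2; rewrite /P1 mvfBE hP // (homogeneous_d hQ1) // subr0.
have EP : P = P1 + d Q1 by rewrite subrK.
clearbody P1 Q1.
have [_ [_ _ _ dP1_111]] := d_set3 P1.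
rewrite dP1 mvf0E P1_110 scaler0 addr0 /D raddf0 subr0 in dP1_111.
have [|u1 [Eu1 Eu2]] := @division_pq _ tau (partial iz (P1 (set3 true false true)))
  (partial iz (P1 (set3 false true true))).
  by rewrite -/p -/q mulrC [RHS]mulrC; apply/esym/eqP; rewrite -subr_eq0 -dP1_111.
rewrite -/p -/q in Eu1 Eu2.
pose b1 := P1 (set3 true false true) - p * primitive iz u1.
pose b2 := P1 (set3 false true true) - q * primitive iz u1.
have b1z : partial iz b1 = 0.
  by rewrite /b1 linearB /= partialM pz mul0r add0r partial_primitive Eu1 subrr.
have b2z : partial iz b2 = 0.
  by rewrite /b2 linearB /= partialM qz mul0r add0r partial_primitive Eu2 subrr.
have Eb1 : P1 (set3 true false true) = b1 + p * primitive iz u1 by rewrite subrK.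
have Eb2 : P1 (set3 false true true) = b2 + q * primitive iz u1 by rewrite subrK.
clearbody b1 b2.
have [e [k [A1 [A2 [kz A1z A2z E1 E2]]]]] := planar_decomposition tau_gt0 b1z b2z.
(* The differential of the d/dz component is its z-derivative times V wedge d/dz, so the multiples
   [primitive iz u1] and [k] of V are integrated once more in [z]. *)
pose Q2 := mvf3 (fun a b c => match a, b, c with
  | true, false, false => A1
  | false, true, false => A2
  | false, false, true => primitive iz (primitive iz u1) + primitive iz k
  | _, _, _ => 0 end).
have hQ2 : primitive_degree 2 Q2 by apply: primitive_degree3 => -[] [] []; rewrite mvf3E.
exists e, (Q1 + Q2); split; first by move=> I kI; rewrite mvfDE hQ1 // hQ2 // addr0.
rewrite schoutenDr EP addrCA addrC; congr (_ + _).
have hS : homogeneous 2 (span4 0 0 0 e) by apply: span4_homogeneous.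
apply: (homogeneous2_ext hP1).
  by move=> I I2; rewrite mvfDE hS // (homogeneous_d hQ2) // addr0.
- have [_ [e1 _ _ _]] := d_set3 Q2.
  by rewrite mvfDE span4_set3 e1 !mvf3E P1_110 A1z A2z !mulr0 subr0 addr0.
- have [_ [_ e2 _ _]] := d_set3 Q2.
  rewrite mvfDE span4_set3 e2 !mvf3E linearD /= !partial_primitive.
  rewrite Eb1 E1 -/p -/lx.
  by ring.
- have [_ [_ _ e3 _]] := d_set3 Q2.
  rewrite mvfDE span4_set3 e3 !mvf3E linearD /= !partial_primitive.
  rewrite Eb2 E2 -/q -/ly.
  by ring.
Qed.

Lemma span4_2_exact e Q : span4 0 0 0 e = d Q -> e = 0.
Proof.
move=> E; have [_ [_ e2 e3 _]] := d_set3 Q.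
rewrite -E span4_set3 in e2; rewrite -E span4_set3 in e3.
by have [] := lie_jet0 e2 e3.
Qed.

(** The differential of a function has planar part a multiple of V, whose 1-jet at the origin is not
    a nonzero multiple of E, and a d/dz component in the image of [D], which vanishes at the
    origin. *)
Lemma span4_1_exact b c Q : span4 0 b c 0 = d Q -> b = 0 /\ c = 0.
Proof.
move=> E; have [[_ e1 e2 e3] _] := d_set3 Q.
rewrite -E span4_set3 in e1; rewrite -E span4_set3 in e2; rewrite -E span4_set3 in e3.
have L0 : lie_x tau 0 0 = 0 :> C /\ lie_y tau 0 0 = 0 :> C.
  by rewrite /lie_x /lie_y linear0 !(scaler0, subr0, addr0).
have [||-> _] := @lie_jet0 _ tau b (partial iz (Q (set3 false false false))) 0 0.
- by rewrite L0.1 addr0.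
- by rewrite L0.2 addr0.
split=> //; have := sfun_congr 0 e3.
rewrite sconstE sfunNE (@vanishes_on_axis_linder R tau) ?mxE //.
by rewrite oppr0.
Qed.

(** A Casimir does not depend on [z] and is constant along the spirals, all of which converge to the
    axis. *)
Lemma cocycle0_const P : homogeneous 0 P -> d P = 0 -> exists a, P = span4 a 0 0 0.
Proof.
move=> hP dP; pose f := P (set3 false false false).
have [[_ e1 e2 e3] _] := d_set3 P; rewrite dP !mvf0E -/f in e1 e2 e3.
have fz : partial iz f = 0 by apply: (@coord_eq0 _ tau).
(* The case [m = 0] of [spiral_homogeneous], where [0 ^+ 0] is 1. *)
have Df : D f = - (0%:R * tau / 2) *: f.
  by rewrite !mul0r oppr0 scale0r; apply/eqP; rewrite -oppr_eq0 -e3.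
have fE v : f v = f 0.
  rewrite (spiral_homogeneous tau_gt0 Df) expr0 mul1r -(pull_z_id fz) pullE.
  rewrite pullE mul0mx; congr (f _); have [zx zy] := spiral_axis tau v.
  by apply/rowP; apply: forall3; rewrite mul_dilationE !inE /= ?zx ?zy ?mulr0 ?mul0r mxE.
exists (f 0); apply: (homogeneous3_ext (k := 0) hP); first exact: span4_homogeneous.
move=> [] [] [] // _; rewrite span4_set3 -/f; apply: sfunP => v.
by rewrite fE sconstE.
Qed.

(** If [D f1 = partial iz h], then adding [f1 V] to the planar part makes it invariant under V,
    hence a combination of E and V. The multiples of V and the function [h] are then matched by one
    potential [F]. *)
Lemma cocycle1_components (a1 a2 h : C) : partial iz a1 = 0 -> partial iz a2 = 0 ->
  0 = p * partial iz h + lx a1 a2 -> 0 = q * partial iz h + ly a1 a2 ->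
  exists (e c : R) (F : C), [/\ a1 = e *: coord ix + p * partial iz F,
    a2 = e *: coord iy + q * partial iz F & h = sconst c - D F].
Proof.
move=> a1z a2z e1 e2; have [pz qz] := z_pq.
have zD f : partial iz (D f) = D (partial iz f) by exact: partial_z_linder.
have D0 : D 0 = 0 by rewrite /D linear0.
(* Differentiating both equations in [z] leaves only [p] and [q] times this function. *)
have kz : partial iz (partial iz h) = 0.
  apply: (@coord_eq0 _ tau); rewrite -/p -/q.
    have := congr1 (partial iz) e1; rewrite linear0 linearD /= partialM pz mul0r add0r.
    rewrite /lx /lie_x -/D !(linearD, raddfN) /= linearZ /= zD a1z a2z D0.
    by rewrite scaler0 oppr0 !addr0 => <-.
  have := congr1 (partial iz) e2; rewrite linear0 linearD /= partialM qz mul0r add0r.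
  rewrite /ly /lie_y -/D !(linearD, raddfN) /= linearZ /= zD a1z a2z D0.
  by rewrite scaler0 !oppr0 !addr0 => <-.
(* The curl at the origin gives [partial iz h] the value 0 there, which is what makes the transport
   equation for it solvable. *)
have [||_ k0] := @lie_jet0 _ tau 0 (partial iz h) a1 a2.
- by rewrite scale0r.
- by rewrite scale0r.
have [|f1 Df1 f1z] := transport_solution_z tau_gt0 _ kz.
  by have := sub_origin_vanishes_on_axis kz; rewrite k0 /sconst scale0r subr0.
rewrite -/D in Df1.
have DpM f : D (p * f) = (tau *: p - q) * f + p * D f.
  rewrite !DE !partialM.
  have [px py] : partial ix p = sconst tau /\ partial iy p = - 1.
    split; rewrite /p linearB linearZ /= !partial_coord /=.
      by rewrite subr0.
    by rewrite scaler0 sub0r.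
  rewrite px py (scale_smoothfun tau); ring.
have DqM f : D (q * f) = (p + tau *: q) * f + q * D f.
  rewrite !DE !partialM.
  have [px py] : partial ix q = 1 /\ partial iy q = sconst tau.
    split; rewrite /q linearD linearZ /= !partial_coord /=.
      by rewrite scaler0 addr0.
    by rewrite add0r.
  rewrite px py (scale_smoothfun tau); ring.
have lx1 : lx (p * f1) (q * f1) = p * partial iz h.
  by rewrite /lx /lie_x -/D DpM Df1 !(scale_smoothfun tau); ring.
have ly1 : ly (p * f1) (q * f1) = q * partial iz h.
  by rewrite /ly /lie_y -/D DqM Df1 !(scale_smoothfun tau); ring.
have [||||e [b [E1 E2]]] := @lie_eq0_linear _ _ tau_gt0 (a1 + p * f1) (a2 + q * f1).
- by rewrite linearD /= a1z partialM pz f1z mul0r mulr0 !addr0.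
- by rewrite linearD /= a2z partialM qz f1z mul0r mulr0 !addr0.
- by rewrite -/lx lxD lx1 addrC -e1.
- by rewrite -/ly lyD ly1 addrC -e2.
rewrite -/p -/q in E1 E2.
(* Its z-derivative [b - f1] is the coefficient of V in the planar part. *)
pose F1 := b *: coord iz - primitive iz f1.
have F1z : partial iz F1 = sconst b - f1.
  by rewrite /F1 linearB linearZ /= partial_coord partial_primitive.
have Db : D (sconst b) = 0 by rewrite DE !partial_sconst !mulr0 addr0.
have h2z : partial iz (h + D F1) = 0.
  by rewrite linearD /= zD F1z {1}/D linearB /= -/D Db Df1 sub0r subrr.
(* The remainder [h + D F1] is independent of [z]; up to its value at the origin, the constant [c],
   it is transported away without disturbing the planar part. *)
have [phi Dphi phiz] := transport_solution_z tau_gt0 (sub_origin_vanishes_on_axis h2z)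
  ltac:(by rewrite linearB /= h2z partial_sconst subrr).
rewrite -/D in Dphi.
exists e, ((h + D F1) 0), (F1 - phi).
have Fz : partial iz (F1 - phi) = sconst b - f1 by rewrite linearB /= phiz subr0.
rewrite Fz; split.
- by rewrite mulrBr addrA [p * sconst b]mulrC -(scale_smoothfun b) -E1 addrK.
- by rewrite mulrBr addrA [q * sconst b]mulrC -(scale_smoothfun b) -E2 addrK.
- rewrite {2}/D linearB /= -/D Dphi; ring.
Qed.

(** The xy-component of the cocycle equation makes the z-derivative of the planar part parallel to
    V, say [u V]; the double primitive of [u] in [z] is a function whose differential removes it. *)
Lemma cocycle1_exact P : homogeneous 1 P -> d P = 0 ->
  exists b c Q, primitive_degree 1 Q /\ P = span4 0 b c 0 + d Q.
Proof.
move=> hP dP; have [pz qz] := z_pq.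
have [_ [dP110 _ _ _]] := d_set3 P; rewrite dP mvf0E in dP110.
have [|u [Eu1 Eu2]] := @division_pq _ tau (partial iz (P (set3 true false false)))
  (partial iz (P (set3 false true false))).
  by rewrite -/p -/q mulrC [RHS]mulrC; apply/esym/eqP; rewrite -subr_eq0 -dP110.
rewrite -/p -/q in Eu1 Eu2.
pose Q0 := mvf3 (fun a b c => match a, b, c with
  | false, false, false => primitive iz (primitive iz u)
  | _, _, _ => 0 end).
have hQ0 : primitive_degree 1 Q0 by apply: primitive_degree3 => -[] [] []; rewrite mvf3E.
pose P1 := P - d Q0.
have dP1 : d P1 = 0 by rewrite /P1 schoutenBr dP dd subrr.
have hP1 : homogeneous 1 P1.
  by move=> I I2; rewrite /P1 mvfBE hP // (homogeneous_d hQ0) // subr0.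
have EP : P = P1 + d Q0 by rewrite subrK.
have [[_ d100 d010 _] _] := d_set3 Q0; rewrite !mvf3E partial_primitive in d100 d010.
have a1z : partial iz (P1 (set3 true false false)) = 0.
  by rewrite /P1 mvfBE d100 linearB /= partialM pz mul0r add0r partial_primitive Eu1 subrr.
have a2z : partial iz (P1 (set3 false true false)) = 0.
  by rewrite /P1 mvfBE d010 linearB /= partialM qz mul0r add0r partial_primitive Eu2 subrr.
clearbody P1 Q0.
have [_ [_ e1 e2 _]] := d_set3 P1; rewrite dP1 !mvf0E in e1 e2.
have [e [c [F [E1 E2 E3]]]] := cocycle1_components a1z a2z e1 e2.
pose Q1 := mvf3 (fun a b c => match a, b, c with
  | false, false, false => F
  | _, _, _ => 0 end).
have hQ1 : primitive_degree 1 Q1 by apply: primitive_degree3 => -[] [] []; rewrite mvf3E.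
exists e, c, (Q0 + Q1); split; first by move=> I kI; rewrite mvfDE hQ0 // hQ1 // addr0.
rewrite schoutenDr EP addrCA addrC; congr (_ + _).
have hS : homogeneous 1 (span4 0 e c 0) by apply: span4_homogeneous.
have [[_ d1 d2 d3] _] := d_set3 Q1; rewrite !mvf3E in d1 d2 d3.
apply: (homogeneous1_ext hP1).
- by move=> I I1; rewrite mvfDE hS // (homogeneous_d hQ1) // addr0.
- by rewrite mvfDE span4_set3 d1.
- by rewrite mvfDE span4_set3 d2.
- by rewrite mvfDE span4_set3 d3.
Qed.

End Cochains.

(** * Linearity of classes, and the span of the representatives *)

Section CohomologyClasses.
Context {R : realType} {n : nat}.
Variables (pi : mvf R n) (k : nat).

Lemma coh_classP a P Q : P \in cocycle_pred pi k -> Q \in cocycle_pred pi k ->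
  coh_class pi k (a *: P + Q) = a *: coh_class pi k P + coh_class pi k Q.
Proof.
move=> kP kQ; pose Z : cocycle pi k := insubd 0 P; pose Y : cocycle pi k := insubd 0 Q.
have -> : coh_class pi k (a *: P + Q) = \pi_(cohomology pi k)%qT (a *: Z + Y).
  rewrite /coh_class; congr (\pi_(_)%qT _); apply: val_inj.
  rewrite val_insubd rpredD ?rpredZ //= -[in LHS](insubdK (0 : cocycle pi k) kP).
  by rewrite -[X in _ + X](insubdK (0 : cocycle pi k) kQ).
rewrite raddfD; congr (_ + _); exact/esym/pi_scale.
Qed.

Lemma coh_class0 : coh_class pi k 0 = 0.
Proof.
have k0 : 0 \in cocycle_pred pi k by exact: rpred0.
by have := coh_classP (-1) k0 k0; rewrite scaler0 addr0 scaleN1r addNr.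
Qed.

Lemma coh_classZ a P : P \in cocycle_pred pi k ->
  coh_class pi k (a *: P) = a *: coh_class pi k P.
Proof.
by move=> kP; have := coh_classP a kP (rpred0 _); rewrite coh_class0 !addr0.
Qed.

End CohomologyClasses.

Section Span.
Context {R : realType}.
Local Notation C := (smoothfun R 3).
Local Notation mvf := (mvf R 3).
Implicit Types (a b c e : R) (k : nat).

Let sconstD a b : sconst (a + b) = sconst a + sconst b :> C.
Proof. exact: scalerDl. Qed.

Let sconstN a : sconst (- a) = - sconst a :> C.
Proof. exact: scaleNr. Qed.

Let sconstM a b : sconst (a * b) = sconst a * sconst b :> C.
Proof. by apply: sfunP => v; rewrite sfunME !sconstE. Qed.

Lemma span4_wedge a b c e a' b' c' e' : wedge (span4 a b c e) (span4 a' b' c' e') =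
  span4 (a * a') (a * b' + b * a') (a * c' + c * a') (a * e' + e * a' + b * c' - c * b')
  :> mvf.
Proof.
have S (x y z t : R) (i j l : bool) := span4_set3 x y z t i j l.
apply: mvf3_ext => i j l; rewrite [RHS]S.
move: (span4 a b c e) (S a b c e) => P EP; move: (span4 a' b' c' e') (S a' b' c' e') => Q EQ.
rewrite wedge_set3 {S}; case: i; case: j; case: l;
  rewrite /= !EP !EQ ?scale_smoothfun ?(sconstD, sconstN, sconstM); ring.
Qed.

Lemma span4_coef a b c e a' b' c' e' : span4 a b c e = span4 a' b' c' e' :> mvf ->
  [/\ a = a', b = b', c = c' & e = e'].
Proof.
move=> E; have Eijk (i j k : bool) := congr1 (fun P : mvf => P (set3 i j k)) E.
have sc_inj r r' : sconst r = sconst r' :> C -> r = r'.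
  by move=> /(sfun_congr 0); rewrite !sconstE.
have sx_inj r r' : r *: coord ix = r' *: coord ix :> C -> r = r'.
  by move=> /(sfun_congr (delta_mx 0 ix)); rewrite !sfunZE !coordE mxE !eqxx !mulr1.
by have := (Eijk false false false, Eijk true false false, Eijk false false true,
  Eijk true false true); rewrite !span4_set3 => -[[[/sc_inj ? /sx_inj ?] /sc_inj ?] /sx_inj ?].
Qed.

Lemma span4B a b c e a' b' c' e' : span4 a b c e - span4 a' b' c' e' =
  span4 (a - a') (b - b') (c - c') (e - e') :> mvf.
Proof.
rewrite /span4 !scalerBl !opprD [X in _ = X + _ + _]addrACA [X in _ = X + _]addrACA.
by rewrite [RHS]addrACA.
Qed.

Lemma span4_0 : span4 0 0 0 0 = 0 :> mvf.
Proof. by rewrite /span4 !scale0r !addr0. Qed.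

Lemma span4_homogeneousP k a b c e : homogeneous k (span4 a b c e : mvf) <->
  [/\ (0%N != k) -> a = 0, (1%N != k) -> b = 0, (1%N != k) -> c = 0 & (2%N != k) -> e = 0].
Proof.
split; last exact: span4_homogeneous.
move=> /homogeneous3P H.
have sc0 r : sconst r = 0 :> C -> r = 0 by move=> /(sfun_congr 0); rewrite sconstE.
have sx0 r : r *: coord ix = 0 :> C -> r = 0.
  by move=> /(sfun_congr (delta_mx 0 ix)); rewrite sfunZE coordE mxE !eqxx mulr1.
split=> kn.
- by apply: sc0; have := H false false false kn; rewrite span4_set3.
- by apply: sx0; have := H true false false kn; rewrite span4_set3.
- by apply: sc0; have := H false false true kn; rewrite span4_set3.
- by apply: sx0; have := H true false true kn; rewrite span4_set3.
Qed.

Let partial_z_span (P : mvf) : representative P -> mvf_dx iz P = 0.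
Proof.
move=> [a [b [c [e ->]]]]; apply: mvf3_ext => i j k; rewrite ffunE -/(span4 a b c e) mvf0E span4_set3.
by case: i; case: j; case: k; rewrite ?raddf0 ?partial_sconst // linearZ /= partial_coord scaler0.
Qed.

Lemma schouten_fun1 (P : mvf) : schouten (mvf_fun 1 : mvf) P = 0.
Proof.
rewrite schoutenE big1 // => i _.
have -> : rcontr i (mvf_fun 1 : mvf) = 0 by rewrite rcontrE lcontr_fun raddf0.
have -> : mvf_dx i (mvf_fun 1 : mvf) = 0.
  by apply/ffunP => I; rewrite !ffunE; case: ifP => _; rewrite ?partial1 ?raddf0.
by rewrite !wedge0l subr0.
Qed.

Let euler_planar : euler = planar_field 1 0 :> mvf.
Proof. by rewrite /planar_field scale1r scale0r addr0. Qed.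

Let euler_homogeneous : homogeneous 1 (euler : mvf).
Proof. by rewrite euler_planar; exact: planar_field_homogeneous. Qed.

(** Each of 1, E, d/dz and the product of E and d/dz is invariant under dilations of the
    [(x, y)]-plane, the flow of E. *)
Lemma schouten_euler_span (P : mvf) : representative P -> schouten euler P = 0.
Proof.
move=> [a [b [c [e ->]]]]; rewrite -/(span4 a b c e) euler_planar.
have s1 : sconst 1 = 1 :> C by exact: scale1r.
have s0 : sconst 0 = 0 :> C by exact: scale0r.
have derE f : planar_der 1 0 f = coord ix * partial ix f + coord iy * partial iy f :> C.
  by rewrite /planar_der !scale1r !scale0r subr0 add0r.
have der0 : planar_der 1 0 0 = 0 :> C by rewrite derE !linear0 !mulr0 addr0.
have derc r : planar_der 1 0 (sconst r) = 0 :> C.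
  by rewrite derE !partial_sconst !mulr0 addr0.
have derx r : planar_der 1 0 (r *: coord ix) = r *: coord ix :> C.
  by rewrite derE !linearZ /= !partial_coord /= scaler0 mulr0 addr0 smoothfun_scaleAr mulr1.
have dery r : planar_der 1 0 (r *: coord iy) = r *: coord iy :> C.
  by rewrite derE !linearZ /= !partial_coord /= scaler0 mulr0 add0r smoothfun_scaleAr mulr1.
apply: mvf3_ext => i j k; rewrite lie_planar_set3 mvf0E s1 s0 !span4_set3.
case: i; case: j; case: k; rewrite ?(derx, dery, derc, der0) ?addn0 ?add0n;
  rewrite ?(mul0r, mulr0, mul1r, subr0, addr0, subrr) //.
Qed.

(** The span is invariant under planar dilations and under translations in [z]; the product of E and
    d/dz is reduced to these two by the Leibniz rule. *)
Lemma schouten_span (P Q : mvf) : representative P -> representative Q -> schouten P Q = 0 :> mvf.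
Proof.
move=> [a [b [c [e ->]]]] rQ.
have EQ := schouten_euler_span rQ.
have ZQ : schouten dz Q = 0 by rewrite schouten_mvf_partial; exact: partial_z_span.
have EZQ : schouten (wedge euler dz) Q = 0.
  rewrite schouten_wedge1l; last exact: euler_homogeneous.
  by rewrite EQ ZQ !wedge0r addr0.
rewrite !schoutenDl !schoutenZl.
by rewrite EQ ZQ EZQ schouten_fun1 !scaler0 !addr0.
Qed.

End Span.

(** * The cohomology of the spiral Poisson structure *)

Section TupleSums.
Variables (V : nmodType) (T : Type).

Lemma sum_tuple1 (F : 'I_1 -> T -> V) (x : T) :
  \sum_(i < 1) F i (tnth [tuple x] i) = F ord0 x.
Proof. by rewrite big_ord_recl big_ord0 addr0. Qed.

Lemma sum_tuple2 (F : 'I_2 -> T -> V) (x y : T) :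
  \sum_(i < 2) F i (tnth [tuple x; y] i) = F ord0 x + F (lift ord0 ord0) y.
Proof. by rewrite !big_ord_recl big_ord0 addr0. Qed.

End TupleSums.

Section Cohomology.
Context {R : realType}.
Local Notation C := (smoothfun R 3).
Local Notation mvf := (mvf R 3).
Variables (tau : R) (tau_gt0 : 0 < tau).
Implicit Types (a b c e r : R) (k : nat) (P Q : mvf) (f : C).

Local Notation pi := (pi_tau tau).
Local Notation d := (schouten pi).
Local Notation cocycle k := (cocycle_pred pi k).

Let pi_planar : pi = wedge (planar_field tau 1) dz.
Proof. by rewrite /pi_tau /planar_field scale1r. Qed.

Let hX : homogeneous 1 (planar_field tau 1).
Proof. exact: planar_field_homogeneous. Qed.

Let hZ : homogeneous 1 (dz : mvf).
Proof. exact: mvf_partial_homogeneous. Qed.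

Let XZ : schouten (planar_field tau 1) dz = 0.
Proof. exact: schouten_planar_dz. Qed.

Lemma poisson_pi_tau : poisson pi.
Proof.
split; first exact: pi_tau_homogeneous.
by rewrite pi_planar; exact: (schouten_pair_self hX hZ XZ).
Qed.

Let dd P : d (d P) = 0.
Proof. by rewrite pi_planar; exact: (schouten_pair_pair hX hZ XZ). Qed.

Let dw P Q : d (wedge P Q) = wedge (d P) Q + wedge (parity P) (d Q).
Proof. by rewrite pi_planar; exact: (schouten_pair_wedge hX hZ). Qed.

Let ds P Q : d (schouten P Q) = schouten (d P) Q - schouten (parity P) (d Q).
Proof. by rewrite pi_planar; exact: (schouten_pair_schouten hX hZ). Qed.

Lemma pi_tau_operations p q P Q : P \in cocycle p -> Q \in cocycle q ->
  (wedge P Q \in cocycle (p + q)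
   /\ cup (coh_class pi p P) (coh_class pi q Q) = coh_class pi (p + q) (wedge P Q))
  /\ (schouten P Q \in cocycle (p + q).-1
   /\ cbracket (coh_class pi p P) (coh_class pi q Q)
      = coh_class pi (p + q).-1 (schouten P Q)).
Proof.
move=> kP kQ; split; split; [exact: wedge_cocycle|exact: cup_coh_class|
  exact: schouten_cocycle|exact: cbracket_coh_class].
Qed.

Lemma d_span4 a b c e : d (span4 a b c e) = 0.
Proof.
have D0 r : linder (spiral_field tau) (sconst r) = 0 :> C.
  by rewrite linder_spiralE !partial_sconst !mulr0 addr0.
have Dx r : lie_x tau (r *: coord ix) (r *: coord iy) = 0 :> C.
  rewrite /lie_x linder_spiralE !linearZ /= !partial_coord /= scaler0 mulr0 addr0.
  by rewrite !scale_smoothfun; ring.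
have Dy r : lie_y tau (r *: coord ix) (r *: coord iy) = 0 :> C.
  rewrite /lie_y linder_spiralE !linearZ /= !partial_coord /= scaler0 mulr0 add0r.
  by rewrite !scale_smoothfun; ring.
have pz i r : i != iz -> partial iz (r *: coord i) = 0 :> C.
  by move=> /negPf iz0; rewrite linearZ /= partial_coord iz0 scaler0.
have D00 : linder (spiral_field tau) (0 : C) = 0 by exact: linear0.
have [[e1 e2 e3 e4] [e5 e6 e7 e8]] := d_set3 tau (span4 a b c e).
apply: mvf3_ext => -[] [] []; rewrite mvf0E ?(e1, e2, e3, e4, e5, e6, e7, e8) ?span4_set3.
- by rewrite !pz // !mulr0 D00 scaler0 !subr0 addr0.
- by rewrite !pz // !mulr0 subr0.
- by rewrite partial_sconst mulr0 Dx addr0.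
- by rewrite partial_sconst mulr0.
- by rewrite partial_sconst mulr0 Dy addr0.
- by rewrite partial_sconst mulr0.
- by rewrite D0 oppr0.
- by [].
Qed.

Lemma span4_cocycle k a b c e : homogeneous k (span4 a b c e : mvf) -> span4 a b c e \in cocycle k.
Proof. by move=> hS; apply/cocycleP; split=> //; exact: d_span4. Qed.

Lemma homogeneous_gt3 k P : (3 < k)%N -> homogeneous k P -> P = 0.
Proof.
move=> k3 /homogeneous3P hP; apply: mvf3_ext => a b c; rewrite mvf0E hP //.
by rewrite neq_ltn (leq_ltn_trans _ k3) //; case: a; case: b; case: c.
Qed.

Lemma cocycle_span k P : P \in cocycle k -> exists a b c e Q,
  [/\ homogeneous k (span4 a b c e : mvf), primitive_degree k Q & P = span4 a b c e + d Q].
Proof.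
move=> /cocycleP[hP dP]; have prim0 : primitive_degree k (0 : mvf) by move=> I _; exact: mvf0E.
case: k hP prim0 => [|[|[|[|k]]]] hP prim0.
- have [a ->] := cocycle0_const tau_gt0 hP dP; exists a, 0, 0, 0, 0; split=> //.
    exact/span4_homogeneousP.
  by rewrite linear0 addr0.
- have [b [c [Q [hQ ->]]]] := cocycle1_exact tau_gt0 hP dP; exists 0, b, c, 0, Q; split=> //.
  exact/span4_homogeneousP.
- have [e [Q [hQ ->]]] := cocycle2_exact tau_gt0 hP dP; exists 0, 0, 0, e, Q; split=> //.
  exact/span4_homogeneousP.
- have [Q hQ ->] := cocycle3_exact tau_gt0 hP; exists 0, 0, 0, 0, Q; split=> //.
    exact/span4_homogeneousP.
  by rewrite span4_0 add0r.
(* Above degree 3 there are no nonzero multivector fields on R^3. *)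
- exists 0, 0, 0, 0, 0; split=> //; first exact/span4_homogeneousP.
  by rewrite span4_0 linear0 addr0; exact: (homogeneous_gt3 _ hP).
Qed.

Lemma span4_exact k a b c e Q : homogeneous k (span4 a b c e : mvf) -> primitive_degree k Q ->
  span4 a b c e = d Q -> span4 a b c e = 0 :> mvf.
Proof.
case: k => [|[|[|k]]] hS hQ E.
(* In degree 0 a primitive is 0, since no set has [#|I|.+1 = 0]. *)
- by rewrite E (_ : Q = 0) ?linear0 //; apply/ffunP => I; rewrite hQ // mvf0E.
- have [a0 _ _ e0] := (span4_homogeneousP 1 a b c e).1 hS.
  move: E; rewrite a0 // e0 // => /span4_1_exact[-> ->]; exact: span4_0.
- have [a0 b0 c0 _] := (span4_homogeneousP 2 a b c e).1 hS.
  move: E; rewrite a0 // b0 // c0 // => /span4_2_exact->; exact: span4_0.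
- have [-> // -> // -> // -> //] := (span4_homogeneousP k.+3 a b c e).1 hS; exact: span4_0.
Qed.

Lemma span4_class_inj k a b c e a' b' c' e' :
  homogeneous k (span4 a b c e : mvf) -> homogeneous k (span4 a' b' c' e' : mvf) ->
  coh_class pi k (span4 a b c e) = coh_class pi k (span4 a' b' c' e') ->
  [/\ a = a', b = b', c = c' & e = e'].
Proof.
move=> hS hS' /(coh_class_eqP (span4_cocycle hS) (span4_cocycle hS'))[Q hQ E].
apply: span4_coef; apply/eqP; rewrite -subr_eq0 span4B; apply/eqP.
apply: (span4_exact _ hQ); last by rewrite -span4B.
by move=> I I2; rewrite -span4B mvfBE hS // hS' // subrr.
Qed.

Lemma class_span k (h : cohomology pi k) : exists a b c e,
  homogeneous k (span4 a b c e : mvf) /\ h = coh_class pi k (span4 a b c e).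
Proof.
have [kr <-] := coh_reprP h.
have [a [b [c [e [Q [hS hQ E]]]]]] := cocycle_span kr; exists a, b, c, e; split; first exact: hS.
apply/(coh_class_eqP kr (span4_cocycle hS)); exists Q; first exact: hQ.
by rewrite E addrC addKr.
Qed.

Lemma representative_unique k (h : cohomology pi k) :
  exists! P, [/\ representative P, P \in cocycle k & h = coh_class pi k P].
Proof.
have [a [b [c [e [hS ->]]]]] := class_span h; exists (span4 a b c e); split.
  by split=> //; [exists a, b, c, e|exact: span4_cocycle].
move=> P [[a' [b' [c' [e' ->]]]]]; rewrite -/(span4 a' b' c' e') => /cocycleP[hS' _].
by move=> /(span4_class_inj hS hS')[-> -> -> ->].
Qed.

Lemma representative_operations P Q : representative P -> representative Q ->
  representative (wedge P Q) /\ representative (schouten P Q).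
Proof.
move=> rP rQ; rewrite schouten_span //; split; last first.
  by exists 0, 0, 0, 0; exact/esym/span4_0.
move: rP rQ => [a [b [c [e ->]]]] [a' [b' [c' [e' ->]]]].
rewrite -/(span4 a b c e) -/(span4 a' b' c' e') span4_wedge.
by do 4 eexists.
Qed.

Lemma cohomology3_eq0 (h : cohomology pi 3) : h = 0.
Proof.
have [a [b [c [e [hS ->]]]]] := class_span h.
have [-> // -> // -> // -> //] := (span4_homogeneousP 3 a b c e).1 hS.
by rewrite span4_0 coh_class0.
Qed.

Lemma mvf_fun_sconst r : mvf_fun (sconst r) = span4 r 0 0 0 :> mvf.
Proof.
apply: mvf3_ext => i j k; rewrite span4_set3 ffunE set0_set3 set3_inj.
by case: i; case: j; case: k; rewrite /= ?scale0r ?[sconst 0]scale0r.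
Qed.

Lemma mvf_fun_homogeneous f : homogeneous 0 (mvf_fun f : mvf).
Proof. by move=> I I0; rewrite ffunE ifN // -cards_eq0. Qed.

Lemma casimir_pi_tau f : casimir pi f <-> exists r, f = sconst r.
Proof.
split=> [df|[r ->]]; last by rewrite /casimir mvf_fun_sconst; exact: d_span4.
have [a E] := cocycle0_const tau_gt0 (mvf_fun_homogeneous f) df; exists a.
have := congr1 (fun P : mvf => P (set3 false false false)) E.
by rewrite span4_set3 ffunE set0_set3 eqxx.
Qed.

(** Casimirs being constants, freeness over them becomes linear independence over R. *)
Lemma casimir_act_sconst r k P : P \in cocycle k ->
  casimir_act (sconst r) (coh_class pi k P) = r *: coh_class pi k P.
Proof.
move=> kP; have kr : mvf_fun (sconst r) \in cocycle 0.
  by apply/cocycleP; split; [exact: mvf_fun_homogeneous|rewrite mvf_fun_sconst; exact: d_span4].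
rewrite /casimir_act (cup_coh_class dw kr kP) -(coh_classZ r kP); congr coh_class.
by apply/ffunP => I; rewrite mvfZE wedge_funl -scale_smoothfun.
Qed.

Lemma euler_cocycle : euler \in cocycle 1.
Proof.
rewrite (_ : euler = span4 0 1 0 0); first by apply/span4_cocycle/span4_homogeneousP.
by rewrite /span4 !scale0r scale1r add0r !addr0.
Qed.

Lemma dz_cocycle : dz \in cocycle 1.
Proof.
rewrite (_ : dz = span4 0 0 1 0); first by apply/span4_cocycle/span4_homogeneousP.
by rewrite /span4 !scale0r scale1r !add0r !addr0.
Qed.

Lemma cohomology0_basis (h : cohomology pi 0) : exists! r, h = r *: coh_class pi 0 (mvf_fun 1).
Proof.
have sconst1 : mvf_fun 1 = span4 1 0 0 0 :> mvf by rewrite /span4 !scale0r scale1r !addr0.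
have S0 r : homogeneous 0 (span4 r 0 0 0 : mvf) by exact/span4_homogeneousP.
have rE r : r *: coh_class pi 0 (mvf_fun 1) = coh_class pi 0 (span4 r 0 0 0).
  rewrite -coh_classZ; last by rewrite sconst1; exact: span4_cocycle.
  by congr coh_class; rewrite /span4 !scale0r !addr0.
have [a [b [c [e [hS ->]]]]] := class_span h.
have [_ b0 c0 e0] := (span4_homogeneousP 0 a b c e).1 hS.
move: hS; rewrite b0 // c0 // e0 // => hS; exists a; split; first by rewrite rE.
by move=> r; rewrite rE => /(span4_class_inj hS (S0 r))[].
Qed.

Lemma cohomology1_basis : free_basis [tuple coh_class pi 1 euler; coh_class pi 1 dz].
Proof.
have S1 b c : homogeneous 1 (span4 0 b c 0 : mvf) by exact/span4_homogeneousP.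
have sumE (f : {ffun 'I_2 -> C}) (b c : R) : f ord0 = sconst b -> f (lift ord0 ord0) = sconst c ->
    \sum_(i < 2) casimir_act (f i) (tnth [tuple coh_class pi 1 euler; coh_class pi 1 dz] i) =
    coh_class pi 1 (span4 0 b c 0).
  move=> fb fc; rewrite (sum_tuple2 (fun i => @casimir_act _ _ _ (f i) _)) fb fc.
  rewrite (casimir_act_sconst b euler_cocycle) (casimir_act_sconst c dz_cocycle).
  rewrite -(coh_classZ c dz_cocycle) -(coh_classP b euler_cocycle (rpredZ c dz_cocycle)).
  by congr coh_class; rewrite /span4 !scale0r add0r addr0.
move=> h; have [a [b [c [e [hS ->]]]]] := class_span h.
have [a0 _ _ e0] := (span4_homogeneousP 1 a b c e).1 hS.
move: hS; rewrite a0 // e0 // => hS.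
exists [ffun i => sconst (if i == ord0 then b else c)]; split; first split.
- by move=> i; apply/casimir_pi_tau; rewrite ffunE; eexists.
- by rewrite (sumE _ b c) // ffunE.
move=> f [cas_f]; have /casimir_pi_tau[b' fb] := cas_f ord0.
have /casimir_pi_tau[c' fc] := cas_f (lift ord0 ord0).
rewrite (sumE _ _ _ fb fc) => /(span4_class_inj hS (S1 b' c'))[_ -> -> _].
apply/ffunP => i; rewrite ffunE; case: (unliftP ord0 i) => [j ->|->]; last by rewrite eqxx fb.
by rewrite ord1 fc.
Qed.

Lemma euler_dz_cocycle : wedge euler dz \in cocycle 2.
Proof. by have [[]] := pi_tau_operations euler_cocycle dz_cocycle. Qed.

Lemma cohomology2_basis : free_basis [tuple coh_class pi 2 (wedge euler dz)].
Proof.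
have S2 e : homogeneous 2 (span4 0 0 0 e : mvf) by exact/span4_homogeneousP.
have sumE (f : {ffun 'I_1 -> C}) (e : R) : f ord0 = sconst e ->
    \sum_(i < 1) casimir_act (f i) (tnth [tuple coh_class pi 2 (wedge euler dz)] i) =
    coh_class pi 2 (span4 0 0 0 e).
  move=> fe; rewrite (sum_tuple1 (fun i => @casimir_act _ _ _ (f i) _)) fe.
  rewrite (casimir_act_sconst e euler_dz_cocycle) -(coh_classZ e euler_dz_cocycle).
  by congr coh_class; rewrite /span4 !scale0r !add0r.
move=> h; have [a [b [c [e [hS ->]]]]] := class_span h.
have [a0 b0 c0 _] := (span4_homogeneousP 2 a b c e).1 hS.
move: hS; rewrite a0 // b0 // c0 // => hS.
exists [ffun => sconst e]; split; first split.
- by move=> i; apply/casimir_pi_tau; rewrite ffunE; eexists.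
- by rewrite (sumE _ e) // ffunE.
move=> f [cas_f]; have /casimir_pi_tau[e' fe] := cas_f ord0.
rewrite (sumE _ _ fe) => /(span4_class_inj hS (S2 e'))[_ _ _ ->].
by apply/ffunP => i; rewrite ffunE ord1 fe.
Qed.

End Cohomology.

Theorem mainTheorem6 (R : realType) (tau : R) (tau_gt0 : 0 < tau) :
  let pi := pi_tau tau in
  poisson pi
  (* H^0 *)
  /\ ((forall f : smoothfun R 3,
         casimir pi f <-> exists c : R, forall v : 'rV[R]_3, f v = c)
      /\ (forall h : cohomology pi 0,
            exists! c : R, h = c *: coh_class pi 0 (mvf_fun 1)))
  (* H^1 *)
  /\ (euler \in cocycle_pred pi 1 /\ dz \in cocycle_pred pi 1
      /\ free_basis [tuple coh_class pi 1 euler; coh_class pi 1 dz])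
  (* H^2 *)
  /\ (wedge euler dz \in cocycle_pred pi 2
      /\ free_basis [tuple coh_class pi 2 (wedge euler dz)])
  (* H^3 *)
  /\ (forall h : cohomology pi 3, h = 0)
  (* the operations on cohomology are induced by those on cocycles *)
  /\ (forall (p q : nat) (P Q : mvf R 3),
        P \in cocycle_pred pi p -> Q \in cocycle_pred pi q ->
        (wedge P Q \in cocycle_pred pi (p + q)
         /\ cup (coh_class pi p P) (coh_class pi q Q)
            = coh_class pi (p + q) (wedge P Q))
        /\ (schouten P Q \in cocycle_pred pi (p + q).-1
            /\ cbracket (coh_class pi p P) (coh_class pi q Q)
               = coh_class pi (p + q).-1 (schouten P Q)))
  (* every class has a unique representative in the span of 1, E, d/dz and
     E /\ d/dz, and this span is closed under both operations *)
  /\ (forall (k : nat) (h : cohomology pi k),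
        exists! P : mvf R 3,
          [/\ representative P, P \in cocycle_pred pi k & h = coh_class pi k P])
  /\ (forall P Q : mvf R 3, representative P -> representative Q ->
        representative (wedge P Q) /\ representative (schouten P Q)).
Proof.
split; first exact: poisson_pi_tau.
split; first split.
- move=> f; apply: (iff_trans (casimir_pi_tau tau_gt0 f)).
  split=> -[r fr]; exists r; first by move=> v; rewrite fr sconstE.
  by apply: sfunP => v; rewrite fr sconstE.
- exact: (cohomology0_basis tau_gt0).
split; first by split; [exact: euler_cocycle|split; [exact: dz_cocycle|exact: (cohomology1_basis tau_gt0)]].
split; first by split; [exact: euler_dz_cocycle|exact: (cohomology2_basis tau_gt0)].
split; first exact: (cohomology3_eq0 tau_gt0).
split; first exact: pi_tau_operations.
split; first exact: (representative_unique tau_gt0).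
exact: representative_operations.
Qed.
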